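(* Let $k$ be a real number, let $\Gamma$ be a finite index subgroup of $\mathrm{SL}_2(\mathbb{Z})$, and let $f$ be a non-zero modular function of weight $k$ for $\Gamma$ (with respect to some automorphy factors) which is holomorphic on the upper half plane $\mathfrak{H}$. If $k\geqslant0$ and $f$ is not finite at the cusps, then $f$ is strongly non-lacunary.
   Context: Expansions. For $r\in\mathbb{R}$ let $\mathfrak{H}_r=\{z\in\mathbb{C} : \mathrm{Im}(z)>r\}$, and let $\mathfrak{H}=\mathfrak{H}_0$. Let $g$ be holomorphic on some $\mathfrak{H}_r$ and suppose there are a real $h>0$ and $u\in\mathbb{C}$ with $|u|=1$ and $g(z+h)=u\,g(z)$ for all $z\in\mathfrak{H}_r$. Then $g$ has a unique expansion $g(z)=\sum_{\lambda\in\Lambda}a(\lambda)e^{2\pi i\lambda z}$, where $\Lambda=\{\lambda\in\mathbb{R} : e^{2\pi i\lambda h}=u\}$, called the expansion of $g$ at $\infty$. We say $g$ has finite order at $\infty$ if $\{\lambda<0 : a(\lambda)\neq0\}$ is finite, and that $g$ is finite at $\infty$ if $a(\lambda)=0$ for all $\lambda<0$. If $g$ has finite order at $\infty$, its expansion at $\infty$ is strongly non-lacunary if there is a non-constant arithmetic progression $\Lambda'=\lambda_0+mh^{-1}\mathbb{N}$ (with $m\ge1$ an integer) contained in $\Lambda$ such that $a(\lambda)\ne0$ for all $\lambda\in\Lambda'$. These notions do not depend on the choice of $h$ and $u$. Modular functions. For $z\in\mathbb{C}^*$, $z^k=e^{k\log z}$ with the imaginary part of $\log z$ in $]-\pi,\pi]$.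 A meromorphic function $f$ on $\mathfrak{H}$ is a modular function of weight $k$ for $\Gamma$ if: (a) for each $\gamma=\begin{pmatrix}a&b\\c&d\end{pmatrix}\in\Gamma$, $f(\gamma z)=j(\gamma,z)f(z)$, where $\gamma z=\frac{az+b}{cz+d}$ and $j(\gamma,\cdot)$ (the automorphy factor) is a holomorphic function on $\mathfrak{H}$ with $|j(\gamma,z)|=|cz+d|^k$; (b) for any $\begin{pmatrix}a&b\\c&d\end{pmatrix}\in\mathrm{SL}_2(\mathbb{Z})$, the function $z\mapsto(cz+d)^{-k}f\left(\frac{az+b}{cz+d}\right)$ is holomorphic on some half plane $\mathfrak{H}_r$ (hence, by (a), it satisfies the conditions on $g$ above) and it has finite order at $\infty$. The modular function $f$ is finite at the cusps if moreover $z\mapsto(cz+d)^{-k}f\left(\frac{az+b}{cz+d}\right)$ is finite at $\infty$ for every $\begin{pmatrix}a&b\\c&d\end{pmatrix}\in\mathrm{SL}_2(\mathbb{Z})$. A modular function is said to be strongly non-lacunary if its expansion at $\infty$ is strongly non-lacunary. *)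

(* Defs.v *)
From Stdlib Require Import Reals ZArith Lia List.
From Coquelicot Require Import Coquelicot.
Import ListNotations.
Open Scope R_scope.

(** ** Complex exponential, principal logarithm and real powers *)

Definition Cexp (z : C) : C := (exp (Re z) * cos (Im z), exp (Re z) * sin (Im z)).

(** Takes its values in ]-PI, PI] for [z <> 0]; the negative real axis goes to
    [acos (-1) = PI]. *)
Definition Carg (z : C) : R :=
  if Rle_dec 0 (Im z) then acos (Re z / Cmod z) else - acos (Re z / Cmod z).

Definition Clog (z : C) : C := (ln (Cmod z), Carg z).

Definition Cpowr (z : C) (k : R) : C := Cexp (k * Clog z)%C.

(** ** Holomorphic and meromorphic functions *)

Definition half_plane (r : R) (z : C) : Prop := r < Im z.

(** [holomorphic_on] is only used on open sets. *)
Definition holomorphic_on (D : C -> Prop) (f : C -> C) : Prop :=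
  forall z, D z -> ex_derive (K := C_AbsRing) (V := C_NormedModule) f z.

Definition holomorphic_at (f : C -> C) (z0 : C) : Prop :=
  locally z0 (fun z : C => ex_derive (K := C_AbsRing) (V := C_NormedModule) f z).

(** A meromorphic function is represented by a total function whose values at
    its poles are irrelevant. *)
Definition meromorphic_on (D : C -> Prop) (f : C -> C) : Prop :=
  forall z0, D z0 -> exists (n : nat) (phi : C -> C),
    holomorphic_at phi z0 /\
    locally' z0 (fun z : C => (Cpow (z - z0) n * f z)%C = phi z).

(** ** Expansions at infinity *)

(** Unordered summation: the finite partial sums of [F] over subsets of [D]
    converge to [s] along the directed set of finite subsets of [D]. *)
Definition is_sum_over {T : Type} (D : T -> Prop) (F : T -> C) (s : C) : Prop :=
  forall eps : R, 0 < eps ->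
  exists l0 : list T, List.Forall D l0 /\
    forall l : list T, NoDup l -> List.Forall D l -> incl l0 l ->
      Cmod (fold_right Cplus (RtoC 0) (map F l) - s)%C < eps.

Definition exponents (h : R) (u : C) (lam : R) : Prop :=
  Cexp (2 * PI * Ci * lam * h)%C = u.

Definition quasi_periodic_on (g : C -> C) (r h : R) (u : C) : Prop :=
  holomorphic_on (half_plane r) g /\ 0 < h /\ Cmod u = 1 /\
  forall z, half_plane r z -> g (z + h)%C = (u * g z)%C.

(** [a] is the coefficient function of the expansion of [g] relative to [h] and
    [u]; its values outside [exponents h u] are irrelevant. *)
Definition is_expansion (g : C -> C) (h : R) (u : C) (a : R -> C) : Prop :=
  exists r : R, quasi_periodic_on g r h u /\
    forall z, half_plane r z ->
      is_sum_over (exponents h u)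
        (fun lam => a lam * Cexp (2 * PI * Ci * lam * z))%C (g z).

Definition finite_order_coeffs (h : R) (u : C) (a : R -> C) : Prop :=
  exists l : list R, forall lam,
    exponents h u lam -> lam < 0 -> a lam <> RtoC 0 -> In lam l.

Definition nonlacunary_coeffs (h : R) (u : C) (a : R -> C) : Prop :=
  exists (lam0 : R) (m : nat), (1 <= m)%nat /\
    forall n : nat,
      exponents h u (lam0 + INR m * / h * INR n) /\
      a (lam0 + INR m * / h * INR n) <> RtoC 0.

(** The expansion is unique once [h] and [u] are chosen, and the three notions
    below do not depend on that choice, so [h], [u] and [a] are quantified
    existentially. *)
Definition finite_order_at_infty (g : C -> C) : Prop :=
  exists (h : R) (u : C) (a : R -> C),
    is_expansion g h u a /\ finite_order_coeffs h u a.

Definition finite_at_infty (g : C -> C) : Prop :=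
  exists (h : R) (u : C) (a : R -> C),
    is_expansion g h u a /\
    forall lam, exponents h u lam -> lam < 0 -> a lam = RtoC 0.

Definition strongly_non_lacunary (g : C -> C) : Prop :=
  exists (h : R) (u : C) (a : R -> C),
    is_expansion g h u a /\ finite_order_coeffs h u a /\
    nonlacunary_coeffs h u a.

(** ** The group SL_2(Z) and its action *)

Record SL2Z : Type := mkSL2Z {
  ma : Z; mb : Z; mc : Z; md : Z;
  SL2Z_det : (ma * md - mb * mc = 1)%Z
}.

Definition SL2Z_one : SL2Z := mkSL2Z 1 0 0 1 eq_refl.

Lemma SL2Z_mul_det (g g' : SL2Z) :
  ((ma g * ma g' + mb g * mc g') * (mc g * mb g' + md g * md g')
   - (ma g * mb g' + mb g * md g') * (mc g * ma g' + md g * mc g') = 1)%Z.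
Proof.
  transitivity ((ma g * md g - mb g * mc g) * (ma g' * md g' - mb g' * mc g'))%Z.
  - ring.
  - rewrite !SL2Z_det; reflexivity.
Qed.

Definition SL2Z_mul (g g' : SL2Z) : SL2Z :=
  mkSL2Z (ma g * ma g' + mb g * mc g') (ma g * mb g' + mb g * md g')
         (mc g * ma g' + md g * mc g') (mc g * mb g' + md g * md g')
         (SL2Z_mul_det g g').

Lemma SL2Z_inv_det (g : SL2Z) : (md g * ma g - (- mb g) * (- mc g) = 1)%Z.
Proof. rewrite <- (SL2Z_det g); ring. Qed.

Definition SL2Z_inv (g : SL2Z) : SL2Z :=
  mkSL2Z (md g) (- mb g) (- mc g) (ma g) (SL2Z_inv_det g).

Definition is_subgroup (G : SL2Z -> Prop) : Prop :=
  G SL2Z_one /\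
  (forall g g', G g -> G g' -> G (SL2Z_mul g g')) /\
  (forall g, G g -> G (SL2Z_inv g)).

(** Finitely many right cosets [G r] cover SL_2(Z). *)
Definition finite_index (G : SL2Z -> Prop) : Prop :=
  exists l : list SL2Z, forall g, exists r, In r l /\ G (SL2Z_mul g (SL2Z_inv r)).

Definition denom (g : SL2Z) (z : C) : C := (IZR (mc g) * z + IZR (md g))%C.

Definition moebius (g : SL2Z) (z : C) : C :=
  ((IZR (ma g) * z + IZR (mb g)) / denom g z)%C.

(** [slash k f g] is z |-> (cz+d)^(-k) f((az+b)/(cz+d)). *)
Definition slash (k : R) (f : C -> C) (g : SL2Z) (z : C) : C :=
  (Cpowr (denom g z) (- k) * f (moebius g z))%C.

(** ** Modular functions *)

(** The functional equation is an identity between meromorphic functions, hence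
    only required where both sides are holomorphic. *)
Definition automorphic (k : R) (G : SL2Z -> Prop) (f : C -> C)
    (j : SL2Z -> C -> C) : Prop :=
  forall g, G g ->
    holomorphic_on (half_plane 0) (j g) /\
    forall z, half_plane 0 z ->
      Cmod (j g z) = Rpower (Cmod (denom g z)) k /\
      (holomorphic_at f z -> holomorphic_at f (moebius g z) ->
       f (moebius g z) = (j g z * f z)%C).

Definition modular_function (k : R) (G : SL2Z -> Prop) (f : C -> C) : Prop :=
  meromorphic_on (half_plane 0) f /\
  (exists j : SL2Z -> C -> C, automorphic k G f j) /\
  forall g : SL2Z,
    (exists r : R, holomorphic_on (half_plane r) (slash k f g)) /\
    finite_order_at_infty (slash k f g).

Definition finite_at_cusps (k : R) (f : C -> C) : Prop :=
  forall g : SL2Z, finite_at_infty (slash k f g).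

(* Main.v *)
(** Circle method.  At a cusp [x = -d/c] where the slash of [f] has a pole of order [nu],
    [f] behaves like [beta (z - x)^(-k) exp (2 pi i M / (z - x))] with [M = nu / c^2].  Only the
    cusps with the largest value of [M] matter: there are finitely many of them modulo the period
    [N] of the automorphy at infinity, and the values of [nu / c^2] at all others stay below some
    [M' < M].  Write the coefficient of [exp (2 pi i lam z)] as an integral over the horizontal
    segment at the saddle point height [y], where [lam = M / y^2].  The dominant cusps all
    contribute the same integral [I] over a short arc, so the coefficient is
    [S (lam) y^(1-k) I] up to an exponentially smaller error, where
    [S (lam) = sum_j beta_j exp (- 2 pi i lam x_j)] runs over the dominant cusps [x_j] in [[0, N[].
    As the [x_j] are rational, [|S|] is periodic along the exponents, and it does not vanish
    identically because distinct characters are linearly independent.  Hence [S] is bounded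
    below along an arithmetic progression, and so the coefficients are non-zero there from some point on. *)

Require Import Defs.
From Stdlib Require Import Reals ZArith Lia List Lra Psatz.
From Stdlib Require Import Classical ClassicalEpsilon FunctionalExtensionality Eqdep_dec Wf_nat.
From Coquelicot Require Import Coquelicot.
Import ListNotations.
Open Scope R_scope.

(** * Complex analysis *)

(** Two opposite demands fix the length of the arcs. At [z = x + y (s + i)] the integrand near a
    dominant cusp [x] has modulus about [exp (2 (2 pi M / y) - 2 pi M s^2 / y)] and phase about
    [2 pi M s^3 / y]. The half-width in [s] must be large against [y^(1/2)], so that the complement
    is exponentially smaller, and small against [y^(1/3)], so that the integrand does not turn and
    cancel itself. The width [y^(2/5)] satisfies both, and with [y = t^5] all powers become
    integral. No asymptotic formula for [I] is then needed: the errors carry a factor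
    [exp (- kap / t)], so a lower bound of [|I|] by a power of [t] is enough.

    Slashes by elements of one coset are only compared in modulus, since the automorphy factors and
    the principal powers differ by unimodular factors. Moduli suffice for orders and for upper
    bounds; true phases matter only at the dominant cusps, where the constants [beta_j] absorb
    them. *)

Lemma C_ext (z w : C) : Re z = Re w -> Im z = Im w -> z = w.
Proof. destruct z, w; unfold Re, Im; simpl; intros; subst; reflexivity. Qed.

Lemma Re_plus (z w : C) : Re (z + w) = Re z + Re w. Proof. reflexivity. Qed.
Lemma Im_plus (z w : C) : Im (z + w) = Im z + Im w. Proof. reflexivity. Qed.
Lemma Re_mult (z w : C) : Re (z * w) = Re z * Re w - Im z * Im w. Proof. reflexivity. Qed.
Lemma Im_mult (z w : C) : Im (z * w) = Re z * Im w + Im z * Re w. Proof. reflexivity. Qed.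
Lemma Re_opp (z : C) : Re (- z) = - Re z. Proof. reflexivity. Qed.
Lemma Im_opp (z : C) : Im (- z) = - Im z. Proof. reflexivity. Qed.
Lemma Re_minus (z w : C) : Re (z - w) = Re z - Re w. Proof. reflexivity. Qed.
Lemma Im_minus (z w : C) : Im (z - w) = Im z - Im w. Proof. reflexivity. Qed.
Lemma Re_RtoC (x : R) : Re (RtoC x) = x. Proof. reflexivity. Qed.
Lemma Im_RtoC (x : R) : Im (RtoC x) = 0. Proof. reflexivity. Qed.
Lemma Re_Ci : Re Ci = 0. Proof. reflexivity. Qed.
Lemma Im_Ci : Im Ci = 1. Proof. reflexivity. Qed.

Global Hint Rewrite Re_plus Im_plus Re_mult Im_mult Re_opp Im_opp Re_minus Im_minus
  Re_RtoC Im_RtoC Re_Ci Im_Ci : reim.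

Lemma Re_pair (x y : R) : Re (x, y) = x. Proof. reflexivity. Qed.
Lemma Im_pair (x y : R) : Im (x, y) = y. Proof. reflexivity. Qed.
Global Hint Rewrite Re_pair Im_pair : reim.

Ltac reim := autorewrite with reim.

Lemma pair_eq_C (x y : R) : (x, y) = (x + Ci * y)%C.
Proof. apply C_ext; reim; ring. Qed.

Lemma Cmod_sqr (z : C) : Cmod z * Cmod z = Re z * Re z + Im z * Im z.
Proof. generalize (Cmod2_alt z); simpl; intro; lra. Qed.

Lemma Im_le_Cmod (z : C) : Rabs (Im z) <= Cmod z.
Proof.
  apply Rsqr_incr_0_var; [| apply Cmod_ge_0].
  rewrite <- Rsqr_abs. unfold Rsqr. rewrite Cmod_sqr. nra.
Qed.

Lemma Cmod_le_Re_Im (z : C) : Cmod z <= Rabs (Re z) + Rabs (Im z).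
Proof.
  apply Rsqr_incr_0_var.
  - unfold Rsqr. rewrite Cmod_sqr.
    pose proof (Rabs_pos (Re z)); pose proof (Rabs_pos (Im z)).
    pose proof (Rsqr_abs (Re z)); pose proof (Rsqr_abs (Im z)).
    unfold Rsqr in *. nra.
  - pose proof (Rabs_pos (Re z)); pose proof (Rabs_pos (Im z)); lra.
Qed.

Lemma Cmod_RtoC_mult (x : R) (z : C) : Cmod (x * z) = Rabs x * Cmod z.
Proof. rewrite Cmod_mult, Cmod_R. reflexivity. Qed.

Lemma Cmod_minus_sym (z w : C) : Cmod (z - w) = Cmod (w - z).
Proof. rewrite <- Cmod_opp. f_equal. ring. Qed.

Lemma Cmod_minus_triangle (a b c : C) : Cmod (a - c) <= Cmod (a - b) + Cmod (b - c).
Proof. replace (a - c)%C with ((a - b) + (b - c))%C by ring. apply Cmod_triangle. Qed.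

Lemma Cmod_triangle_sub (a b : C) : Cmod a <= Cmod b + Cmod (a - b).
Proof. replace a with (b + (a - b))%C at 1 by ring. apply Cmod_triangle. Qed.

Lemma Cmod_triangle_minus (a b : C) : Cmod (a - b) <= Cmod a + Cmod b.
Proof. unfold Cminus. eapply Rle_trans; [apply Cmod_triangle|]. rewrite Cmod_opp. lra. Qed.

Lemma Cexp_plus (z w : C) : Cexp (z + w) = (Cexp z * Cexp w)%C.
Proof.
  unfold Cexp. apply C_ext; reim;
  rewrite exp_plus, ?cos_plus, ?sin_plus; ring.
Qed.

Lemma Cexp_0 : Cexp 0 = 1.
Proof. unfold Cexp. simpl. rewrite exp_0, cos_0, sin_0. apply C_ext; simpl; ring. Qed.

Lemma Cmod_Cexp (z : C) : Cmod (Cexp z) = exp (Re z).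
Proof.
  apply Rsqr_inj; [apply Cmod_ge_0 | left; apply exp_pos |].
  unfold Rsqr. rewrite Cmod_sqr. unfold Cexp. reim.
  generalize (sin2_cos2 (Im z)); unfold Rsqr; intro H.
  transitivity (exp (Re z) * exp (Re z) * (sin (Im z) * sin (Im z) + cos (Im z) * cos (Im z))).
  ring. rewrite H; ring.
Qed.

Lemma Cexp_neq_0 (z : C) : Cexp z <> 0.
Proof. apply Cmod_gt_0. rewrite Cmod_Cexp. apply exp_pos. Qed.

Lemma Cexp_opp (z : C) : Cexp (- z) = (/ Cexp z)%C.
Proof.
  assert (H : (Cexp (- z) * Cexp z)%C = 1).
  { rewrite <- Cexp_plus. replace (- z + z)%C with (RtoC 0) by ring. apply Cexp_0. }
  pose proof (Cexp_neq_0 z).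
  replace (Cexp (- z)) with ((Cexp (- z) * Cexp z) / Cexp z)%C by (field; auto).
  rewrite H. field; auto.
Qed.

Lemma Cexp_RtoC (x : R) : Cexp x = exp x.
Proof. unfold Cexp. apply C_ext; reim; rewrite ?cos_0, ?sin_0; ring. Qed.

Definition ee (z : C) : C := Cexp (2 * PI * Ci * z).

Lemma ee_plus (z w : C) : ee (z + w) = (ee z * ee w)%C.
Proof. unfold ee. rewrite <- Cexp_plus. f_equal. ring. Qed.

Lemma ee_0 : ee 0 = 1.
Proof. unfold ee. rewrite <- Cexp_0. f_equal. ring. Qed.

Lemma ee_opp (z : C) : ee (- z) = (/ ee z)%C.
Proof. unfold ee. rewrite <- Cexp_opp. f_equal. ring. Qed.

Lemma ee_neq_0 (z : C) : ee z <> 0.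
Proof. apply Cexp_neq_0. Qed.

Lemma Cmod_ee (z : C) : Cmod (ee z) = exp (- (2 * PI * Im z)).
Proof. unfold ee. rewrite Cmod_Cexp. f_equal. reim. ring. Qed.

Lemma Cmod_ee_R (x : R) : Cmod (ee x) = 1.
Proof. rewrite Cmod_ee, Im_RtoC, Rmult_0_r, Ropp_0. apply exp_0. Qed.

Lemma ee_R (x : R) : ee x = (cos (2 * PI * x), sin (2 * PI * x)).
Proof.
  unfold ee, Cexp. apply C_ext; reim;
  replace (2 * PI * 0 * 0) with 0 by ring;
  match goal with |- exp ?a * ?f ?b = ?f ?c => replace a with 0 by ring; replace b with c by ring end;
  rewrite exp_0; ring.
Qed.

Lemma ee_nat (n : nat) : ee (INR n) = 1.
Proof.
  rewrite ee_R. apply C_ext; reim.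
  - replace (2 * PI * INR n) with (0 + 2 * INR n * PI) by ring. rewrite cos_period. apply cos_0.
  - replace (2 * PI * INR n) with (0 + 2 * INR n * PI) by ring. rewrite sin_period. apply sin_0.
Qed.

Lemma ee_IZR (n : Z) : ee (IZR n) = 1.
Proof.
  destruct (Z_le_dec 0 n) as [H|H].
  - rewrite <- (Z2Nat.id n) by assumption. rewrite <- INR_IZR_INZ. apply ee_nat.
  - replace n with (- Z.of_nat (Z.to_nat (- n)))%Z by lia.
    rewrite opp_IZR, <- INR_IZR_INZ, RtoC_opp, ee_opp, ee_nat. field.
Qed.

Lemma cos_eq_1_inv (x : R) : cos x = 1 -> exists n : Z, x = 2 * PI * IZR n.
Proof.
  intro H.
  assert (S : sin (x / 2) = 0).
  { replace x with (2 * (x / 2)) in H by field. rewrite cos_2a_sin in H.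
    replace (2 * sin (x / 2) * sin (x / 2)) with (2 * (sin (x/2) * sin (x/2))) in H by ring.
    nra. }
  destruct (sin_eq_0_0 _ S) as [n Hn]. exists n. lra.
Qed.

Lemma ee_R_eq_1 (x : R) : ee x = 1 -> exists n : Z, x = IZR n.
Proof.
  rewrite ee_R. intro H. injection H as H _.
  destruct (cos_eq_1_inv _ H) as [n Hn]. exists n.
  pose proof PI_RGT_0. apply Rmult_eq_reg_l with (2 * PI); lra.
Qed.

Lemma ee_R_inj (x y : R) : ee x = ee y -> exists n : Z, x = y + IZR n.
Proof.
  intro H. destruct (ee_R_eq_1 (x - y)) as [n Hn].
  - rewrite RtoC_minus. unfold Cminus. rewrite ee_plus, ee_opp, H. field. apply ee_neq_0.
  - exists n. lra.
Qed.

Lemma eq_of_sqr (x y : R) : x * x = y * y -> 0 <= x * y -> x = y.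
Proof.
  intros H H'. assert (E : (x - y) * (x + y) = 0) by lra.
  destruct (Rmult_integral _ _ E) as [E'|E']; [lra|].
  replace x with (- y) in H' by lra. assert (y = 0) by nra. lra.
Qed.

Lemma unit_polar (u : C) : Cmod u = 1 -> exists t : R, u = ee t.
Proof.
  intro H.
  assert (HH : Re u * Re u + Im u * Im u = 1) by (rewrite <- Cmod_sqr, H; ring).
  assert (Hr : -1 <= Re u <= 1) by nra.
  pose proof PI_RGT_0.
  assert (Hc : cos (acos (Re u)) = Re u) by (apply cos_acos; assumption).
  assert (Hs : sin (acos (Re u)) * sin (acos (Re u)) = Im u * Im u).
  { generalize (sin2_cos2 (acos (Re u))); unfold Rsqr. rewrite Hc. nra. }
  destruct (Rle_dec 0 (sin (acos (Re u)) * Im u)) as [L|L].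
  - exists (acos (Re u) / (2 * PI)). rewrite ee_R.
    replace (2 * PI * (acos (Re u) / (2 * PI))) with (acos (Re u)) by (field; lra).
    apply C_ext; reim; [auto|]. symmetry; apply eq_of_sqr; lra.
  - exists (- (acos (Re u) / (2 * PI))). rewrite ee_R.
    replace (2 * PI * - (acos (Re u) / (2 * PI))) with (- acos (Re u)) by (field; lra).
    rewrite cos_neg, sin_neg.
    apply C_ext; reim; [auto|]. symmetry; apply eq_of_sqr; [lra|].
    apply Rnot_le_lt in L. lra.
Qed.

(** * Complex differentiability *)

(** The estimate is non-strict so that it also covers [h = 0]; in terms of increments it is usable
    without division and without filters. *)
Definition Cderiv (f : C -> C) (z l : C) : Prop :=
  forall eps, 0 < eps -> exists delta, 0 < delta /\ forall h : C, Cmod h < delta ->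
    Cmod (f (z + h) - f z - l * h)%C <= eps * Cmod h.

Lemma is_derive_Cderiv (f : C -> C) (z l : C) :
  is_derive (K := C_AbsRing) (V := C_NormedModule) f z l -> Cderiv f z l.
Proof.
  intros [_ H] eps Heps.
  specialize (H z (fun P HP => HP) (mkposreal eps Heps)).
  apply (locally_norm_le_locally (K := C_AbsRing) (V := AbsRing_NormedModule C_AbsRing) z) in H. destruct H as [d Hd].
  exists d. split; [apply cond_pos|]. intros h Hh.
  specialize (Hd (z + h)%C). unfold ball_norm in Hd.
  assert (E : (z + h - z)%C = h) by ring.
  change (Cmod (z + h - z)%C < d ->
    Cmod (f (z + h) - f z - (z + h - z) * l)%C <= eps * Cmod (z + h - z)%C) in Hd.
  rewrite E in Hd. rewrite (Cmult_comm l h). apply Hd, Hh.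
Qed.

Lemma holomorphic_Cderiv (D : C -> Prop) (f : C -> C) (z : C) :
  holomorphic_on D f -> D z -> exists l, Cderiv f z l.
Proof. intros H Hz. destruct (H z Hz) as [l Hl]. exists l. apply is_derive_Cderiv, Hl. Qed.

Lemma Cderiv_continuous (f : C -> C) (z l : C) : Cderiv f z l ->
  forall eps, 0 < eps -> exists delta, 0 < delta /\ forall h : C, Cmod h < delta ->
    Cmod (f (z + h) - f z)%C < eps.
Proof.
  intros H eps Heps. destruct (H 1 Rlt_0_1) as [d [Hd0 Hd]].
  pose proof (Cmod_ge_0 l) as Hl.
  exists (Rmin d (eps / (2 + Cmod l))). split.
  - apply Rmin_pos; [assumption|]. apply Rdiv_lt_0_compat; lra.
  - intros h Hh. assert (H1 : Cmod h < d) by (eapply Rlt_le_trans; [apply Hh | apply Rmin_l]).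
    assert (H2 : Cmod h < eps / (2 + Cmod l)) by (eapply Rlt_le_trans; [apply Hh | apply Rmin_r]).
    specialize (Hd h H1).
    replace (f (z + h) - f z)%C with ((f (z + h) - f z - l * h) + l * h)%C by ring.
    eapply Rle_lt_trans; [apply Cmod_triangle|]. rewrite Cmod_mult.
    assert (H3 : Cmod h * (2 + Cmod l) < eps).
    { apply (Rmult_lt_compat_r (2 + Cmod l)) in H2; [|lra].
      replace (eps / (2 + Cmod l) * (2 + Cmod l)) with eps in H2 by (field; lra). exact H2. }
    pose proof (Cmod_ge_0 h). nra.
Qed.

Lemma Cderiv_mult (f g : C -> C) (z a b : C) :
  Cderiv f z a -> Cderiv g z b -> Cderiv (fun w => f w * g w)%C z (a * g z + f z * b)%C.
Proof.
  intros Hf Hg eps Heps.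
  pose proof (Cmod_ge_0 a) as Pa. pose proof (Cmod_ge_0 (f z)) as Pf.
  pose proof (Cmod_ge_0 (g z)) as Pg.
  set (K := 2 + Cmod a + Cmod (f z) + Cmod (g z)).
  assert (HK : 0 < K) by (unfold K; lra).
  assert (He : 0 < eps / (2 * K)) by (apply Rdiv_lt_0_compat; lra).
  assert (HeK : eps / (2 * K) * K = eps / 2) by (field; lra).
  destruct (Hf (Rmin 1 (eps / (2 * K)))) as [d1 [Hd1 H1]]; [apply Rmin_pos; lra|].
  destruct (Hg (eps / (2 * K))) as [d2 [Hd2 H2]]; [assumption|].
  destruct (Cderiv_continuous g z b Hg (Rmin 1 (eps / (2 * K)))) as [d3 [Hd3 H3]]; [apply Rmin_pos; lra|].
  exists (Rmin d1 (Rmin d2 d3)). split; [repeat apply Rmin_pos; assumption|].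
  intros h Hh. pose proof (Rmin_l d1 (Rmin d2 d3)). pose proof (Rmin_r d1 (Rmin d2 d3)).
  pose proof (Rmin_l d2 d3). pose proof (Rmin_r d2 d3).
  pose proof (Rmin_l 1 (eps / (2 * K))) as M1. pose proof (Rmin_r 1 (eps / (2 * K))) as M2.
  specialize (H1 h ltac:(lra)). specialize (H2 h ltac:(lra)). specialize (H3 h ltac:(lra)).
  set (u := (f (z + h) - f z - a * h)%C) in *.
  set (v := (g (z + h) - g z - b * h)%C) in *.
  set (w := (g (z + h) - g z)%C) in *.
  replace (f (z + h) * g (z + h) - f z * g z - (a * g z + f z * b) * h)%C
    with (u * g z + u * w + a * h * w + f z * v)%C by (unfold u, v, w; ring).
  pose proof (Cmod_triangle (u * g z + u * w + a * h * w) (f z * v)).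
  pose proof (Cmod_triangle (u * g z + u * w) (a * h * w)).
  pose proof (Cmod_triangle (u * g z) (u * w)).
  rewrite !Cmod_mult in *.
  pose proof (Cmod_ge_0 h). pose proof (Cmod_ge_0 u). pose proof (Cmod_ge_0 w). pose proof (Cmod_ge_0 v).
  set (e' := eps / (2 * K)) in *.
  assert (A1 : Cmod u <= e' * Cmod h) by nra.
  assert (A1' : Cmod u <= 1 * Cmod h) by nra.
  assert (A2 : Cmod u * Cmod w <= (1 * Cmod h) * e') by (apply Rmult_le_compat; lra).
  assert (A3 : Cmod a * Cmod h * Cmod w <= Cmod a * Cmod h * e') by (apply Rmult_le_compat_l; nra).
  assert (A5 : Cmod (f z) * Cmod v <= Cmod (f z) * (e' * Cmod h)) by (apply Rmult_le_compat_l; lra).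
  assert (A6 : Cmod u * Cmod (g z) <= (e' * Cmod h) * Cmod (g z)) by (apply Rmult_le_compat_r; lra).
  assert (e' * K * Cmod h <= eps * Cmod h) by (apply Rmult_le_compat_r; lra).
  unfold K in *. nra.
Qed.

(** Both bounds come from [1 + u <= exp u]: at [u = x] directly, and at [u = - x] after
    multiplication by [exp x], which gives [exp x * (1 - x) <= 1]. *)
Lemma abs_exp_minus (x : R) : Rabs x <= 1 / 2 -> Rabs (exp x - 1 - x) <= 2 * (x * x).
Proof.
  intro H. apply Rabs_le_between in H.
  pose proof (exp_ineq1_le x). pose proof (exp_ineq1_le (- x)).
  assert (E : exp x * exp (- x) = 1) by (rewrite <- exp_plus, Rplus_opp_r; apply exp_0).
  pose proof (exp_pos x).
  assert (exp x * (1 - x) <= 1) by nra.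
  rewrite Rabs_right by lra. nra.
Qed.

Lemma abs_cos_minus (y : R) : Rabs (cos y - 1) <= y * y / 2.
Proof.
  replace y with (2 * (y / 2)) at 1 by field. rewrite cos_2a_sin.
  assert (A : Rabs (sin (y / 2)) <= Rabs (y / 2)).
  { destruct (Rle_dec 0 (y / 2)) as [L|L].
    - destruct (Rle_dec (y/2) PI) as [L'|L'].
      + destruct L as [L|L]; [|rewrite <- L, sin_0; lra].
        rewrite (Rabs_right (y / 2)) by lra.
        rewrite Rabs_right by (apply Rle_ge, sin_ge_0; lra). left; apply sin_lt_x; assumption.
      + pose proof (SIN_bound (y / 2)). pose proof PI2_1.
        rewrite (Rabs_right (y / 2)) by lra. apply Rabs_le. lra.
    - apply Rnot_le_lt in L.
      rewrite <- (Rabs_Ropp (sin _)), <- (Rabs_Ropp (y/2)), <- sin_neg.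
      destruct (Rle_dec (- (y/2)) PI) as [L'|L'].
      + rewrite (Rabs_right (- (y / 2))) by lra.
        rewrite Rabs_right by (apply Rle_ge, sin_ge_0; lra). left; apply sin_lt_x; lra.
      + pose proof (SIN_bound (- (y / 2))). pose proof PI2_1.
        rewrite (Rabs_right (- (y / 2))) by lra. apply Rabs_le. lra. }
  apply Rsqr_le_abs_1 in A. unfold Rsqr in A.
  pose proof (Rle_0_sqr (sin (y/2))); unfold Rsqr in *.
  rewrite Rabs_left1; lra.
Qed.

Lemma abs_sin_minus (y : R) : Rabs (sin y - y) <= Rabs y * (y * y) / 2.
Proof.
  destruct (MVT_gen (fun t => sin t - t) 0 y (fun t => cos t - 1)) as [t [Ht E]].
  - intros; auto_derive; auto; ring.
  - intros x Hx. apply derivable_continuous_pt. exists (cos x - 1).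
    apply is_derive_Reals. auto_derive; auto; ring.
  - rewrite sin_0 in E. replace (sin y - y) with (sin y - y - (0 - 0)) by ring. rewrite E.
    rewrite Rabs_mult. rewrite Rminus_0_r.
    pose proof (abs_cos_minus t). pose proof (Rabs_pos y).
    assert (t * t <= y * y).
    { unfold Rmin, Rmax in Ht; destruct (Rle_dec 0 y); nra. }
    nra.
Qed.

(** The point 0 is enough, because the addition formula transports the derivative, as in
    [Cderiv_ee]. Each component of [exp h - 1 - h] is at most [4 |h|^2], whence the radius
    [eps / 8]. *)
Lemma Cderiv_Cexp_0 : Cderiv Cexp 0 1.
Proof.
  intros eps Heps. exists (Rmin (1/2) (eps / 8)). split; [apply Rmin_pos; lra|].
  intros h Hh. pose proof (Rmin_l (1/2) (eps/8)). pose proof (Rmin_r (1/2) (eps/8)).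
  assert (Hh1 : Cmod h < 1/2) by lra. assert (Hh2 : Cmod h < eps/8) by lra.
  rewrite Cexp_0. replace (0 + h)%C with h by ring.
  pose proof (re_le_Cmod h) as R1. pose proof (Im_le_Cmod h) as R2.
  pose proof (Cmod_ge_0 h).
  destruct h as [x y]. unfold Re, Im, Cexp in *; simpl in *. set (m := Cmod (x, y)) in *.
  assert (Sq : x * x + y * y = m * m) by (unfold m; rewrite Cmod_sqr; simpl; reflexivity).
  pose proof (Rabs_pos x). pose proof (Rabs_pos y).
  pose proof (abs_exp_minus x ltac:(lra)) as E1.
  pose proof (abs_cos_minus y) as E2. pose proof (abs_sin_minus y) as E3.
  eapply Rle_trans; [apply Cmod_le_Re_Im|]. reim.
  apply Rabs_le_between in E1. apply Rabs_le_between in E2.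
  assert (E3' : Rabs (sin y - y) <= y * y) by nra.
  apply Rabs_le_between in E3'. apply Rabs_le_between in R1. apply Rabs_le_between in R2.
  assert (X1 : 0 <= exp x <= 2) by nra.
  pose proof (Rle_0_sqr x) as Sx; pose proof (Rle_0_sqr y) as Sy; unfold Rsqr in *.
  assert (B1 : Rabs (exp x * cos y - 1 - (1 * x - 0 * y)) <= 4 * (m * m)).
  { replace (exp x * cos y - 1 - (1 * x - 0 * y)) with ((exp x - 1 - x) + exp x * (cos y - 1)) by ring.
    apply Rabs_le. nra. }
  assert (B2 : Rabs (exp x * sin y - 0 - (1 * y + 0 * x)) <= 4 * (m * m)).
  { replace (exp x * sin y - 0 - (1 * y + 0 * x)) with (exp x * (sin y - y) + (exp x - 1) * y) by ring.
    assert (U1 : Rabs (exp x * (sin y - y)) <= 2 * (m * m)) by (apply Rabs_le; nra).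
    assert (U2 : Rabs ((exp x - 1) * y) <= 2 * (m * m)).
    { rewrite Rabs_mult.
      assert (Rabs (exp x - 1) <= 2 * m) by (apply Rabs_le; nra).
      assert (Rabs y <= m) by (apply Rabs_le; lra).
      pose proof (Rabs_pos (exp x - 1)). nra. }
    eapply Rle_trans; [apply Rabs_triang|]. lra. }
  nra.
Qed.

Lemma Cderiv_ee (l z : C) : exists d, Cderiv (fun w => ee (l * w))%C z d.
Proof.
  set (k := (2 * PI * Ci * l)%C).
  exists (k * Cexp (k * z))%C. intros eps Heps.
  pose proof (Cmod_ge_0 k) as Pk. pose proof (Cmod_ge_0 (Cexp (k * z))) as Pe.
  set (K := (1 + Cmod k) * (1 + Cmod (Cexp (k * z)))).
  assert (HK : 0 < K) by (unfold K; nra).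
  destruct (Cderiv_Cexp_0 (eps / K)) as [d [Hd0 Hd]]; [apply Rdiv_lt_0_compat; lra|].
  exists (d / (1 + Cmod k)). split; [apply Rdiv_lt_0_compat; lra|].
  intros h Hh.
  assert (Hk : Cmod (k * h) < d).
  { rewrite Cmod_mult. apply (Rmult_lt_compat_r (1 + Cmod k)) in Hh; [|lra].
    replace (d / (1 + Cmod k) * (1 + Cmod k)) with d in Hh by (field; lra).
    pose proof (Cmod_ge_0 h). nra. }
  specialize (Hd _ Hk). rewrite Cexp_0 in Hd. replace (0 + k * h)%C with (k * h)%C in Hd by ring.
  unfold ee. replace (2 * PI * Ci * (l * (z + h)))%C with (k * z + k * h)%C by (unfold k; ring).
  replace (2 * PI * Ci * (l * z))%C with (k * z)%C by (unfold k; ring).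
  rewrite Cexp_plus.
  replace (Cexp (k * z) * Cexp (k * h) - Cexp (k * z) - k * Cexp (k * z) * h)%C
    with (Cexp (k * z) * (Cexp (k * h) - 1 - 1 * (k * h)))%C by ring.
  rewrite Cmod_mult. rewrite Cmod_mult in Hd.
  pose proof (Cmod_ge_0 h).
  apply Rle_trans with (Cmod (Cexp (k * z)) * (eps / K * (Cmod k * Cmod h))).
  - apply Rmult_le_compat_l; lra.
  - replace eps with (eps / K * K) at 2 by (field; lra).
    assert (0 <= eps / K) by (left; apply Rdiv_lt_0_compat; lra).
    replace (Cmod (Cexp (k * z)) * (eps / K * (Cmod k * Cmod h)))
      with (eps / K * (Cmod (Cexp (k * z)) * Cmod k) * Cmod h) by ring.
    apply Rmult_le_compat_r; [assumption|]. apply Rmult_le_compat_l; [assumption|]. unfold K. nra.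
Qed.

(** Lemmas on normed modules leave equalities typed in the module; these tactics retype them in [R]
    or [C], where [ring] and [field] apply. *)
Ltac eqR := match goal with |- @eq _ ?a ?b => change (@eq R a b) end.
Ltac eqC := match goal with |- @eq _ ?a ?b => change (@eq C a b) end.

(** * Integrals of complex-valued functions over real intervals *)

Definition Ccont (f : R -> C) (x : R) : Prop :=
  forall eps, 0 < eps -> exists delta, 0 < delta /\
    forall t, Rabs (t - x) < delta -> Cmod (f t - f x)%C < eps.

Definition is_CInt (f : R -> C) (a b : R) (l : C) : Prop :=
  is_RInt (V := C_R_NormedModule) f a b l.

Lemma is_CInt_components (f : R -> C) (a b : R) (l : C) :
  is_CInt f a b l <->
  is_RInt (fun t => Re (f t)) a b (Re l) /\ is_RInt (fun t => Im (f t)) a b (Im l).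
Proof.
  split.
  - intro H. split.
    + exact (is_RInt_fct_extend_fst (U := R_NormedModule) (V := R_NormedModule) f a b l H).
    + exact (is_RInt_fct_extend_snd (U := R_NormedModule) (V := R_NormedModule) f a b l H).
  - intros [H1 H2]. destruct l as [u v].
    exact (is_RInt_fct_extend_pair (U := R_NormedModule) (V := R_NormedModule) f a b u v H1 H2).
Qed.

Lemma is_CInt_ext (f g : R -> C) (a b : R) (l : C) : a <= b ->
  (forall x, a < x < b -> f x = g x) -> is_CInt f a b l -> is_CInt g a b l.
Proof.
  intros Hab H. apply is_RInt_ext. intros x Hx.
  rewrite Rmin_left, Rmax_right in Hx by assumption. auto.
Qed.

Lemma is_CInt_unique (f : R -> C) (a b : R) (l l' : C) :
  is_CInt f a b l -> is_CInt f a b l' -> l = l'.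
Proof.
  intros H H'.
  rewrite <- (is_RInt_unique (V := C_R_CompleteNormedModule) f a b l H).
  exact (is_RInt_unique (V := C_R_CompleteNormedModule) f a b l' H').
Qed.

Lemma is_CInt_plus (f g : R -> C) (a b : R) (l m : C) :
  is_CInt f a b l -> is_CInt g a b m -> is_CInt (fun x => f x + g x)%C a b (l + m)%C.
Proof. intros H1 H2. exact (is_RInt_plus (V := C_R_NormedModule) f g a b l m H1 H2). Qed.

Lemma is_CInt_minus (f g : R -> C) (a b : R) (l m : C) :
  is_CInt f a b l -> is_CInt g a b m -> is_CInt (fun x => f x - g x)%C a b (l - m)%C.
Proof. intros H1 H2. exact (is_RInt_minus (V := C_R_NormedModule) f g a b l m H1 H2). Qed.

Lemma is_CInt_Chasles (f : R -> C) (a b c : R) (l m : C) :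
  is_CInt f a b l -> is_CInt f b c m -> is_CInt f a c (l + m)%C.
Proof. intros H1 H2. exact (is_RInt_Chasles (V := C_R_NormedModule) f a b c l m H1 H2). Qed.

Lemma is_CInt_const (a b : R) (c : C) : is_CInt (fun _ => c) a b ((b - a) * c)%C.
Proof.
  apply is_CInt_components. split.
  - replace (Re ((b - a) * c)%C) with ((b - a) * Re c)
      by (rewrite <- RtoC_minus; reim; ring).
    exact (is_RInt_const (V := R_NormedModule) a b (Re c)).
  - replace (Im ((b - a) * c)%C) with ((b - a) * Im c)
      by (rewrite <- RtoC_minus; reim; ring).
    exact (is_RInt_const (V := R_NormedModule) a b (Im c)).
Qed.

(** The normed module has real scalars, so a complex factor is distributed over the two
    components. *)
Lemma is_CInt_scal (f : R -> C) (a b : R) (c l : C) :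
  is_CInt f a b l -> is_CInt (fun x => c * f x)%C a b (c * l)%C.
Proof.
  intro H. apply is_CInt_components in H. destruct H as [H1 H2].
  apply is_CInt_components. split.
  - exact (is_RInt_minus (V := R_NormedModule) _ _ a b _ _
      (is_RInt_scal (V := R_NormedModule) _ a b (Re c) _ H1)
      (is_RInt_scal (V := R_NormedModule) _ a b (Im c) _ H2)).
  - exact (is_RInt_plus (V := R_NormedModule) _ _ a b _ _
      (is_RInt_scal (V := R_NormedModule) _ a b (Re c) _ H2)
      (is_RInt_scal (V := R_NormedModule) _ a b (Im c) _ H1)).
Qed.

Lemma is_CInt_comp_lin (f : R -> C) (u v a b : R) (l : C) : u <> 0 ->
  is_CInt f (u * a + v) (u * b + v) l -> is_CInt (fun x => f (u * x + v)) a b (/ u * l)%C.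
Proof.
  intros Hu H. apply (is_RInt_comp_lin (V := C_R_NormedModule)) in H.
  assert (H' : is_CInt (fun x => u * f (u * x + v)%R)%C a b l).
  { apply is_CInt_components. apply is_CInt_components in H. destruct H as [H1 H2].
    split.
    - eapply is_RInt_ext; [|exact H1]. intros x _. reim.
      change (Re (scal u (f (u * x + v)))) with (u * Re (f (u * x + v))). eqR. ring.
    - eapply is_RInt_ext; [|exact H2]. intros x _. reim.
      change (Im (scal u (f (u * x + v)))) with (u * Im (f (u * x + v))). eqR. ring. }
  apply (is_CInt_scal _ a b (/ u)) in H'.
  eapply is_RInt_ext; [|exact H']. intros x _. eqC. cbv beta. field.
  intro E. apply Hu. injection E; auto.
Qed.

Lemma is_CInt_shift (f : R -> C) (v a b : R) (l : C) :
  is_CInt f (a + v) (b + v) l <-> is_CInt (fun x => f (x + v)) a b l.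
Proof.
  assert (K : forall (f : R -> C) v a b l, is_CInt f (a + v) (b + v) l ->
    is_CInt (fun x => f (x + v)) a b l).
  { clear. intros f v a b l H.
    replace l with (/ 1 * l)%C by field.
    eapply is_RInt_ext; [|apply (is_CInt_comp_lin f 1 v a b l)].
    - intros x _. simpl. f_equal. ring.
    - lra.
    - rewrite !Rmult_1_l. exact H. }
  split; [apply K|]. intro H.
  replace a with ((a + v) + - v) in H by ring. replace b with ((b + v) + - v) in H by ring.
  apply K in H. eapply is_RInt_ext; [|exact H]. intros x _. simpl. f_equal. ring.
Qed.

Lemma is_CInt_norm (f : R -> C) (a b M : R) (l : C) : a <= b ->
  (forall x, a <= x <= b -> Cmod (f x) <= M) -> is_CInt f a b l -> Cmod l <= (b - a) * M.
Proof.
  intros Hab H Hl. rewrite Cmod_norm.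
  apply (norm_RInt_le_const (V := C_R_NormedModule) f a b l M); auto.
  intros x Hx. rewrite <- Cmod_norm. auto.
Qed.

Lemma Ccont_continuous (f : R -> C) (x : R) :
  Ccont f x -> continuous (U := C_R_CompleteNormedModule) f x.
Proof.
  intro H. apply filterlim_locally. intro eps.
  destruct (H eps (cond_pos eps)) as [d [Hd0 Hd]].
  exists (mkposreal d Hd0). intros t Ht.
  apply (C_NormedModule_mixin_compat1 (f x) (f t)). apply Hd. exact Ht.
Qed.

Lemma ex_CInt_continuous (f : R -> C) (a b : R) : a <= b ->
  (forall x, a <= x <= b -> Ccont f x) -> exists l, is_CInt f a b l.
Proof.
  intros Hab H. apply (ex_RInt_continuous (V := C_R_CompleteNormedModule)).
  intros x Hx. rewrite Rmin_left, Rmax_right in Hx by assumption.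
  apply Ccont_continuous; auto.
Qed.

Lemma is_CInt_periodic (f : R -> C) (T v : R) (l : C) : 0 < T ->
  (forall x, Ccont f x) -> (forall x, f (x + T) = f x) ->
  is_CInt f 0 T l -> is_CInt f v (v + T) l.
Proof.
  intros HT Hc Hp Hl.
  assert (Hi : forall a b, a <= b -> exists l, is_CInt f a b l)
    by (intros; apply ex_CInt_continuous; auto).
  assert (K : exists m, is_CInt f 0 v m).
  { destruct (Rle_dec 0 v) as [L|L]; [apply Hi, L|].
    destruct (Hi v 0 ltac:(lra)) as [m Hm]. exists (opp (G := C_R_NormedModule) m).
    apply is_RInt_swap. exact Hm. }
  destruct K as [m Hm].
  assert (Hm' : is_CInt f T (v + T) m).
  { replace T with (0 + T) at 1 by ring. apply is_CInt_shift.
    eapply is_RInt_ext; [|exact Hm]. intros; symmetry; apply Hp. }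
  assert (Hs : is_CInt f v 0 (- m)%C) by (apply (is_RInt_swap (V := C_R_NormedModule)); exact Hm).
  replace l with (- m + l + m)%C by ring.
  eapply is_CInt_Chasles; [eapply is_CInt_Chasles; eassumption|exact Hm'].
Qed.

(** Compactness by bisection, used for Cauchy's theorem and for boundedness on rectangles: if [P]
    failed, repeated quartering would give nested bad rectangles shrinking to a point, against the
    local hypothesis at that point. That hypothesis only speaks of dyadic reductions of the initial
    rectangle, so the aspect ratio stays fixed. *)
Lemma rectangle_bisection (P : R -> R -> R -> R -> Prop) :
  (forall a b c d, P a ((a + b) / 2) c ((c + d) / 2) -> P ((a + b) / 2) b c ((c + d) / 2) ->
     P a ((a + b) / 2) ((c + d) / 2) d -> P ((a + b) / 2) b ((c + d) / 2) d -> P a b c d) ->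
  forall a b c d, a < b -> c < d ->
  (forall x y, a <= x <= b -> c <= y <= d -> exists delta, 0 < delta /\
     forall n a' c', let w := (b - a) / 2 ^ n in let h := (d - c) / 2 ^ n in
       a <= a' -> a' <= x <= a' + w -> a' + w <= b ->
       c <= c' -> c' <= y <= c' + h -> c' + h <= d -> w < delta -> h < delta ->
       P a' (a' + w) c' (c' + h)) ->
  P a b c d.
Proof.
  intros Hsplit a b c d Hab Hcd Hloc.
  apply NNPP. intro Hnot.
  set (w := fun n => (b - a) / 2 ^ n). set (h := fun n => (d - c) / 2 ^ n).
  set (Bad := fun n (p : R * R) => ~ P (fst p) (fst p + w n) (snd p) (snd p + h n)).
  assert (Hpow : forall n, 0 < 2 ^ n) by (intro; apply pow_lt; lra).
  assert (Hw : forall n, w n / 2 = w (S n)) by (intro n; unfold w; simpl; field; apply Rgt_not_eq, Hpow).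
  assert (Hh : forall n, h n / 2 = h (S n)) by (intro n; unfold h; simpl; field; apply Rgt_not_eq, Hpow).
  assert (Pw : forall n, 0 < w n) by (intro n; apply Rdiv_lt_0_compat; [lra|apply Hpow]).
  assert (Ph : forall n, 0 < h n) by (intro n; apply Rdiv_lt_0_compat; [lra|apply Hpow]).
  assert (Step : forall n p, Bad n p -> exists q, Bad (S n) q /\
    fst p <= fst q /\ fst q + w (S n) <= fst p + w n /\
    snd p <= snd q /\ snd q + h (S n) <= snd p + h n).
  { intros n [x y] HB. unfold Bad in HB; simpl in HB.
    pose proof (Hw n) as W. pose proof (Hh n) as H. pose proof (Pw (S n)). pose proof (Ph (S n)).
    apply NNPP. intro HN. apply HB.
    assert (Q : forall q, fst q = x \/ fst q = x + w (S n) -> snd q = y \/ snd q = y + h (S n) ->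
       P (fst q) (fst q + w (S n)) (snd q) (snd q + h (S n))).
    { intros q Hq1 Hq2. apply NNPP. intro HQ. apply HN. exists q. split; [exact HQ|].
      simpl. destruct Hq1, Hq2; lra. }
    pose proof (Q (x, y) ltac:(simpl; lra) ltac:(simpl; lra)) as Q1.
    pose proof (Q (x + w (S n), y) ltac:(simpl; lra) ltac:(simpl; lra)) as Q2.
    pose proof (Q (x, y + h (S n)) ltac:(simpl; lra) ltac:(simpl; lra)) as Q3.
    pose proof (Q (x + w (S n), y + h (S n)) ltac:(simpl; lra) ltac:(simpl; lra)) as Q4.
    simpl in Q1, Q2, Q3, Q4.
    apply Hsplit;
    replace ((x + (x + w n)) / 2) with (x + w (S n)) by lra;
    replace ((y + (y + h n)) / 2) with (y + h (S n)) by lra; try assumption;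
    replace (x + w n) with (x + w (S n) + w (S n)) by lra;
    replace (y + h n) with (y + h (S n) + h (S n)) by lra; assumption. }
  assert (B0 : Bad 0%nat (a, c)).
  { unfold Bad, w, h; simpl. replace (a + (b - a) / 1) with b by field.
    replace (c + (d - c) / 1) with d by field. exact Hnot. }
  (* Dependent choice: each bad rectangle is kept together with the proof that it is bad. *)
  pose (next := fun n (s : {p | Bad n p}) =>
    let q := constructive_indefinite_description _ (Step n (proj1_sig s) (proj2_sig s)) in
    exist (Bad (S n)) (proj1_sig q) (proj1 (proj2_sig q))).
  pose (sq := fix sq n : {p | Bad n p} :=
    match n with O => exist (Bad 0%nat) (a, c) B0 | S m => next m (sq m) end).
  set (s := fun n => proj1_sig (sq n)).
  assert (Sbad : forall n, Bad n (s n)) by (intro n; exact (proj2_sig (sq n))).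
  assert (Sstep : forall n, fst (s n) <= fst (s (S n)) /\ fst (s (S n)) + w (S n) <= fst (s n) + w n /\
    snd (s n) <= snd (s (S n)) /\ snd (s (S n)) + h (S n) <= snd (s n) + h n).
  { intro n. unfold s. simpl. unfold next. simpl.
    destruct (constructive_indefinite_description _ (Step n (proj1_sig (sq n)) (proj2_sig (sq n)))) as [q [Hq1 Hq2]].
    simpl. exact Hq2. }
  assert (Smon : forall n m, fst (s n) <= fst (s (n + m)%nat) /\ fst (s (n + m)%nat) + w (n + m)%nat <= fst (s n) + w n /\
    snd (s n) <= snd (s (n + m)%nat) /\ snd (s (n + m)%nat) + h (n + m)%nat <= snd (s n) + h n).
  { intros n m. induction m as [|m IH].
    - rewrite Nat.add_0_r. lra.
    - rewrite Nat.add_succ_r. pose proof (Sstep (n + m)%nat). lra. }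
  (* Each lower corner lies below each upper corner, whatever the two indices, so the suprema of the
     lower coordinates give a point common to all the rectangles. *)
  assert (Scross : forall n m, fst (s n) <= fst (s m) + w m /\ snd (s n) <= snd (s m) + h m).
  { intros n m. pose proof (Smon n m). pose proof (Smon m n).
    rewrite (Nat.add_comm m n) in *. pose proof (Pw (n + m)%nat). pose proof (Ph (n + m)%nat). lra. }
  assert (S0 : s 0%nat = (a, c)) by reflexivity.
  assert (w0 : w 0%nat = b - a) by (unfold w; simpl; field).
  assert (h0 : h 0%nat = d - c) by (unfold h; simpl; field).
  assert (Lub : forall u : nat -> R, (forall n m, u n <= u m + w m) \/ (forall n m, u n <= u m + h m) ->
     exists x, (forall n, u n <= x) /\ forall B, (forall n, u n <= B) -> x <= B).
  { intros u Hu. destruct (completeness (fun r => exists n, r = u n)) as [x [Hx1 Hx2]].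
    - destruct Hu as [Hu|Hu]; [exists (u 0%nat + w 0%nat)|exists (u 0%nat + h 0%nat)];
      intros r [n ->]; apply Hu.
    - exists (u 0%nat). exists 0%nat. reflexivity.
    - exists x. split; [intro n; apply Hx1; exists n; reflexivity|].
      intros B HB. apply Hx2. intros r [n ->]. apply HB. }
  destruct (Lub (fun n => fst (s n))) as [x [Hx1 Hx2]]; [left; intros; apply Scross|].
  destruct (Lub (fun n => snd (s n))) as [y [Hy1 Hy2]]; [right; intros; apply Scross|].
  assert (Hx3 : forall n, x <= fst (s n) + w n) by (intro n; apply Hx2; intro m; apply Scross).
  assert (Hy3 : forall n, y <= snd (s n) + h n) by (intro n; apply Hy2; intro m; apply Scross).
  destruct (Hloc x y) as [delta [Hd0 Hd]].
  { generalize (Hx1 0%nat) (Hx3 0%nat). rewrite S0, w0. simpl. lra. }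
  { generalize (Hy1 0%nat) (Hy3 0%nat). rewrite S0, h0. simpl. lra. }
  destruct (pow_lt_1_zero (1/2) ltac:(rewrite Rabs_right; lra) (delta / (b - a + (d - c)))) as [n Hn].
  { apply Rdiv_lt_0_compat; lra. }
  specialize (Hn n (Nat.le_refl n)).
  rewrite Rabs_right in Hn by (apply Rle_ge, pow_le; lra).
  assert (Hn' : (1 / 2) ^ n * (b - a + (d - c)) < delta).
  { apply (Rmult_lt_compat_r (b - a + (d - c))) in Hn; [|lra].
    replace (delta / (b - a + (d - c)) * (b - a + (d - c))) with delta in Hn by (field; lra). exact Hn. }
  assert (En : (1 / 2) ^ n = / 2 ^ n).
  { replace (1/2) with (/ 2) by field. rewrite pow_inv. reflexivity. }
  assert (Ewn : w n = (1/2)^n * (b - a)) by (rewrite En; unfold w; field; apply Rgt_not_eq, Hpow).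
  assert (Ehn : h n = (1/2)^n * (d - c)) by (rewrite En; unfold h; field; apply Rgt_not_eq, Hpow).
  assert (0 < (1/2)^n) by (apply pow_lt; lra).
  apply (Sbad n).
  pose proof (Smon 0%nat n) as Sm. rewrite S0, w0, h0 in Sm. simpl in Sm.
  specialize (Hx1 n). specialize (Hx3 n). specialize (Hy1 n). specialize (Hy3 n).
  apply (Hd n); fold (w n) (h n); try lra; nra.
Qed.

Lemma is_CInt_id (a b : R) : is_CInt (fun x => RtoC x) a b ((b * b - a * a) / 2).
Proof.
  replace ((b * b - a * a) / 2)%C with (RtoC (b * b / 2 - a * a / 2))
    by (rewrite RtoC_minus, !RtoC_div, !RtoC_mult by lra; field).
  apply is_CInt_components. split.
  - apply (is_RInt_derive (V := R_CompleteNormedModule) (fun x => x * x / 2) (fun x => x)).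
    + intros x _. auto_derive; auto. field.
    + intros x _. apply continuous_id.
  - rewrite Im_RtoC. replace 0 with ((b - a) * 0) by ring.
    exact (is_RInt_const (V := R_NormedModule) a b 0).
Qed.

(** * Cauchy's theorem for rectangles *)

(** The contour integral, counterclockwise, with [dz = i dy] on the vertical sides. It is a relation
    so that it also asserts the existence of the four integrals. *)
Definition is_bdry_int (F : C -> C) (a b c d : R) (v : C) : Prop :=
  exists i1 i2 i3 i4,
    is_CInt (fun x => F (x, c)) a b i1 /\ is_CInt (fun y => F (b, y)) c d i2 /\
    is_CInt (fun x => F (x, d)) a b i3 /\ is_CInt (fun y => F (a, y)) c d i4 /\
    v = (i1 + Ci * i2 - i3 - Ci * i4)%C.

Lemma is_bdry_int_minus (F G : C -> C) (a b c d : R) (v w : C) :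
  is_bdry_int F a b c d v -> is_bdry_int G a b c d w ->
  is_bdry_int (fun z => F z - G z)%C a b c d (v - w)%C.
Proof.
  intros (i1 & i2 & i3 & i4 & H1 & H2 & H3 & H4 & ->) (j1 & j2 & j3 & j4 & K1 & K2 & K3 & K4 & ->).
  exists (i1 - j1)%C, (i2 - j2)%C, (i3 - j3)%C, (i4 - j4)%C.
  repeat (split; [apply is_CInt_minus; assumption|]). ring.
Qed.

(** In [goursat] this allows the first-order part of [F] at a point to be subtracted at no cost. *)
Lemma is_bdry_int_affine (p q : C) (a b c d : R) :
  is_bdry_int (fun z => p + q * z)%C a b c d 0.
Proof.
  assert (K : forall p q : C, forall a b, is_CInt (fun x => p + q * x)%C a b
     ((b - a) * p + q * ((b * b - a * a) / 2))%C).
  { intros. apply is_CInt_plus; [apply is_CInt_const|]. apply is_CInt_scal, is_CInt_id. }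
  assert (L : forall (f g : R -> C) a b l, (forall x, f x = g x) -> is_CInt f a b l -> is_CInt g a b l)
    by (intros; eapply is_RInt_ext; [|eassumption]; intros; simpl; auto).
  eexists _, _, _, _. split; [|split; [|split; [|split]]].
  - eapply L; [|apply (K (p + q * (Ci * c))%C q)]. intro x. simpl. rewrite pair_eq_C. ring.
  - eapply L; [|apply (K (p + q * b)%C (q * Ci)%C)]. intro x. simpl. rewrite pair_eq_C. ring.
  - eapply L; [|apply (K (p + q * (Ci * d))%C q)]. intro x. simpl. rewrite pair_eq_C. ring.
  - eapply L; [|apply (K (p + q * a)%C (q * Ci)%C)]. intro x. simpl. rewrite pair_eq_C. ring.
  - field.
Qed.

Lemma is_bdry_int_bound (F : C -> C) (a b c d M : R) (v : C) : a <= b -> c <= d ->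
  (forall x y, a <= x <= b -> c <= y <= d -> Cmod (F (x, y)) <= M) ->
  is_bdry_int F a b c d v -> Cmod v <= 2 * ((b - a) + (d - c)) * M.
Proof.
  intros Hab Hcd HM (i1 & i2 & i3 & i4 & H1 & H2 & H3 & H4 & ->).
  apply (is_CInt_norm _ a b M) in H1; [|assumption|intros; apply HM; lra].
  apply (is_CInt_norm _ c d M) in H2; [|assumption|intros; apply HM; lra].
  apply (is_CInt_norm _ a b M) in H3; [|assumption|intros; apply HM; lra].
  apply (is_CInt_norm _ c d M) in H4; [|assumption|intros; apply HM; lra].
  pose proof (Cmod_triangle_minus (i1 + Ci * i2 - i3) (Ci * i4)) as T1.
  pose proof (Cmod_triangle_minus (i1 + Ci * i2) i3) as T2.
  pose proof (Cmod_triangle i1 (Ci * i2)) as T3.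
  rewrite Cmod_mult, Cmod_Ci in T1, T3. lra.
Qed.

Lemma is_bdry_int_split (F : C -> C) (a b c d m n : R) (v1 v2 v3 v4 v : C) :
  is_bdry_int F a m c n v1 -> is_bdry_int F m b c n v2 ->
  is_bdry_int F a m n d v3 -> is_bdry_int F m b n d v4 ->
  is_bdry_int F a b c d v -> v = (v1 + v2 + v3 + v4)%C.
Proof.
  intros (i1 & i2 & i3 & i4 & H1 & H2 & H3 & H4 & ->) (j1 & j2 & j3 & j4 & J1 & J2 & J3 & J4 & ->)
   (k1 & k2 & k3 & k4 & K1 & K2 & K3 & K4 & ->) (l1 & l2 & l3 & l4 & L1 & L2 & L3 & L4 & ->)
   (o1 & o2 & o3 & o4 & O1 & O2 & O3 & O4 & ->).
  rewrite (is_CInt_unique _ _ _ _ _ O1 (is_CInt_Chasles _ _ _ _ _ _ H1 J1)).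
  rewrite (is_CInt_unique _ _ _ _ _ O2 (is_CInt_Chasles _ _ _ _ _ _ J2 L2)).
  rewrite (is_CInt_unique _ _ _ _ _ O3 (is_CInt_Chasles _ _ _ _ _ _ K3 L3)).
  rewrite (is_CInt_unique _ _ _ _ _ O4 (is_CInt_Chasles _ _ _ _ _ _ H4 K4)).
  rewrite (is_CInt_unique _ _ _ _ _ H2 J4).
  rewrite (is_CInt_unique _ _ _ _ _ H3 K1).
  rewrite (is_CInt_unique _ _ _ _ _ J3 L1).
  rewrite (is_CInt_unique _ _ _ _ _ K2 L4). ring.
Qed.

Definition Cdiff_on_H (F : C -> C) : Prop := forall z, 0 < Im z -> exists l, Cderiv F z l.

Lemma Cdiff_Ccont_h (F : C -> C) (x y : R) : Cdiff_on_H F -> 0 < y -> Ccont (fun t => F (t, y)) x.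
Proof.
  intros HF Hy eps Heps. destruct (HF (x, y) Hy) as [l Hl].
  destruct (Cderiv_continuous F _ l Hl eps Heps) as [d [Hd0 Hd]].
  exists d. split; [assumption|]. intros t Ht.
  specialize (Hd (RtoC (t - x))). rewrite Cmod_R in Hd. specialize (Hd Ht).
  replace ((x, y) + RtoC (t - x))%C with ((t, y) : C) in Hd
    by (apply C_ext; reim; ring). exact Hd.
Qed.

Lemma Cdiff_Ccont_v (F : C -> C) (x y : R) : Cdiff_on_H F -> 0 < y -> Ccont (fun t => F (x, t)) y.
Proof.
  intros HF Hy eps Heps. destruct (HF (x, y) Hy) as [l Hl].
  destruct (Cderiv_continuous F _ l Hl eps Heps) as [d [Hd0 Hd]].
  exists d. split; [assumption|]. intros t Ht.
  specialize (Hd (Ci * RtoC (t - y))%C). rewrite Cmod_mult, Cmod_Ci, Rmult_1_l, Cmod_R in Hd.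
  specialize (Hd Ht).
  replace ((x, y) + Ci * RtoC (t - y))%C with ((x, t) : C) in Hd
    by (apply C_ext; reim; ring). exact Hd.
Qed.

Lemma ex_bdry_int (F : C -> C) (a b c d : R) : Cdiff_on_H F -> a <= b -> 0 < c -> c <= d ->
  exists v, is_bdry_int F a b c d v.
Proof.
  intros HF Hab Hc Hcd.
  destruct (ex_CInt_continuous (fun x => F (x, c)) a b Hab) as [i1 H1];
    [intros; apply Cdiff_Ccont_h; auto; lra|].
  destruct (ex_CInt_continuous (fun y => F (b, y)) c d Hcd) as [i2 H2];
    [intros; apply Cdiff_Ccont_v; auto; lra|].
  destruct (ex_CInt_continuous (fun x => F (x, d)) a b Hab) as [i3 H3];
    [intros; apply Cdiff_Ccont_h; auto; lra|].
  destruct (ex_CInt_continuous (fun y => F (a, y)) c d Hcd) as [i4 H4];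
    [intros; apply Cdiff_Ccont_v; auto; lra|].
  eexists. exists i1, i2, i3, i4. split; [|split; [|split; [|split]]]; try eassumption. reflexivity.
Qed.

(** The bound by [eps] times the area adds up over the four quarters, so by bisection it need only
    hold on small rectangles containing a given point. There [F] is affine up to a small multiple of
    the distance, and the affine part contributes nothing. *)
Lemma goursat (F : C -> C) (a b c d : R) (v : C) : Cdiff_on_H F -> a < b -> 0 < c -> c < d ->
  is_bdry_int F a b c d v -> v = 0.
Proof.
  intros HF Hab Hc Hcd Hv.
  assert (Main : forall eps, 0 < eps -> Cmod v <= eps * ((b - a) * (d - c))).
  { intros eps Heps.
    apply (rectangle_bisection (fun a b c d => a <= b -> 0 < c -> c <= d -> forall v,
       is_bdry_int F a b c d v -> Cmod v <= eps * ((b - a) * (d - c)))) with (a := a) (b := b) (c := c) (d := d);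
      try assumption; try lra.
    - clear - HF. intros a b c d P1 P2 P3 P4 Hab Hc Hcd v Hv.
      set (m := (a + b) / 2) in *. set (n := (c + d) / 2) in *.
      destruct (ex_bdry_int F a m c n) as [v1 V1]; try assumption; try (unfold m, n; lra).
      destruct (ex_bdry_int F m b c n) as [v2 V2]; try assumption; try (unfold m, n; lra).
      destruct (ex_bdry_int F a m n d) as [v3 V3]; try assumption; try (unfold m, n; lra).
      destruct (ex_bdry_int F m b n d) as [v4 V4]; try assumption; try (unfold m, n; lra).
      rewrite (is_bdry_int_split F a b c d m n v1 v2 v3 v4 v); try assumption.
      apply P1 in V1; try (unfold m, n; lra). apply P2 in V2; try (unfold m, n; lra).
      apply P3 in V3; try (unfold m, n; lra). apply P4 in V4; try (unfold m, n; lra).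
      pose proof (Cmod_triangle (v1 + v2 + v3) v4). pose proof (Cmod_triangle (v1 + v2) v3).
      pose proof (Cmod_triangle v1 v2).
      replace (eps * ((b - a) * (d - c))) with (eps * ((m - a) * (n - c)) + eps * ((b - m) * (n - c))
        + eps * ((m - a) * (d - n)) + eps * ((b - m) * (d - n))) by (unfold m, n; field).
      lra.
    - intros x y Hx Hy.
      set (W := b - a). set (H := d - c).
      assert (HW : 0 < W) by (unfold W; lra). assert (HH : 0 < H) by (unfold H; lra).
      (* This ratio is the same for all the reduced rectangles; dividing by it turns the perimeter
         times the bound on the distance into the area. *)
      set (kap := (W + H) * (W + H) / (W * H)).
      assert (Hkap : 0 < kap) by (unfold kap; apply Rdiv_lt_0_compat; nra).
      destruct (HF (x, y)) as [l Hl]; [simpl; lra|].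
      destruct (Hl (eps / (2 * kap))) as [del [Hdel Hd]]; [apply Rdiv_lt_0_compat; lra|].
      exists (del / 2). split; [lra|].
      intros k a' c'. fold W H. set (t := / 2 ^ k).
      assert (Ht : 0 < t) by (apply Rinv_0_lt_compat, pow_lt; lra).
      replace (W / 2 ^ k) with (W * t) by reflexivity. replace (H / 2 ^ k) with (H * t) by reflexivity.
      cbv zeta. intros Ha1 Ha2 Ha3 Hc1 Hc2 Hc3 Hw Hh _ Hc' _ u Hu.
      pose proof (is_bdry_int_minus _ _ _ _ _ _ _ _ Hu
        (is_bdry_int_affine (F (x, y) - l * (x, y)) l a' (a' + W * t) c' (c' + H * t))) as Hm.
      replace (u - 0)%C with u in Hm by ring.
      apply (is_bdry_int_bound _ _ _ _ _ (eps / (2 * kap) * (W * t + H * t))) in Hm;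
        [| nra | nra |].
      + eapply Rle_trans; [exact Hm|].
        replace (2 * (a' + W * t - a' + (c' + H * t - c')) * (eps / (2 * kap) * (W * t + H * t)))
          with (eps / kap * ((W + H) * (W + H) * t * t)) by (field; lra).
        right. unfold kap. field. repeat split; nra.
      + intros x' y' Hx' Hy'.
        specialize (Hd ((x', y') - (x, y))%C).
        assert (Hs : Cmod ((x', y') - (x, y))%C <= W * t + H * t).
        { eapply Rle_trans; [apply Cmod_le_Re_Im|]. reim.
          apply Rplus_le_compat; apply Rabs_le; lra. }
        specialize (Hd ltac:(lra)).
        replace ((x, y) + ((x', y') - (x, y)))%C with ((x', y') : C) in Hd
          by (apply C_ext; reim; ring).
        replace (F (x', y') - (F (x, y) - l * (x, y) + l * (x', y')))%C
          with (F (x', y') - F (x, y) - l * ((x', y') - (x, y)))%C by ring.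
        eapply Rle_trans; [exact Hd|]. apply Rmult_le_compat_l; [|assumption].
        left; apply Rdiv_lt_0_compat; lra. }
  apply Cmod_eq_0. apply Rle_antisym; [|apply Cmod_ge_0].
  apply le_epsilon. intros e He. rewrite Rplus_0_l.
  assert (HA : 0 < (b - a) * (d - c)) by nra.
  eapply Rle_trans; [apply (Main (e / ((b - a) * (d - c)))); apply Rdiv_lt_0_compat; assumption|].
  right. field. lra.
Qed.

(** On a rectangle one period wide the vertical sides cancel, so Cauchy's theorem equates the
    horizontal ones. *)
Lemma periodic_int_indep (F : C -> C) (T y1 y2 : R) (l : C) : Cdiff_on_H F -> 0 < T ->
  (forall z, 0 < Im z -> F (z + T)%C = F z) -> 0 < y1 -> 0 < y2 ->
  is_CInt (fun x => F (x, y1)) 0 T l -> is_CInt (fun x => F (x, y2)) 0 T l.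
Proof.
  intros HF HT Hp.
  assert (K : forall y1 y2 l m, 0 < y1 -> y1 < y2 -> is_CInt (fun x => F (x, y1)) 0 T l ->
    is_CInt (fun x => F (x, y2)) 0 T m -> l = m).
  { clear y1 y2 l. intros y1 y2 l m H1 H2 Hl Hm.
    destruct (ex_CInt_continuous (fun y => F (0, y)) y1 y2 ltac:(lra)) as [i Hi];
      [intros; apply Cdiff_Ccont_v; auto; lra|].
    assert (Hi' : is_CInt (fun y => F (T, y)) y1 y2 i).
    { eapply is_CInt_ext; [lra| |exact Hi]. intros y Hy.
      cbv beta; rewrite <- (Hp (0, y)) by (simpl; lra). f_equal. apply C_ext; reim; ring. }
    assert (E : (l + Ci * i - m - Ci * i)%C = 0).
    { apply (goursat F 0 T y1 y2); auto. exists l, i, m, i. auto. }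
    replace l with ((l + Ci * i - m - Ci * i) + m)%C by ring. rewrite E. ring. }
  intros H1 H2 Hl.
  destruct (Rtotal_order y1 y2) as [L|[L|L]].
  - destruct (ex_CInt_continuous (fun x => F (x, y2)) 0 T ltac:(lra)) as [m Hm];
      [intros; apply Cdiff_Ccont_h; auto|].
    rewrite (K y1 y2 l m); auto.
  - subst; assumption.
  - destruct (ex_CInt_continuous (fun x => F (x, y2)) 0 T ltac:(lra)) as [m Hm];
      [intros; apply Cdiff_Ccont_h; auto|].
    rewrite <- (K y2 y1 m l); auto.
Qed.

(** If [l] were non-zero, moving [z] in the direction [j z / l] would increase [|j|]. *)
Lemma unimodular_Cderiv_0 (j : C -> C) (z l : C) :
  (forall w, 0 < Im w -> Cmod (j w) = 1) -> 0 < Im z -> Cderiv j z l -> l = 0.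
Proof.
  intros Hj Hz Hl. apply NNPP. intro Hl0.
  assert (Pl : 0 < Cmod l) by (apply Cmod_gt_0; assumption).
  destruct (Hl (Cmod l / 2)) as [d [Hd0 Hd]]; [lra|].
  set (m := Rmin d (Im z)). assert (Hm : 0 < m) by (apply Rmin_pos; assumption).
  pose proof (Rmin_l d (Im z)). pose proof (Rmin_r d (Im z)). fold m in H, H0.
  assert (Pj : j z <> 0) by (apply Cmod_gt_0; rewrite Hj; lra).
  (* This makes [Cmod h = m / 2], so that [z + h] stays in the half plane, and [l * h = t * j z], so
     that the linear part lengthens [j z] by [t] while the error is at most [t / 2]. *)
  set (t := Cmod l * m / 2). assert (Ht : 0 < t) by (unfold t; nra).
  set (h := (t * j z / l)%C).
  assert (Hh : Cmod h = m / 2).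
  { unfold h. rewrite Cmod_div, Cmod_mult, Cmod_R, Hj, Rabs_right by (try assumption; lra).
    unfold t. field. lra. }
  specialize (Hd h ltac:(lra)).
  pose proof (Im_le_Cmod h) as Hi. apply Rabs_le_between in Hi.
  assert (E1 : Cmod (j (z + h)%C) = 1) by (apply Hj; reim; lra).
  assert (E2 : Cmod (j z + l * h)%C = 1 + t).
  { replace (j z + l * h)%C with ((RtoC (1 + t)) * j z)%C
      by (unfold h; rewrite RtoC_plus; field; assumption).
    rewrite Cmod_mult, Cmod_R, Hj, Rabs_right by lra. ring. }
  pose proof (Cmod_triangle_sub (j z + l * h) (j (z + h)%C)) as Tr.
  rewrite Cmod_minus_sym in Tr.
  replace (j (z + h) - (j z + l * h))%C with (j (z + h) - j z - l * h)%C in Tr by ring.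
  rewrite E1, E2 in Tr. rewrite Hh in Hd.
  replace (Cmod l / 2 * (m / 2)) with (t / 2) in Hd by (unfold t; field). lra.
Qed.

Lemma Cderiv_0_const (j : C -> C) (z w : C) :
  (forall x, 0 < Im x -> Cderiv j x 0) -> 0 < Im z -> 0 < Im w -> j z = j w.
Proof.
  intros Hj Hz Hw.
  set (v := (w - z)%C).
  assert (Hin : forall t, 0 <= t <= 1 -> 0 < Im (z + t * v)%C).
  { intros t Ht. unfold v. reim. nra. }
  (* The mean value theorem concerns real functions, so [j] is followed along the segment through
     [pr], which will be [Re] and [Im]. *)
  assert (Lim : forall (pr : C -> R), (forall x, Rabs (pr x) <= Cmod x) ->
     (forall x y, pr (x - y)%C = pr x - pr y) ->
     forall t, 0 <= t <= 1 -> derivable_pt_lim (fun t => pr (j (z + t * v)%C)) t 0).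
  { intros pr Hpr Hsub t Ht eps Heps.
    pose proof (Cmod_ge_0 v).
    assert (Hq : 0 < eps / (2 * (1 + Cmod v))) by (apply Rdiv_lt_0_compat; lra).
    destruct (Hj _ (Hin t Ht) _ Hq) as [d [Hd0 Hd]].
    assert (Hd' : 0 < d / (1 + Cmod v)) by (apply Rdiv_lt_0_compat; lra).
    exists (mkposreal _ Hd'). simpl. intros h Hh0 Hh.
    rewrite Rminus_0_r.
    apply (Rmult_lt_compat_r (1 + Cmod v)) in Hh; [|lra].
    replace (d / (1 + Cmod v) * (1 + Cmod v)) with d in Hh by (field; lra).
    pose proof (Rabs_pos h).
    specialize (Hd (h * v)%C). rewrite Cmod_RtoC_mult in Hd. specialize (Hd ltac:(nra)).
    replace (z + t * v + h * v)%C with (z + RtoC (t + h) * v)%C in Hd by (rewrite RtoC_plus; ring).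
    replace (j (z + RtoC (t + h) * v) - j (z + t * v) - 0 * (h * v))%C
      with (j (z + RtoC (t + h) * v) - j (z + t * v))%C in Hd by ring.
    rewrite <- Hsub. unfold Rdiv. rewrite Rabs_mult, Rabs_inv.
    assert (0 < Rabs h) by (apply Rabs_pos_lt; assumption).
    apply (Rmult_lt_reg_r (Rabs h)); [assumption|].
    rewrite Rmult_assoc, Rinv_l, Rmult_1_r by lra.
    eapply Rle_lt_trans; [apply Hpr|]. eapply Rle_lt_trans; [apply Hd|].
    replace (eps / (2 * (1 + Cmod v)) * (Rabs h * Cmod v))
      with (eps / (2 * (1 + Cmod v)) * Cmod v * Rabs h) by ring.
    apply Rmult_lt_compat_r; [assumption|].
    apply Rle_lt_trans with (eps / (2 * (1 + Cmod v)) * (1 + Cmod v)).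
    - apply Rmult_le_compat_l; lra.
    - replace (eps / (2 * (1 + Cmod v)) * (1 + Cmod v)) with (eps / 2) by (field; lra). lra. }
  assert (Eq : forall (pr : C -> R), (forall x, Rabs (pr x) <= Cmod x) ->
     (forall x y, pr (x - y)%C = pr x - pr y) -> pr (j z) = pr (j w)).
  { intros pr H1 H2. pose proof (Lim pr H1 H2) as L.
    destruct (MVT_gen (fun t => pr (j (z + t * v)%C)) 0 1 (fun _ => 0)) as [c [_ E]].
    - intros x Hx. rewrite Rmin_left, Rmax_right in Hx by lra. apply is_derive_Reals. apply L. lra.
    - intros x Hx. rewrite Rmin_left, Rmax_right in Hx by lra.
      apply derivable_continuous_pt. exists 0. apply L; lra.
    - replace (z + 0 * v)%C with z in E by ring.
      replace (z + 1 * v)%C with w in E by (unfold v; ring). lra. }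
  apply C_ext; apply Eq; auto using re_le_Cmod, Im_le_Cmod.
Qed.

(** A translation has denominator 1, so its automorphy factor has modulus 1; being constant, it
    makes [f] quasi-periodic with a fixed multiplier. *)
Lemma unimodular_const (j : C -> C) (z w : C) :
  holomorphic_on (half_plane 0) j -> (forall w, 0 < Im w -> Cmod (j w) = 1) ->
  0 < Im z -> 0 < Im w -> j z = j w.
Proof.
  intros Hh Hj. apply Cderiv_0_const. intros x Hx.
  destruct (holomorphic_Cderiv _ _ _ Hh Hx) as [l Hl].
  rewrite <- (unimodular_Cderiv_0 j x l); assumption.
Qed.

(** * The action of SL2(Z) *)

Lemma SL2Z_ext (g g' : SL2Z) :
  ma g = ma g' -> mb g = mb g' -> mc g = mc g' -> md g = md g' -> g = g'.
Proof.
  destruct g as [a b c d D], g' as [a' b' c' d' D']; simpl; intros; subst.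
  f_equal. apply UIP_dec, Z.eq_dec.
Qed.

Lemma SL2Z_mul_assoc (x y z : SL2Z) :
  SL2Z_mul x (SL2Z_mul y z) = SL2Z_mul (SL2Z_mul x y) z.
Proof. apply SL2Z_ext; simpl; ring. Qed.

Lemma SL2Z_mul_inv_l (x : SL2Z) : SL2Z_mul (SL2Z_inv x) x = SL2Z_one.
Proof. apply SL2Z_ext; simpl; pose proof (SL2Z_det x); lia. Qed.

Lemma SL2Z_mul_1_l (x : SL2Z) : SL2Z_mul SL2Z_one x = x.
Proof. apply SL2Z_ext; simpl; destruct (mb x), (ma x), (mc x), (md x); reflexivity. Qed.

Lemma SL2Z_mul_1_r (x : SL2Z) : SL2Z_mul x SL2Z_one = x.
Proof. apply SL2Z_ext; simpl; ring. Qed.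

Lemma SL2Z_inv_mul (x y : SL2Z) : SL2Z_inv (SL2Z_mul x y) = SL2Z_mul (SL2Z_inv y) (SL2Z_inv x).
Proof. apply SL2Z_ext; simpl; ring. Qed.

Lemma SL2Z_inv_inv (x : SL2Z) : SL2Z_inv (SL2Z_inv x) = x.
Proof. apply SL2Z_ext; simpl; ring. Qed.

Lemma SL2Z_T_det (n : Z) : (1 * 1 - n * 0 = 1)%Z.
Proof. ring. Qed.

Definition SL2Z_T (n : Z) : SL2Z := mkSL2Z 1 n 0 1 (SL2Z_T_det n).

Lemma SL2Z_T_add (m n : Z) : SL2Z_mul (SL2Z_T m) (SL2Z_T n) = SL2Z_T (m + n).
Proof. apply SL2Z_ext; unfold SL2Z_mul, SL2Z_T; cbn [ma mb mc md]; ring. Qed.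

Lemma SL2Z_T_inv (n : Z) : SL2Z_inv (SL2Z_T n) = SL2Z_T (- n).
Proof. apply SL2Z_ext; reflexivity. Qed.

(** In the induction either the head [r] serves two indices, or it serves none from some index on,
    and then the shifted family only uses the tail. *)
Lemma pigeonhole {A : Type} (l : list A) : forall P : nat -> A -> Prop,
  (forall i, exists r, In r l /\ P i r) -> exists i j r, (i < j)%nat /\ P i r /\ P j r.
Proof.
  induction l as [|r l IH]; intros P H.
  - destruct (H 0%nat) as [r [[] _]].
  - destruct (classic (exists i j, (i < j)%nat /\ P i r /\ P j r)) as [[i [j Hij]]|N].
    + exists i, j, r. exact Hij.
    + assert (K : exists i0, forall i, (i0 <= i)%nat -> ~ P i r).
      { destruct (classic (exists i, P i r)) as [[i Hi]|N'].
        - exists (S i). intros j Hj Pj. apply N. exists i, j. repeat split; auto.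
        - exists 0%nat. intros i _ Hi. apply N'. exists i; auto. }
      destruct K as [i0 Hi0].
      destruct (IH (fun i => P (i0 + i)%nat)) as [i [j [r' [Hij [Hi Hj]]]]].
      * intro i. destruct (H (i0 + i)%nat) as [r' [[<-|Hr'] Hp]].
        -- exfalso. apply (Hi0 (i0 + i)%nat); [lia|assumption].
        -- exists r'. auto.
      * exists (i0 + i)%nat, (i0 + j)%nat, r'. repeat split; auto. lia.
Qed.

(** Two of the elements [rho T^i] lie in the same coset of [G], and their quotient is
    [rho T^(j - i) rho^(-1)]. This gives a period at every cusp, with no normality of [G]. *)
Lemma conj_T_in (G : SL2Z -> Prop) (rho : SL2Z) : is_subgroup G -> finite_index G ->
  exists N : nat, (1 <= N)%nat /\ G (SL2Z_mul (SL2Z_mul rho (SL2Z_T (Z.of_nat N))) (SL2Z_inv rho)).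
Proof.
  intros [_ [Hm Hi]] [l Hl].
  destruct (pigeonhole l (fun n r => G (SL2Z_mul (SL2Z_mul rho (SL2Z_T (Z.of_nat n))) (SL2Z_inv r))))
    as [i [j [r [Hij [H1 H2]]]]]; [intro; apply Hl|].
  exists (j - i)%nat. split; [lia|].
  apply Hi in H1. pose proof (Hm _ _ H2 H1) as H3.
  rewrite !SL2Z_inv_mul, SL2Z_inv_inv in H3.
  rewrite <- SL2Z_mul_assoc in H3. rewrite (SL2Z_mul_assoc (SL2Z_inv r)) in H3.
  rewrite SL2Z_mul_inv_l, SL2Z_mul_1_l in H3.
  rewrite SL2Z_T_inv, <- SL2Z_mul_assoc, (SL2Z_mul_assoc (SL2Z_T _)), SL2Z_T_add in H3.
  rewrite <- SL2Z_mul_assoc. replace (Z.of_nat (j - i)) with (Z.of_nat j + - Z.of_nat i)%Z by lia.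
  exact H3.
Qed.

Lemma IZR_det (g : SL2Z) : IZR (ma g) * IZR (md g) - IZR (mb g) * IZR (mc g) = 1.
Proof. rewrite <- !mult_IZR, <- minus_IZR, SL2Z_det. reflexivity. Qed.

Lemma denom_neq_0 (g : SL2Z) (z : C) : 0 < Im z -> denom g z <> 0.
Proof.
  intros Hz E. unfold denom in E.
  assert (E1 : Im (IZR (mc g) * z + IZR (md g))%C = 0) by (rewrite E; reflexivity).
  assert (E2 : Re (IZR (mc g) * z + IZR (md g))%C = 0) by (rewrite E; reflexivity).
  autorewrite with reim in E1, E2.
  assert (Hc : IZR (mc g) = 0) by nra.
  pose proof (IZR_det g). rewrite Hc in *. nra.
Qed.

Lemma Cmod_denom_pos (g : SL2Z) (z : C) : 0 < Im z -> 0 < Cmod (denom g z).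
Proof. intro H. apply Cmod_gt_0, denom_neq_0, H. Qed.

Lemma Im_div (a b : C) : b <> 0 -> Im (a / b)%C = (Im a * Re b - Re a * Im b) / (Cmod b * Cmod b).
Proof.
  intro Hb. assert (Pb : 0 < Cmod b) by (apply Cmod_gt_0; assumption).
  pose proof (Cmod_sqr b) as S.
  rewrite S. destruct a as [x y], b as [u v]. unfold Cdiv, Cinv, Cmult, Re, Im in *; simpl in *.
  field. nra.
Qed.

Lemma Im_moebius (g : SL2Z) (z : C) : 0 < Im z ->
  Im (moebius g z) = Im z / (Cmod (denom g z) * Cmod (denom g z)).
Proof.
  intro Hz. unfold moebius. rewrite Im_div by (apply denom_neq_0; assumption).
  f_equal. unfold denom. reim. pose proof (IZR_det g).
  transitivity (Im z * (IZR (ma g) * IZR (md g) - IZR (mb g) * IZR (mc g))); [ring|].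
  rewrite H; ring.
Qed.

Lemma Im_moebius_pos (g : SL2Z) (z : C) : 0 < Im z -> 0 < Im (moebius g z).
Proof.
  intro Hz. rewrite Im_moebius by assumption. pose proof (Cmod_denom_pos g z Hz).
  apply Rdiv_lt_0_compat; nra.
Qed.

Lemma denom_mul (g g' : SL2Z) (z : C) : 0 < Im z ->
  denom (SL2Z_mul g g') z = (denom g (moebius g' z) * denom g' z)%C.
Proof.
  intro Hz. pose proof (denom_neq_0 g' z Hz) as H. unfold moebius.
  unfold denom at 1 2. unfold SL2Z_mul; simpl.
  rewrite !plus_IZR, !mult_IZR, !RtoC_plus, !RtoC_mult.
  field_simplify; [|assumption]. unfold denom. ring.
Qed.

Lemma moebius_mul (g g' : SL2Z) (z : C) : 0 < Im z ->
  moebius (SL2Z_mul g g') z = moebius g (moebius g' z).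
Proof.
  intro Hz. pose proof (denom_neq_0 g' z Hz) as H.
  pose proof (denom_neq_0 g _ (Im_moebius_pos g' z Hz)) as H'.
  unfold moebius at 1. rewrite denom_mul by assumption. unfold moebius at 2.
  set (D := denom g (moebius g' z)) in *.
  unfold moebius. set (D' := denom g' z) in *.
  field_simplify; try (repeat split; assumption). f_equal.
  unfold D', denom. unfold SL2Z_mul; simpl.
  rewrite !plus_IZR, !mult_IZR, !RtoC_plus, !RtoC_mult. ring.
Qed.

Lemma moebius_one (z : C) : moebius SL2Z_one z = z.
Proof. unfold moebius, denom; simpl. field. Qed.

Lemma denom_one (z : C) : denom SL2Z_one z = 1.
Proof. unfold denom; simpl. ring. Qed.

Lemma moebius_inv_l (g : SL2Z) (z : C) : 0 < Im z -> moebius (SL2Z_inv g) (moebius g z) = z.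
Proof. intro Hz. rewrite <- moebius_mul, SL2Z_mul_inv_l by assumption. apply moebius_one. Qed.

Lemma denom_inv_l (g : SL2Z) (z : C) : 0 < Im z ->
  denom (SL2Z_inv g) (moebius g z) = (/ denom g z)%C.
Proof.
  intro Hz. pose proof (denom_mul (SL2Z_inv g) g z Hz) as E.
  rewrite SL2Z_mul_inv_l, denom_one in E. pose proof (denom_neq_0 g z Hz).
  replace (denom (SL2Z_inv g) (moebius g z))
    with ((denom (SL2Z_inv g) (moebius g z) * denom g z) / denom g z)%C by (field; assumption).
  rewrite <- E. field; assumption.
Qed.

Lemma moebius_T (n : Z) (z : C) : moebius (SL2Z_T n) z = (z + IZR n)%C.
Proof. unfold moebius, denom; simpl. field. Qed.

Lemma denom_T (n : Z) (z : C) : denom (SL2Z_T n) z = 1.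
Proof. unfold denom; simpl. ring. Qed.

Lemma Cmod_Cpowr (z : C) (k : R) : Cmod (Cpowr z k) = Rpower (Cmod z) k.
Proof.
  unfold Cpowr, Rpower. rewrite Cmod_Cexp. f_equal. reim.
  unfold Clog. reim. ring.
Qed.

Lemma Rpower_pos (x k : R) : 0 < Rpower x k.
Proof. apply exp_pos. Qed.

Lemma Cmod_slash (k : R) (f : C -> C) (g : SL2Z) (z : C) :
  Cmod (slash k f g z) = Rpower (Cmod (denom g z)) (- k) * Cmod (f (moebius g z)).
Proof. unfold slash. rewrite Cmod_mult, Cmod_Cpowr. reflexivity. Qed.

Lemma holomorphic_at_of_on (f : C -> C) (z : C) :
  holomorphic_on (half_plane 0) f -> 0 < Im z -> holomorphic_at f z.
Proof.
  intros Hf Hz. exists (mkposreal _ Hz). intros w [_ Hw]. apply Hf. unfold half_plane.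
  unfold ball in Hw; simpl in Hw. unfold AbsRing_ball, abs, minus, plus, opp in Hw; simpl in Hw.
  apply Rabs_def2 in Hw. unfold Im in *. simpl in *. lra.
Qed.

(** The denominator is multiplicative along the product, and [|j| = |c z + d|^k] cancels the power
    coming from [del]. Without the moduli a unimodular factor would remain. *)
Lemma slash_coset (k : R) (G : SL2Z -> Prop) (f : C -> C) (j : SL2Z -> C -> C) (del rho : SL2Z) (w : C) :
  holomorphic_on (half_plane 0) f -> automorphic k G f j -> G del -> 0 < Im w ->
  Cmod (slash k f (SL2Z_mul del rho) w) = Cmod (slash k f rho w).
Proof.
  intros Hf Ha Hd Hw. rewrite !Cmod_slash.
  rewrite denom_mul, moebius_mul by assumption.
  pose proof (Im_moebius_pos rho w Hw) as Hw'.
  destruct (Ha del Hd) as [_ Hj]. destruct (Hj _ Hw') as [H1 H2].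
  rewrite H2 by (apply holomorphic_at_of_on; auto; apply Im_moebius_pos; assumption).
  rewrite !Cmod_mult, H1.
  rewrite <- Rpower_mult_distr by (apply Cmod_denom_pos; assumption).
  set (A := Cmod (denom del (moebius rho w))).
  assert (E : Rpower A (- k) * Rpower A k = 1).
  { rewrite <- Rpower_plus, Rplus_opp_l. apply Rpower_O. apply Cmod_denom_pos; assumption. }
  transitivity (Rpower A (- k) * Rpower A k * (Rpower (Cmod (denom rho w)) (- k) * Cmod (f (moebius rho w)))); [ring|].
  rewrite E. ring.
Qed.

Lemma translation_constant (k : R) (G : SL2Z -> Prop) (f : C -> C) (j : SL2Z -> C -> C) (n : Z) :
  holomorphic_on (half_plane 0) f -> automorphic k G f j -> G (SL2Z_T n) ->
  exists u : C, Cmod u = 1 /\ forall z, 0 < Im z -> f (z + IZR n)%C = (u * f z)%C.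
Proof.
  intros Hf Ha Hn. destruct (Ha _ Hn) as [Hh Hj].
  assert (Hm : forall w, 0 < Im w -> Cmod (j (SL2Z_T n) w) = 1).
  { intros w Hw. destruct (Hj w Hw) as [-> _]. rewrite denom_T, Cmod_1.
    unfold Rpower. rewrite ln_1, Rmult_0_r. apply exp_0. }
  assert (Hi : 0 < Im Ci) by (simpl; lra).
  exists (j (SL2Z_T n) Ci). split; [apply Hm, Hi|].
  intros z Hz. rewrite (unimodular_const _ _ z Hh Hm Hi Hz).
  destruct (Hj z Hz) as [_ H2]. rewrite <- moebius_T.
  apply H2; apply holomorphic_at_of_on; auto. rewrite moebius_T. reim. lra.
Qed.

(** * Expansions at infinity *)

Fixpoint csum (F : nat -> C) (n : nat) : C :=
  match n with O => 0 | S m => (csum F m + F m)%C end.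

Definition lsum (l : list C) : C := fold_right Cplus (RtoC 0) l.

Lemma lsum_app (l m : list C) : lsum (l ++ m) = (lsum l + lsum m)%C.
Proof. induction l; unfold lsum in *; simpl; [ring|]. rewrite IHl. ring. Qed.

Lemma lsum_map_seq (F : nat -> C) (n : nat) : lsum (map F (seq 0 n)) = csum F n.
Proof.
  induction n; [reflexivity|]. rewrite seq_S, map_app, lsum_app, IHn. simpl.
  unfold lsum; simpl. ring.
Qed.

Lemma lsum_zero (l : list C) : (forall x, In x l -> x = 0) -> lsum l = 0.
Proof.
  induction l as [|x l IH]; intro H; [reflexivity|]. unfold lsum in *; simpl.
  rewrite (H x) by (left; reflexivity). rewrite IH by (intros; apply H; right; assumption). ring.
Qed.

Lemma csum_zero (F : nat -> C) (n : nat) : (forall i, (i < n)%nat -> F i = 0) -> csum F n = 0.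
Proof.
  induction n; intro H; [reflexivity|]. simpl. rewrite H, IHn by (intros; try apply H; lia). ring.
Qed.

Lemma list_bounded {A : Type} (v : A -> R) (l : list A) :
  exists B, 0 < B /\ forall x, In x l -> v x <= B.
Proof.
  induction l as [|x l [B [PB HB]]]; [exists 1; split; [lra|intros x []]|].
  exists (Rmax (v x) B). split; [eapply Rlt_le_trans; [exact PB|apply Rmax_r]|].
  intros y [<-|Hy]; [apply Rmax_l|]. eapply Rle_trans; [apply HB, Hy|apply Rmax_r].
Qed.

(** Adding one more index to [l0] keeps the partial sum within 1 of [s], so a term outside [l0] has
    modulus at most 2. *)
Lemma is_sum_over_bounded {T : Type} (dec : forall x y : T, {x = y} + {x <> y})
  (D : T -> Prop) (F : T -> C) (s : C) :
  is_sum_over D F s -> exists B, forall x, D x -> Cmod (F x) <= B.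
Proof.
  intro H. destruct (H 1 Rlt_0_1) as [l0 [Hl0 H0]].
  destruct (list_bounded (fun x => Cmod (F x)) l0) as [B [_ HB]]. exists (Rmax B 2). intros x Hx.
  destruct (in_dec dec x l0) as [Hi|Hi]; [eapply Rle_trans; [apply HB, Hi|apply Rmax_l]|].
  eapply Rle_trans; [|apply Rmax_r].
  set (l := nodup dec l0).
  assert (Hl : List.Forall D l) by (apply Forall_forall; intros y Hy; apply nodup_In in Hy;
    rewrite Forall_forall in Hl0; auto).
  pose proof (H0 l (NoDup_nodup _ _) Hl (fun y Hy => proj2 (nodup_In dec l0 y) Hy)) as A1.
  assert (A2 : Cmod (fold_right Cplus (RtoC 0) (map F (x :: l)) - s)%C < 1).
  { apply H0.
    - constructor; [intro Hn; apply nodup_In in Hn; contradiction|apply NoDup_nodup].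
    - constructor; assumption.
    - intros y Hy. right. apply nodup_In. assumption. }
  simpl in A2. set (S := fold_right Cplus (RtoC 0) (map F l)) in *.
  replace (F x) with ((F x + S - s) - (S - s))%C by ring.
  pose proof (Cmod_triangle_minus (F x + S - s) (S - s)). lra.
Qed.

Lemma exponents_ee (h : R) (u : C) (lam : R) : exponents h u lam <-> ee (RtoC (lam * h)) = u.
Proof.
  unfold exponents, ee. rewrite RtoC_mult.
  replace (2 * PI * Ci * (lam * h))%C with (2 * PI * Ci * lam * h)%C by ring. tauto.
Qed.

Lemma exponents_param (h t : R) (u : C) : 0 < h -> u = ee t ->
  forall lam, exponents h u lam <-> exists n : Z, lam = (t + IZR n) / h.
Proof.
  intros Hh -> lam. rewrite exponents_ee. split.
  - intro E. destruct (ee_R_inj _ _ E) as [n Hn]. exists n. rewrite <- Hn. field. lra.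
  - intros [n ->]. replace ((t + IZR n) / h * h) with (t + IZR n) by (field; lra).
    rewrite RtoC_plus, ee_plus, ee_IZR. ring.
Qed.

Lemma nat_above (x : R) : exists n : nat, x <= INR n.
Proof.
  destruct (Rle_dec x 0) as [L|L]; [exists 0%nat; simpl; assumption|].
  destruct (archimed x) as [H _]. exists (Z.to_nat (up x)).
  rewrite INR_IZR_INZ, Z2Nat.id; [lra|]. apply le_IZR. lra.
Qed.

Lemma exp_2pi_half (x : R) : 1 <= x -> exp (- (2 * PI * x)) <= 1 / 2.
Proof.
  intro Hx. pose proof PI2_1.
  pose proof (exp_ineq1_le (2 * PI * x)). rewrite exp_Ropp.
  assert (2 <= exp (2 * PI * x)) by nra.
  replace (1 / 2) with (/ 2) by field. apply Rinv_le_contravar; lra.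
Qed.

(** A quantitative expansion: ordered partial sums, with a remainder of the size of the first
    omitted term. This form serves both to isolate a leading term and to integrate term by term. *)
Definition expands (G : C -> C) (h l0 y0 B : R) (A : nat -> C) : Prop :=
  0 < h /\ 0 <= B /\ forall n z, y0 + h <= Im z ->
    Cmod (G z - csum (fun i => A i * ee (RtoC (l0 + INR i / h) * z)) n)%C
      <= B * exp (- (2 * PI * (l0 + INR n / h) * (Im z - y0))).

(** Finite order allows the relevant exponents to be listed upwards from some [l0] with step
    [1 / h]. Summability at the single height [y0] bounds all terms there; at least [h] higher they
    decrease geometrically, with ratio at most 1/2. *)
Lemma expansion_struct (G : C -> C) (h : R) (u : C) (a : R -> C) :
  is_expansion G h u a -> finite_order_coeffs h u a ->
  exists l0 y0 B : R,
    (forall n, exponents h u (l0 + INR n / h)) /\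
    (forall lam, exponents h u lam -> a lam <> 0 -> exists n, lam = l0 + INR n / h) /\
    expands G h l0 y0 B (fun n => a (l0 + INR n / h)).
Proof.
  intros [r [[_ [Hh [Hu _]]] HG]] [l Hl].
  destruct (unit_polar u Hu) as [t Ht].
  pose proof (exponents_param h t u Hh Ht) as Hexp.
  destruct (list_bounded Ropp l) as [m' [_ Hm']].
  set (m := - m'). assert (Hm : forall x, In x l -> m <= x)
    by (intros x Hx; specialize (Hm' x Hx); unfold m; lra).
  (* Chosen so that [l0] is at most 0 and at most the lower bound [m] of the exceptional exponents;
     below [l0] all coefficients vanish. *)
  destruct (nat_above (Rmax t (t - m * h))) as [n0 Hn0].
  pose proof (Rmax_l t (t - m * h)) as M1. pose proof (Rmax_r t (t - m * h)) as M2.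
  set (l0 := (t - INR n0) / h).
  assert (L0 : l0 * h = t - INR n0) by (unfold l0; field; lra).
  assert (Hl0 : l0 <= 0) by (apply Rmult_le_reg_r with h; lra).
  assert (Hl0m : l0 <= m) by (apply Rmult_le_reg_r with h; lra).
  set (L := fun n => l0 + INR n / h).
  assert (HLexp : forall n, exponents h u (L n)).
  { intro n. apply Hexp. exists (Z.of_nat n - Z.of_nat n0)%Z.
    rewrite minus_IZR, <- !INR_IZR_INZ. unfold L, l0. field; lra. }
  assert (HLsurj : forall lam, exponents h u lam -> a lam <> 0 -> exists n, lam = L n).
  { intros lam H1 H2.
    assert (H3 : l0 <= lam).
    { destruct (Rle_dec 0 lam) as [P|P]; [lra|]. apply Rle_trans with m; [lra|].
      apply Hm, Hl; auto; lra. }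
    apply Hexp in H1. destruct H1 as [n Hn].
    assert (H4 : lam * h = t + IZR n) by (rewrite Hn; field; lra).
    assert (H5 : l0 * h <= lam * h) by (apply Rmult_le_compat_r; lra).
    assert (H6 : (- Z.of_nat n0 <= n)%Z).
    { apply le_IZR. rewrite opp_IZR, <- INR_IZR_INZ. lra. }
    exists (Z.to_nat (n + Z.of_nat n0)). unfold L.
    rewrite (INR_IZR_INZ (Z.to_nat _)), Z2Nat.id, plus_IZR, <- INR_IZR_INZ by lia.
    rewrite Hn. unfold l0. field; lra. }
  assert (Linj : forall n p, L n = L p -> n = p).
  { intros n p E. apply INR_eq. unfold L in E.
    assert (INR n / h = INR p / h) by lra.
    replace (INR n) with (INR n / h * h) by (field; lra). rewrite H. field; lra. }
  set (y0 := r + 1).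
  destruct (is_sum_over_bounded Req_EM_T _ _ _ (HG (Ci * y0)%C
     ltac:(unfold half_plane; reim; unfold y0; lra))) as [B HB].
  assert (HBn : forall n, Cmod (a (L n)) <= B * exp (2 * PI * L n * y0)).
  { intro n. specialize (HB _ (HLexp n)). rewrite Cmod_mult in HB.
    change (Cexp (2 * PI * Ci * L n * (Ci * y0)))%C with (Cexp (2 * PI * Ci * L n * (Ci * y0))%C) in HB.
    replace (2 * PI * Ci * L n * (Ci * y0))%C with (2 * PI * Ci * (L n * (Ci * y0)))%C in HB by ring.
    change (Cexp (2 * PI * Ci * (L n * (Ci * y0)))%C) with (ee (L n * (Ci * y0))) in HB.
    rewrite Cmod_ee in HB.
    replace (2 * PI * Im (L n * (Ci * y0))%C) with (2 * PI * L n * y0) in HB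
      by (reim; ring).
    rewrite exp_Ropp in HB. pose proof (exp_pos (2 * PI * L n * y0)) as PE.
    apply (Rmult_le_compat_r (exp (2 * PI * L n * y0))) in HB; [|lra].
    rewrite Rmult_assoc, Rinv_l, Rmult_1_r in HB by lra. exact HB. }
  assert (PB : 0 <= B) by (eapply Rle_trans; [apply Cmod_ge_0|apply HB, (HLexp 0%nat)]).
  exists l0, y0, (2 * B). split; [exact HLexp|]. split; [exact HLsurj|].
  split; [exact Hh|]. split; [lra|]. intros n z Hz.
  set (F := fun i => (a (l0 + INR i / h)%R * ee (RtoC (l0 + INR i / h) * z))%C).
  set (Y := Im z - y0). assert (HY : h <= Y) by (unfold Y; lra).
  set (E := exp (- (2 * PI * (l0 + INR n / h) * Y))).
  pose proof PI_RGT_0 as HPI.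
  assert (PE : 0 < E) by apply exp_pos.
  assert (HF : forall i, Cmod (F (n + i)%nat) <= B * E * (1 / 2) ^ i).
  { intro i. unfold F. rewrite Cmod_mult, Cmod_ee. fold (L (n + i)%nat).
    apply Rle_trans with (B * exp (2 * PI * L (n + i)%nat * y0) * exp (- (2 * PI * Im (L (n + i)%nat * z)%C))).
    - apply Rmult_le_compat_r; [left; apply exp_pos|apply HBn].
    - rewrite !Rmult_assoc. apply Rmult_le_compat_l; [assumption|].
      rewrite <- exp_plus.
      replace (2 * (PI * (L (n + i)%nat * y0)) + - (2 * (PI * Im (L (n + i)%nat * z)%C)))
        with (- (2 * PI * (l0 + INR n / h) * Y) + - (2 * PI * (Y / h)) * INR i)
        by (reim; unfold L, Y; rewrite plus_INR; field; lra).
      rewrite exp_plus. fold E. apply Rmult_le_compat_l; [lra|].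
      assert (Q : exp (- (2 * PI * (Y / h))) <= 1 / 2).
      { apply exp_2pi_half. apply Rmult_le_reg_r with h; [assumption|]. unfold Rdiv.
        rewrite Rmult_assoc, Rinv_l; lra. }
      clear - Q. induction i as [|i IH].
      + simpl. rewrite Rmult_0_r, exp_0. lra.
      + rewrite S_INR, Rmult_plus_distr_l, Rmult_1_r, exp_plus, Rmult_comm. simpl.
        apply Rmult_le_compat; try (left; apply exp_pos); assumption. }
  assert (HS : forall i, Cmod (csum F (n + i) - csum F n)%C <= 2 * B * E * (1 - (1/2) ^ i)).
  { induction i as [|i IH].
    - rewrite Nat.add_0_r. replace (csum F n - csum F n)%C with (RtoC 0) by ring.
      rewrite Cmod_0. simpl. lra.
    - rewrite Nat.add_succ_r. simpl csum.
      replace (csum F (n + i) + F (n + i)%nat - csum F n)%C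
        with ((csum F (n + i) - csum F n) + F (n + i)%nat)%C by ring.
      eapply Rle_trans; [apply Cmod_triangle|]. specialize (HF i). simpl. lra. }
  assert (HS' : forall i, Cmod (csum F (n + i) - csum F n)%C <= 2 * B * E).
  { intro i. eapply Rle_trans; [apply HS|].
    assert (0 < (1/2)^i) by (apply pow_lt; lra).
    assert (0 <= B * E * (1/2)^i) by (apply Rmult_le_pos; [apply Rmult_le_pos|]; lra). lra. }
  apply le_epsilon. intros eps Heps.
  assert (Hzr : half_plane r z) by (unfold half_plane, y0 in *; lra).
  destruct (HG z Hzr eps Heps) as [ls [Hls1 Hls2]].
  assert (Hbig : exists p, forall x, In x ls -> forall m, x = L m -> (m < p)%nat).
  { clear - Linj. induction ls as [|x ls [p Hp]]; [exists 0%nat; intros x []|].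
    destruct (classic (exists m, x = L m)) as [[m Hm]|N].
    - exists (Nat.max p (S m)). intros y [<-|Hy] m' Hm'.
      + assert (m = m') by (apply Linj; congruence). lia.
      + specialize (Hp y Hy m' Hm'). lia.
    - exists p. intros y [<-|Hy] m' Hm'; [exfalso; apply N; eauto|eauto]. }
  destruct Hbig as [p Hp].
  set (q := (n + p)%nat).
  (* The unordered sum is tested on the first [q] exponents together with whatever else [ls]
     contains. These extra exponents have zero coefficients, because [q] exceeds every index that
     occurs in [ls]. *)
  set (base := map L (seq 0 q)).
  set (extra := filter (fun x => if in_dec Req_EM_T x base then false else true) (nodup Req_EM_T ls)).
  assert (Hex : forall x, In x extra -> In x ls /\ ~ In x base).
  { intros x Hx. apply filter_In in Hx. destruct Hx as [H1 H2]. apply nodup_In in H1.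
    destruct (in_dec Req_EM_T x base); [discriminate|auto]. }
  rewrite Forall_forall in Hls1.
  specialize (Hls2 (base ++ extra)).
  assert (N1 : NoDup (base ++ extra)).
  { apply NoDup_app.
    - unfold base. apply NoDup_map_NoDup_ForallPairs; [|apply seq_NoDup].
      intros x y _ _ E'. apply Linj, E'.
    - apply NoDup_filter, NoDup_nodup.
    - intros x H1 H2. apply Hex in H2. tauto. }
  assert (N2 : List.Forall (exponents h u) (base ++ extra)).
  { apply Forall_forall. intros x Hx. apply in_app_or in Hx. destruct Hx as [Hx|Hx].
    - apply in_map_iff in Hx. destruct Hx as [i [<- _]]. apply HLexp.
    - apply Hls1, Hex, Hx. }
  assert (N3 : incl ls (base ++ extra)).
  { intros x Hx. apply in_or_app. destruct (in_dec Req_EM_T x base) as [Hb|Hb]; [left; assumption|].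
    right. apply filter_In. split; [apply nodup_In; assumption|].
    destruct (in_dec Req_EM_T x base); [contradiction|reflexivity]. }
  specialize (Hls2 N1 N2 N3). rewrite map_app in Hls2.
  match type of Hls2 with context [fold_right Cplus (RtoC 0) ?x] =>
    change (fold_right Cplus (RtoC 0) x) with (lsum x) in Hls2 end.
  rewrite lsum_app in Hls2.
  rewrite (lsum_zero (map _ extra)) in Hls2.
  2:{ intros x Hx. apply in_map_iff in Hx. destruct Hx as [lam [<- Hlam]].
      destruct (Hex _ Hlam) as [H1 H2].
      destruct (classic (a lam = 0)) as [Z|NZ]; [rewrite Z; ring|].
      exfalso. destruct (HLsurj lam (Hls1 _ H1) NZ) as [i Hi]. apply H2.
      rewrite Hi. apply in_map. apply in_seq. specialize (Hp _ H1 _ Hi). unfold q. lia. }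
  unfold base in Hls2. rewrite map_map, lsum_map_seq in Hls2.
  replace (csum _ q) with (csum F q) in Hls2.
  2:{ clear. induction q; [reflexivity|]. simpl. rewrite IHq. f_equal. unfold F, ee, L. f_equal. f_equal. ring. }
  unfold q in Hls2.
  replace (csum F (n + p) + 0 - G z)%C with (csum F (n + p) - G z)%C in Hls2 by ring.
  pose proof (Cmod_minus_triangle (G z) (csum F (n + p)) (csum F n)) as Tr.
  rewrite Cmod_minus_sym in Hls2. specialize (HS' p). lra.
Qed.

(** [nu] is the order of the pole of [G] at infinity ([0] if [G] is bounded there). *)
Definition order_at (G : C -> C) (nu : R) : Prop :=
  (0 < nu /\ exists (b : C) (Y K del : R), b <> 0 /\ 0 < Y /\ 0 <= K /\ 0 < del /\
     forall w, Y <= Im w -> Cmod (G w * ee (nu * w) - b)%C <= K * exp (- (del * Im w))) \/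
  (nu = 0 /\ exists Y K : R, 0 < Y /\ 0 <= K /\ forall w, Y <= Im w -> Cmod (G w) <= K).

Lemma mult_inv_cancel (a b : R) : b <> 0 -> a * b * / b = a.
Proof. intro H. field. exact H. Qed.

Lemma inv_mult_cancel (a b : R) : b <> 0 -> a * / b * b = a.
Proof. intro H. field. exact H. Qed.

Lemma exp_le (x y : R) : x <= y -> exp x <= exp y.
Proof. intros [H| ->]; [left; apply exp_increasing, H|lra]. Qed.

Lemma exp_le_1 (x : R) : x <= 0 -> exp x <= 1.
Proof. intro H. rewrite <- exp_0. apply exp_le, H. Qed.

Lemma least_nat (P : nat -> Prop) : (exists n, P n) ->
  exists n, P n /\ forall m, (m < n)%nat -> ~ P m.
Proof.
  intros [n Hn]. revert Hn. induction n as [n IH] using lt_wf_ind. intro Hn.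
  destruct (classic (exists m, (m < n)%nat /\ P m)) as [[m [H1 H2]]|N].
  - apply (IH m); assumption.
  - exists n. split; [assumption|]. intros m H1 H2. apply N. eauto.
Qed.

(** If a negative exponent carries a non-zero coefficient, the least such one is the leading term,
    and the gap [1 / h] to the next exponent gives the decay rate [2 * PI / h]. Otherwise the
    remainder from the first non-negative exponent on is all of [G], and it is bounded. *)
Lemma expands_order (G : C -> C) (h l0 y0 B : R) (A : nat -> C) : expands G h l0 y0 B A ->
  exists nu, 0 <= nu /\ order_at G nu /\
    ((exists n, l0 + INR n / h < 0 /\ A n <> 0) -> 0 < nu).
Proof.
  intros [Hh [HB H]].
  assert (Lmono : forall i n, (i <= n)%nat -> l0 + INR i / h <= l0 + INR n / h).
  { intros i n Hi. apply Rplus_le_compat_l. apply Rmult_le_compat_r.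
    left; apply Rinv_0_lt_compat; assumption. apply le_INR, Hi. }
  pose proof PI_RGT_0 as HPI.
  destruct (classic (exists n, l0 + INR n / h < 0 /\ A n <> 0)) as [Ex|Nex].
  - destruct (least_nat _ Ex) as [n [[Hn1 Hn2] Hn3]].
    set (L := l0 + INR n / h) in *.
    exists (- L). split; [lra|]. split; [|intros _; lra].
    left. split; [lra|].
    exists (A n), (Rmax 1 (y0 + h)), (B * exp (2 * PI * (L + / h) * y0)), (2 * PI / h).
    split; [assumption|]. split; [apply Rlt_le_trans with 1; [lra|apply Rmax_l]|].
    split; [apply Rmult_le_pos; [assumption|left; apply exp_pos]|].
    split; [apply Rdiv_lt_0_compat; lra|].
    intros w Hw. pose proof (Rmax_r 1 (y0 + h)).
    specialize (H (S n) w ltac:(lra)). simpl csum in H.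
    rewrite csum_zero in H.
    2:{ intros i Hi. destruct (classic (A i = 0)) as [Z|NZ]; [rewrite Z; ring|].
        exfalso. apply (Hn3 i Hi). split; [|assumption].
        eapply Rle_lt_trans; [apply (Lmono i n); lia|exact Hn1]. }
    fold L in H.
    replace (G w * ee (RtoC (- L) * w) - A n)%C
      with ((G w - (0 + A n * ee (L * w))) * ee (RtoC (- L) * w))%C.
    2:{ rewrite RtoC_opp. replace (- L * w)%C with (- (L * w))%C by ring. rewrite ee_opp.
        field. apply ee_neq_0. }
    rewrite Cmod_mult, Cmod_ee.
    eapply Rle_trans; [apply Rmult_le_compat_r; [left; apply exp_pos|exact H]|].
    rewrite !Rmult_assoc. apply Rmult_le_compat_l; [assumption|].
    rewrite <- !exp_plus. right. f_equal. rewrite S_INR. unfold L.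
    reim. field. lra.
  - exists 0. split; [lra|]. split; [|tauto].
    right. split; [reflexivity|].
    destruct (nat_above (- l0 * h)) as [n Hn].
    assert (Hn' : 0 <= l0 + INR n / h).
    { apply Rmult_le_reg_r with h; [assumption|]. rewrite Rmult_0_l.
      replace ((l0 + INR n / h) * h) with (l0 * h + INR n) by (field; lra). lra. }
    destruct (least_nat (fun n => 0 <= l0 + INR n / h) (ex_intro _ n Hn')) as [m [Hm1 Hm2]].
    exists (Rmax 1 (y0 + h)), B. split; [apply Rlt_le_trans with 1; [lra|apply Rmax_l]|].
    split; [assumption|].
    intros w Hw. pose proof (Rmax_r 1 (y0 + h)).
    specialize (H m w ltac:(lra)).
    rewrite csum_zero in H.
    2:{ intros i Hi. destruct (classic (A i = 0)) as [Z|NZ]; [rewrite Z; ring|].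
        exfalso. apply Nex. exists i. split; [|assumption]. apply Rnot_le_lt, Hm2, Hi. }
    replace (G w - 0)%C with (G w) in H by ring.
    eapply Rle_trans; [exact H|]. rewrite <- (Rmult_1_r B) at 2.
    apply Rmult_le_compat_l; [assumption|]. apply exp_le_1.
    assert (0 <= 2 * PI * (l0 + INR m / h) * (Im w - y0)); [|lra].
    apply Rmult_le_pos; [|lra]. apply Rmult_le_pos; lra.
Qed.

Lemma order_exists (G : C -> C) : finite_order_at_infty G ->
  exists nu, 0 <= nu /\ order_at G nu /\ (~ finite_at_infty G -> 0 < nu).
Proof.
  intros (h & u & a & Hexp & Hfin).
  destruct (expansion_struct G h u a Hexp Hfin) as (l0 & y0 & B & H1 & H2 & H3).
  destruct (expands_order _ _ _ _ _ _ H3) as [nu [P1 [P2 P3]]].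
  exists nu. split; [assumption|]. split; [assumption|].
  intro NF. apply P3. apply NNPP. intro N. apply NF.
  exists h, u, a. split; [assumption|]. intros lam Hl1 Hl2. apply NNPP. intro NZ.
  destruct (H2 lam Hl1 NZ) as [n Hn]. apply N. exists n. rewrite <- Hn. auto.
Qed.

Lemma order_upper (G : C -> C) (nu : R) : order_at G nu ->
  exists Y K, 0 < Y /\ 0 <= K /\ forall w, Y <= Im w -> Cmod (G w) <= K * exp (2 * PI * nu * Im w).
Proof.
  intros [[Hnu (b & Y & K & del & Hb & HY & HK & Hdel & H)]|[-> (Y & K & HY & HK & H)]].
  - exists Y, (Cmod b + K). split; [assumption|].
    pose proof (Cmod_ge_0 b). split; [lra|]. intros w Hw.
    specialize (H w Hw). pose proof (Cmod_triangle_sub (G w * ee (nu * w)) b) as Tr.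
    assert (E : exp (- (del * Im w)) <= 1) by (apply exp_le_1; nra).
    rewrite Cmod_mult, Cmod_ee in Tr.
    replace (2 * PI * Im (nu * w)%C) with (2 * PI * nu * Im w) in Tr by (reim; ring).
    rewrite exp_Ropp in Tr. pose proof (exp_pos (2 * PI * nu * Im w)) as PE.
    apply Rmult_le_reg_r with (/ exp (2 * PI * nu * Im w)); [apply Rinv_0_lt_compat; assumption|].
    rewrite mult_inv_cancel by lra.
    apply (Rmult_le_compat_l K) in E; lra.
  - exists Y, K. split; [assumption|]. split; [assumption|]. intros w Hw.
    rewrite Rmult_0_r, Rmult_0_l, exp_0, Rmult_1_r. auto.
Qed.

Lemma order_lower (G : C -> C) (nu : R) : order_at G nu -> 0 < nu ->
  exists Y c, 0 < Y /\ 0 < c /\ forall w, Y <= Im w -> c * exp (2 * PI * nu * Im w) <= Cmod (G w).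
Proof.
  intros [[Hnu (b & Y & K & del & Hb & HY & HK & Hdel & H)]|[-> _]]; [|lra]. intros _.
  assert (Pb : 0 < Cmod b) by (apply Cmod_gt_0; assumption).
  set (X := 2 * K / (del * Cmod b)).
  assert (HX : X * (del * Cmod b) = 2 * K) by (unfold X; field; split; lra).
  exists (Rmax Y X), (Cmod b / 2). split; [eapply Rlt_le_trans; [exact HY|apply Rmax_l]|].
  split; [lra|]. intros w Hw.
  pose proof (Rmax_l Y X). pose proof (Rmax_r Y X).
  specialize (H w ltac:(lra)).
  assert (E : K * exp (- (del * Im w)) <= Cmod b / 2).
  { rewrite exp_Ropp. pose proof (exp_ineq1_le (del * Im w)). pose proof (exp_pos (del * Im w)).
    apply Rmult_le_reg_r with (exp (del * Im w)); [assumption|].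
    rewrite inv_mult_cancel by lra.
    assert (X * (del * Cmod b) <= Im w * (del * Cmod b)) by (apply Rmult_le_compat_r; nra). nra. }
  pose proof (Cmod_triangle_sub b (G w * ee (nu * w))) as Tr.
  rewrite Cmod_minus_sym in Tr. rewrite Cmod_mult, Cmod_ee in Tr.
  replace (2 * PI * Im (nu * w)%C) with (2 * PI * nu * Im w) in Tr by (reim; ring).
  rewrite exp_Ropp in Tr. pose proof (exp_pos (2 * PI * nu * Im w)) as PE.
  apply Rmult_le_reg_r with (/ exp (2 * PI * nu * Im w)); [apply Rinv_0_lt_compat; assumption|].
  rewrite mult_inv_cancel by lra. lra.
Qed.

(** The order is read off from the growth along the imaginary axis, hence depends on [|G|] only. So
    it is an invariant of the coset although slashes agree only in modulus. *)
Lemma order_le (G G' : C -> C) (nu nu' : R) : 0 <= nu -> order_at G nu -> order_at G' nu' ->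
  (forall w, 0 < Im w -> Cmod (G w) = Cmod (G' w)) -> nu' <= nu.
Proof.
  intros P H H' E. apply Rnot_lt_le. intro L.
  destruct (order_upper G nu H) as (Y & K & HY & HK & HU).
  destruct (order_lower G' nu' H') as (Y' & c & HY' & Hc & HL); [lra|].
  set (q := 2 * PI * (nu' - nu)). assert (Hq : 0 < q) by (unfold q; pose proof PI_RGT_0; nra).
  (* At heights from [X] on, [c * exp (y * q)] is at least [c * X * q = K + 1], which exceeds the
     bound [K]. *)
  set (X := (K + 1) / (c * q)). assert (HX : c * (X * q) = K + 1) by (unfold X; field; lra).
  set (y := Rmax (Rmax Y Y') X).
  pose proof (Rmax_l (Rmax Y Y') X). pose proof (Rmax_r (Rmax Y Y') X).
  pose proof (Rmax_l Y Y'). pose proof (Rmax_r Y Y'). fold y in H0, H1.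
  specialize (HU (Ci * y)%C). specialize (HL (Ci * y)%C). specialize (E (Ci * y)%C).
  assert (Ei : Im (Ci * y)%C = y) by (reim; ring). rewrite Ei in *.
  specialize (HU ltac:(lra)). specialize (HL ltac:(lra)). specialize (E ltac:(lra)).
  rewrite <- E in HL.
  replace (2 * PI * nu' * y) with (2 * PI * nu * y + y * q) in HL by (unfold q; ring).
  rewrite exp_plus in HL. pose proof (exp_pos (2 * PI * nu * y)) as PE.
  assert (Q : c * exp (y * q) <= K).
  { apply Rmult_le_reg_r with (exp (2 * PI * nu * y)); [assumption|]. lra. }
  pose proof (exp_ineq1_le (y * q)).
  assert (X * q <= y * q) by (apply Rmult_le_compat_r; lra).
  assert (c * (X * q) <= c * exp (y * q)) by (apply Rmult_le_compat_l; lra). lra.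
Qed.

Lemma order_unique (G G' : C -> C) (nu nu' : R) : 0 <= nu -> 0 <= nu' ->
  order_at G nu -> order_at G' nu' ->
  (forall w, 0 < Im w -> Cmod (G w) = Cmod (G' w)) -> nu = nu'.
Proof.
  intros. apply Rle_antisym; [apply (order_le G' G)|apply (order_le G G')]; auto.
  intros; symmetry; auto.
Qed.

Lemma Ccont_mult (f g : R -> C) (x : R) : Ccont f x -> Ccont g x -> Ccont (fun t => f t * g t)%C x.
Proof.
  intros Hf Hg eps Heps.
  pose proof (Cmod_ge_0 (f x)) as Pf. pose proof (Cmod_ge_0 (g x)) as Pg.
  set (K := 2 + Cmod (f x) + Cmod (g x)).
  set (e := Rmin 1 (eps / K)). assert (He : 0 < e).
  { apply Rmin_pos; [lra|]. apply Rdiv_lt_0_compat; unfold K; lra. }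
  assert (He1 : e <= 1) by apply Rmin_l.
  assert (He2 : e * K <= eps).
  { apply Rle_trans with (eps / K * K); [apply Rmult_le_compat_r; [unfold K; lra|apply Rmin_r]|].
    right; field; unfold K; lra. }
  destruct (Hf e He) as [d1 [Hd1 H1]]. destruct (Hg e He) as [d2 [Hd2 H2]].
  exists (Rmin d1 d2). split; [apply Rmin_pos; assumption|]. intros t Ht.
  pose proof (Rmin_l d1 d2). pose proof (Rmin_r d1 d2).
  specialize (H1 t ltac:(lra)). specialize (H2 t ltac:(lra)).
  set (u := (f t - f x)%C) in *. set (v := (g t - g x)%C) in *.
  replace (f t * g t - f x * g x)%C with (u * v + u * g x + f x * v)%C by (unfold u, v; ring).
  eapply Rle_lt_trans; [apply Cmod_triangle|].
  pose proof (Cmod_triangle (u * v) (u * g x)). rewrite !Cmod_mult in *.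
  pose proof (Cmod_ge_0 u). pose proof (Cmod_ge_0 v).
  assert (Cmod u * Cmod v <= e * 1) by (apply Rmult_le_compat; lra).
  assert (Cmod u * Cmod (g x) <= e * Cmod (g x)) by (apply Rmult_le_compat_r; lra).
  assert (Cmod (f x) * Cmod v <= Cmod (f x) * e) by (apply Rmult_le_compat_l; lra).
  unfold K in He2. nra.
Qed.

Lemma Ccont_ee (l : C) (x y : R) : Ccont (fun t => ee (l * (t, y))) x.
Proof.
  intros eps Heps. destruct (Cderiv_ee l (x, y)) as [d Hd].
  destruct (Cderiv_continuous _ _ _ Hd eps Heps) as [de [Hde0 Hde]].
  exists de. split; [assumption|]. intros t Ht.
  specialize (Hde (RtoC (t - x))). rewrite Cmod_R in Hde. specialize (Hde Ht).
  replace ((x, y) + RtoC (t - x))%C with ((t, y) : C) in Hde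
    by (apply C_ext; reim; ring). exact Hde.
Qed.

(** Translation by half a wavelength, [h / (2 n)], changes the sign of the integrand but, by
    periodicity, not the integral. *)
Lemma int_ee_period (h y : R) (n : Z) : 0 < h -> n <> 0%Z ->
  is_CInt (fun x => ee (RtoC (IZR n / h) * (x, y))) 0 h 0.
Proof.
  intros Hh Hn. set (f := fun x => ee (RtoC (IZR n / h) * (x, y))).
  assert (Hc : forall x, Ccont f x) by (intro; apply Ccont_ee).
  assert (Hs : forall x v, f (x + v) = (ee (RtoC (IZR n / h * v)) * f x)%C).
  { intros x v. unfold f. rewrite <- ee_plus. f_equal.
    apply C_ext; reim; ring. }
  assert (Hn' : IZR n <> 0) by (apply not_0_IZR; assumption).
  destruct (ex_CInt_continuous f 0 h) as [l Hl]; [lra|auto|].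
  assert (Hp : forall x, f (x + h) = f x).
  { intro x. rewrite Hs. replace (IZR n / h * h) with (IZR n) by (field; lra). rewrite ee_IZR. ring. }
  set (v := h / (2 * IZR n)).
  assert (H1 : is_CInt f v (v + h) l) by (apply is_CInt_periodic; assumption).
  replace v with (0 + v) in H1 at 1 by ring. rewrite (Rplus_comm v h) in H1.
  apply (proj1 (is_CInt_shift f v 0 h l)) in H1.
  assert (H2 : is_CInt (fun x => f (x + v)) 0 h (ee (RtoC (IZR n / h * v)) * l)%C).
  { eapply is_CInt_ext; [lra| |apply is_CInt_scal, Hl]. intros x _. cbv beta. rewrite Hs. reflexivity. }
  pose proof (is_CInt_unique _ _ _ _ _ H1 H2) as E.
  assert (E1 : ee (RtoC (IZR n / h * v)) = (- (1))%C).
  { rewrite ee_R. unfold v. replace (2 * PI * (IZR n / h * (h / (2 * IZR n)))) with PI by (field; lra).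
    rewrite cos_PI, sin_PI. apply C_ext; reim; ring. }
  rewrite E1 in E.
  replace (RtoC 0) with l; [exact Hl|].
  apply C_ext.
  - apply (f_equal Re) in E. autorewrite with reim in *. lra.
  - apply (f_equal Im) in E. autorewrite with reim in *. lra.
Qed.

Lemma int_const_exponent (h : R) (c : C) : is_CInt (fun _ => c) 0 h (h * c)%C.
Proof. replace (h * c)%C with ((h - 0) * c)%C by ring. apply is_CInt_const. Qed.

(** All partial sums beyond index [n] have the integral [h * A n] exactly, and the remainder tends
    to 0 uniformly on the segment. *)
Lemma fourier_coeff (G : C -> C) (h l0 y0 B y : R) (A : nat -> C) (n : nat) :
  expands G h l0 y0 B A -> y0 + h <= y -> (forall x, Ccont (fun t => G (t, y)) x) ->
  is_CInt (fun x => G (x, y) * ee (- RtoC (l0 + INR n / h) * (x, y)))%C 0 h (h * A n)%C.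
Proof.
  intros [Hh [HB H]] Hy Hc.
  set (L := fun i => l0 + INR i / h).
  set (S := fun m (x : R) => csum (fun i => A i * ee (RtoC (L i) * (x, y)))%C m).
  assert (HS : forall m, (n < m)%nat ->
     is_CInt (fun x => S m x * ee (- RtoC (L n) * (x, y)))%C 0 h (h * A n)%C).
  { assert (Hterm : forall i, is_CInt (fun x => A i * ee (RtoC (L i) * (x, y)) * ee (- RtoC (L n) * (x, y)))%C
       0 h (if Nat.eq_dec i n then h * A n else 0)%C).
    { intro i. destruct (Nat.eq_dec i n) as [->|N].
      - eapply is_CInt_ext; [lra| |apply int_const_exponent]. intros x _. cbv beta.
        replace (- RtoC (L n) * (x, y))%C with (- (RtoC (L n) * (x, y)))%C by ring.
        rewrite ee_opp. field. apply ee_neq_0.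
      - replace (RtoC 0) with (A i * 0)%C by ring.
        eapply is_CInt_ext; [lra| |apply is_CInt_scal, (int_ee_period h y (Z.of_nat i - Z.of_nat n)); [assumption|lia]].
        intros x _. cbv beta. rewrite <- Cmult_assoc, <- ee_plus. do 2 f_equal.
        rewrite minus_IZR, <- !INR_IZR_INZ. unfold L.
        replace ((INR i - INR n) / h) with ((l0 + INR i / h) - (l0 + INR n / h)) by (field; lra).
        rewrite RtoC_minus. ring. }
    assert (Hpart : forall m, is_CInt (fun x => S m x * ee (- RtoC (L n) * (x, y)))%C 0 h
       (if lt_dec n m then h * A n else 0)%C).
    { induction m as [|m IH].
      - destruct (lt_dec n 0); [lia|]. replace (RtoC 0) with (h * 0)%C by ring.
        eapply is_CInt_ext; [lra| |apply int_const_exponent]. intros x _. unfold S; simpl. ring.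
      - replace (if lt_dec n (Datatypes.S m) then (h * A n)%C else 0) with
          ((if lt_dec n m then h * A n else 0) + (if Nat.eq_dec m n then h * A n else 0))%C.
        + eapply is_CInt_ext; [lra| |apply is_CInt_plus; [apply IH|apply Hterm]].
          intros x _. unfold S; simpl. ring.
        + destruct (lt_dec n m), (Nat.eq_dec m n), (lt_dec n (Datatypes.S m)); try lia; ring. }
    intros m Hm. specialize (Hpart m). destruct (lt_dec n m); [exact Hpart|lia]. }
  destruct (ex_CInt_continuous (fun x => G (x, y) * ee (- RtoC (L n) * (x, y)))%C 0 h) as [v Hv].
  { lra. } { intros x _. apply Ccont_mult; [apply Hc|apply Ccont_ee]. }
  replace (h * A n)%C with v; [exact Hv|].
  pose proof PI_RGT_0 as HPI.
  set (E := exp (2 * PI * L n * y)).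
  assert (PE : 0 < E) by apply exp_pos.
  assert (Hd : forall m, (n < m)%nat -> Cmod (v - h * A n)%C <= h * (B * exp (- (2 * PI * L m * (y - y0))) * E)).
  { intros m Hm. replace h with (h - 0) at 2 by ring.
    apply (is_CInt_norm (fun x => G (x, y) * ee (- RtoC (L n) * (x, y)) - S m x * ee (- RtoC (L n) * (x, y)))%C 0 h).
    - lra.
    - intros x _. replace (G (x, y) * ee (- RtoC (L n) * (x, y)) - S m x * ee (- RtoC (L n) * (x, y)))%C
        with ((G (x, y) - S m x) * ee (- RtoC (L n) * (x, y)))%C by ring.
      rewrite Cmod_mult, Cmod_ee.
      replace (- (2 * PI * Im (- RtoC (L n) * (x, y))%C)) with (2 * PI * L n * y)
        by (reim; ring).
      apply Rmult_le_compat_r; [left; apply exp_pos|]. apply (H m (x, y)). exact Hy.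
    - apply is_CInt_minus; [exact Hv|apply HS, Hm]. }
  assert (Z : Cmod (v - h * A n)%C = 0).
  { apply Rle_antisym; [|apply Cmod_ge_0]. apply le_epsilon. intros eps Heps. rewrite Rplus_0_l.
    set (Y := y - y0). assert (HY : h <= Y) by (unfold Y; lra).
    destruct (nat_above (h * B * E / eps - 2 * PI * l0 * Y)) as [m0 Hm0].
    set (m := Nat.max m0 (Datatypes.S n)).
    eapply Rle_trans; [apply (Hd m); unfold m; lia|]. fold Y. rewrite exp_Ropp.
    assert (Q : h * B * E / eps <= exp (2 * PI * L m * Y)).
    { eapply Rle_trans; [|apply exp_ineq1_le].
      assert (INR m0 <= INR m) by (apply le_INR; unfold m; lia).
      assert (INR m <= 2 * PI * (INR m / h) * Y).
      { pose proof (pos_INR m). pose proof PI2_1.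
        replace (2 * PI * (INR m / h) * Y) with (INR m * (2 * PI * (Y / h))) by (field; lra).
        assert (1 <= Y / h) by (apply Rmult_le_reg_r with h; [assumption|]; unfold Rdiv; rewrite Rmult_assoc, Rinv_l; lra).
        assert (1 <= 2 * PI * (Y / h)) by nra. nra. }
      unfold L. nra. }
    pose proof (exp_pos (2 * PI * L m * Y)) as PX.
    apply Rmult_le_reg_r with (exp (2 * PI * L m * Y)); [assumption|].
    replace (h * (B * / exp (2 * PI * L m * Y) * E) * exp (2 * PI * L m * Y)) with (h * B * E) by (field; lra).
    apply (Rmult_le_compat_l eps) in Q; [|lra].
    replace (eps * (h * B * E / eps)) with (h * B * E) in Q by (field; lra). exact Q. }
  apply Cmod_eq_0 in Z. replace v with ((v - h * A n) + h * A n)%C by ring. rewrite Z. ring.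
Qed.

Lemma holomorphic_Cdiff (f : C -> C) : holomorphic_on (half_plane 0) f -> Cdiff_on_H f.
Proof. intros H z Hz. apply (holomorphic_Cderiv _ _ _ H Hz). Qed.

(** Translating the coefficient integral by [N] leaves it unchanged, since the integrand has period
    [h], but also multiplies it by [u / ee (lam * N)]. A non-zero coefficient therefore forces
    [ee (lam * N) = u]. *)
Lemma period_exponent (f : C -> C) (h N r l0 y0 B : R) (u' u : C) (A : nat -> C) (n : nat) :
  Cdiff_on_H f -> (forall z, 0 < Im z -> f (z + N)%C = (u * f z)%C) ->
  (forall z, r < Im z -> f (z + h)%C = (u' * f z)%C) ->
  exponents h u' (l0 + INR n / h) ->
  expands f h l0 y0 B A -> A n <> 0 -> exponents N u (l0 + INR n / h).
Proof.
  intros Hf HN Hh Hexp HE HA. set (lam := l0 + INR n / h) in *.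
  assert (Ph : 0 < h) by apply HE.
  set (y := Rmax (y0 + h) (Rmax 1 (r + 1))).
  pose proof (Rmax_l (y0 + h) (Rmax 1 (r + 1))) as Y1.
  pose proof (Rmax_r (y0 + h) (Rmax 1 (r + 1))) as Y2.
  pose proof (Rmax_l 1 (r + 1)). pose proof (Rmax_r 1 (r + 1)). fold y in Y1, Y2.
  assert (Hy : 0 < y) by lra.
  assert (Hc : forall x, Ccont (fun t => f (t, y)) x) by (intro; apply Cdiff_Ccont_h; assumption).
  pose proof (fourier_coeff f h l0 y0 B y A n HE Y1 Hc) as Hv. fold lam in Hv.
  set (F := fun x => (f (x, y) * ee (- RtoC lam * (x, y)))%C) in Hv.
  assert (HcF : forall x, Ccont F x) by (intro; apply Ccont_mult; [apply Hc|apply Ccont_ee]).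
  apply exponents_ee in Hexp.
  assert (Hsh : forall x v, ee (- RtoC lam * (x + v, y)) = (ee (- RtoC lam * (x, y)) / ee (RtoC (lam * v)))%C).
  { intros x v. unfold Cdiv. rewrite <- ee_opp, <- ee_plus. f_equal.
    apply C_ext; reim; ring. }
  assert (Hpair : forall x v, ((x + v, y) : C) = ((x, y) + RtoC v)%C)
    by (intros; apply C_ext; reim; ring).
  assert (Hper : forall x, F (x + h) = F x).
  { intro x. unfold F. rewrite Hsh, Hexp, Hpair, Hh by (simpl; lra).
    assert (u' <> 0) by (rewrite <- Hexp; apply ee_neq_0). field; assumption. }
  apply exponents_ee.
  assert (HshN : forall x, F (x + N) = (u / ee (RtoC (lam * N)) * F x)%C).
  { intro x. unfold F. rewrite Hsh, Hpair, HN by (simpl; lra). field. apply ee_neq_0. }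
  pose proof (is_CInt_periodic F h N _ Ph HcF Hper Hv) as H1.
  replace N with (0 + N) in H1 at 1 by ring. rewrite (Rplus_comm N h) in H1.
  apply (proj1 (is_CInt_shift F N 0 h _)) in H1.
  assert (H2 : is_CInt (fun x => F (x + N)) 0 h (u / ee (RtoC (lam * N)) * (h * A n))%C).
  { eapply is_CInt_ext; [lra| |apply is_CInt_scal, Hv]. intros x _. cbv beta. rewrite HshN. reflexivity. }
  pose proof (is_CInt_unique _ _ _ _ _ H1 H2) as E.
  pose proof (ee_neq_0 (RtoC (lam * N))) as NZ.
  assert (Hh0 : RtoC h <> 0) by (intro Q; injection Q; lra).
  assert (E2 : (h * A n)%C <> 0) by (apply Cmult_neq_0; assumption).
  set (X := (h * A n)%C) in *. set (q := ee (RtoC (lam * N))) in *.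
  assert (E3 : (X * q)%C = (X * u)%C) by (rewrite E at 1; field; exact NZ).
  transitivity (X * q / X)%C. { field; exact E2. } rewrite E3. field. exact E2.
Qed.

Lemma lsum_filter (F G : R -> C) (P : R -> bool) (l : list R) :
  (forall x, In x l -> P x = true -> F x = G x) -> (forall x, In x l -> P x = false -> G x = 0) ->
  lsum (map F (filter P l)) = lsum (map G l).
Proof.
  intros H1 H2. induction l as [|x l IH]; [reflexivity|]. simpl.
  assert (IH' : lsum (map F (filter P l)) = lsum (map G l)).
  { apply IH; intros; [apply H1|apply H2]; auto; right; assumption. }
  destruct (P x) eqn:E.
  - unfold lsum in *; simpl. rewrite IH', H1 by (auto; left; reflexivity). reflexivity.
  - unfold lsum in *; simpl. rewrite IH', (H2 x) by (auto; left; reflexivity). ring.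
Qed.

Definition pdec (P : Prop) : {P} + {~ P} := excluded_middle_informative P.
Definition pbool (P : Prop) : bool := if pdec P then true else false.

Lemma pbool_true (P : Prop) : pbool P = true <-> P.
Proof. unfold pbool; destruct (pdec P); split; intros; auto; discriminate. Qed.

Lemma pbool_false (P : Prop) : pbool P = false <-> ~ P.
Proof. unfold pbool; destruct (pdec P); split; intros; auto; try discriminate; tauto. Qed.

(** The hypotheses say that [F] on [D] and [F'] on [D'] coincide once extended by zero. *)
Lemma is_sum_over_change (D D' : R -> Prop) (F F' : R -> C) (s : C) :
  is_sum_over D F s ->
  (forall x, D x -> D' x -> F' x = F x) ->
  (forall x, D x -> ~ D' x -> F x = 0) ->
  (forall x, D' x -> ~ D x -> F' x = 0) ->
  is_sum_over D' F' s.
Proof.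
  intros H E1 E2 E3 eps Heps. destruct (H eps Heps) as [l0 [Hl0 H0]].
  rewrite Forall_forall in Hl0.
  exists (filter (fun x => pbool (D' x)) l0). split.
  { apply Forall_forall. intros x Hx. apply filter_In in Hx. apply pbool_true, Hx. }
  intros l Hnd Hl Hincl. rewrite Forall_forall in Hl.
  (* A finite subset [l] of [D'] is traded for its part in [D], completed by the elements of [l0]
     outside [D'] so as to contain [l0]; only vanishing terms are lost or gained. *)
  set (k1 := filter (fun x => pbool (D x)) l).
  set (k2 := filter (fun x => pbool (~ D' x)) (nodup Req_EM_T l0)).
  assert (K1 : forall x, In x k1 -> In x l /\ D x).
  { intros x Hx. apply filter_In in Hx. rewrite pbool_true in Hx. exact Hx. }
  assert (K2 : forall x, In x k2 -> In x l0 /\ ~ D' x).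
  { intros x Hx. apply filter_In in Hx. rewrite pbool_true, nodup_In in Hx. exact Hx. }
  specialize (H0 (k1 ++ k2)).
  assert (N1 : NoDup (k1 ++ k2)).
  { apply NoDup_app; [apply NoDup_filter; assumption|apply NoDup_filter, NoDup_nodup|].
    intros x Hx Hx'. apply K1 in Hx. apply K2 in Hx'. apply Hx', Hl, Hx. }
  assert (N2 : List.Forall D (k1 ++ k2)).
  { apply Forall_forall. intros x Hx. apply in_app_or in Hx. destruct Hx as [Hx|Hx].
    - apply K1, Hx.
    - apply Hl0, K2, Hx. }
  assert (N3 : incl l0 (k1 ++ k2)).
  { intros x Hx. apply in_or_app. destruct (classic (D' x)) as [P|P].
    - left. apply filter_In. rewrite pbool_true. split; [|auto].
      apply Hincl, filter_In. rewrite pbool_true. auto.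
    - right. apply filter_In. rewrite pbool_true, nodup_In. auto. }
  specialize (H0 N1 N2 N3). rewrite map_app in H0.
  change (fold_right Cplus (RtoC 0)) with lsum in *.
  rewrite lsum_app in H0. rewrite (lsum_zero (map F k2)) in H0.
  2:{ intros z Hz. apply in_map_iff in Hz. destruct Hz as [x [<- Hx]]. apply K2 in Hx.
      apply E2; [apply Hl0|]; apply Hx. }
  unfold k1 in H0. rewrite (lsum_filter F F') in H0.
  - replace (lsum (map F' l) + 0 - s)%C with (lsum (map F' l) - s)%C in H0 by ring. exact H0.
  - intros x Hx P. symmetry. apply E1; [apply pbool_true, P|apply Hl, Hx].
  - intros x Hx P. apply E3; [apply Hl, Hx|apply pbool_false, P].
Qed.

(** The expansion given by [finite_order_at_infty] may use a period [h] unrelated to [N]; by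
    uniqueness of Fourier coefficients, only exponents of the period [N] occur in it. *)
Lemma change_period (f : C -> C) (N : R) (u : C) :
  holomorphic_on (half_plane 0) f -> 0 < N -> Cmod u = 1 ->
  (forall z, 0 < Im z -> f (z + N)%C = (u * f z)%C) ->
  finite_order_at_infty f ->
  exists a, is_expansion f N u a /\ finite_order_coeffs N u a.
Proof.
  intros Hf HN Hu Hper (h & u' & a' & Hexp & Hfin).
  destruct (expansion_struct f h u' a' Hexp Hfin) as (l0 & y0 & B & H1 & H2 & H3).
  destruct Hexp as [r [[_ [Hh [Hu' Hper']]] Hsum]].
  assert (Key : forall lam, exponents h u' lam -> a' lam <> 0 -> exponents N u lam).
  { intros lam E1 E2. destruct (H2 lam E1 E2) as [n ->].
    apply (period_exponent f h N r l0 y0 B u' u (fun n => a' (l0 + INR n / h)) n); auto.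
    apply holomorphic_Cdiff, Hf. }
  (* The values of [a'] off the exponents of period [h] are arbitrary, hence the default value 0. *)
  exists (fun lam => if pdec (exponents h u' lam) then a' lam else 0). split.
  - exists (Rmax 0 r). split.
    + split; [|split; [assumption|split; [assumption|]]].
      * intros z Hz. apply Hf. unfold half_plane in *. pose proof (Rmax_l 0 r). lra.
      * intros z Hz. apply Hper. unfold half_plane in *. pose proof (Rmax_l 0 r). lra.
    + intros z Hz.
      assert (Hz' : half_plane r z) by (unfold half_plane in *; pose proof (Rmax_r 0 r); lra).
      apply (is_sum_over_change _ _ _ _ _ (Hsum z Hz')).
      * intros lam E1 E2. destruct (pdec (exponents h u' lam)); [reflexivity|contradiction].
      * intros lam E1 E2. destruct (classic (a' lam = 0)) as [Z|NZ]; [rewrite Z; ring|].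
        exfalso; apply E2, Key; assumption.
      * intros lam E1 E2. destruct (pdec (exponents h u' lam)); [contradiction|ring].
  - destruct Hfin as [l Hl]. exists l. intros lam E1 E2 E3.
    destruct (pdec (exponents h u' lam)); [apply Hl; assumption|]. exfalso; apply E3; reflexivity.
Qed.

(** [fourier_coeff] applies high up only. Holomorphy in the whole half plane moves the segment down
    to any height, as required for the saddle point, which tends to the real axis as the exponent
    grows. *)
Lemma fourier_coeff_H (f : C -> C) (N l0 y0 B : R) (u : C) (A : nat -> C) (n : nat) (y v : R) :
  Cdiff_on_H f -> (forall z, 0 < Im z -> f (z + N)%C = (u * f z)%C) ->
  exponents N u (l0 + INR n / N) -> expands f N l0 y0 B A -> 0 < y ->
  is_CInt (fun x => f (x, y) * ee (- RtoC (l0 + INR n / N) * (x, y)))%C v (v + N) (N * A n)%C.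
Proof.
  intros Hf Hper Hexp HE Hy. assert (HN : 0 < N) by apply HE.
  set (lam := l0 + INR n / N) in *.
  set (F := fun z => (f z * ee (- RtoC lam * z))%C).
  assert (HF : Cdiff_on_H F).
  { intros z Hz. destruct (Hf z Hz) as [d1 D1]. destruct (Cderiv_ee (- RtoC lam)%C z) as [d2 D2].
    eexists. apply (Cderiv_mult _ _ _ _ _ D1 D2). }
  apply exponents_ee in Hexp.
  assert (HFp : forall z, 0 < Im z -> F (z + N)%C = F z).
  { intros z Hz. unfold F. rewrite Hper by assumption.
    replace (- RtoC lam * (z + N))%C with (- RtoC lam * z + - RtoC (lam * N))%C by (rewrite RtoC_mult; ring).
    rewrite ee_plus, ee_opp, Hexp. assert (u <> 0) by (rewrite <- Hexp; apply ee_neq_0).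
    field; assumption. }
  set (y1 := Rmax 1 (y0 + N)).
  pose proof (Rmax_l 1 (y0 + N)). pose proof (Rmax_r 1 (y0 + N)). fold y1 in H, H0.
  assert (H1 : is_CInt (fun x => F (x, y1)) 0 N (N * A n)%C).
  { apply (fourier_coeff f N l0 y0 B y1 A n); auto. intro; apply Cdiff_Ccont_h; auto; lra. }
  apply (periodic_int_indep F N y1 y) in H1; auto; [|lra].
  apply (is_CInt_periodic (fun x => F (x, y))); auto.
  - intro x. apply Cdiff_Ccont_h; auto.
  - intro x. rewrite <- (HFp (x, y)) by exact Hy. f_equal. apply C_ext; reim; ring.
Qed.

(** * Reduction theory: moving a point to height at least 1/2 *)

Lemma list_argmin {A : Type} (v : A -> R) (P : A -> Prop) (l : list A) :
  (exists x, In x l /\ P x) ->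
  exists x, In x l /\ P x /\ forall y, In y l -> P y -> v x <= v y.
Proof.
  induction l as [|a l IH]; intros [x [Hx Px]]; [destruct Hx|].
  destruct (classic (exists x, In x l /\ P x)) as [E|N].
  - destruct (IH E) as [m [Hm1 [Hm2 Hm3]]].
    destruct (classic (P a /\ v a <= v m)) as [[Pa La]|Na].
    + exists a. split; [left; reflexivity|]. split; [assumption|].
      intros y [<-|Hy] Py; [lra|]. specialize (Hm3 y Hy Py). lra.
    + exists m. split; [right; assumption|]. split; [assumption|].
      intros y [<-|Hy] Py; [|auto]. apply Rnot_lt_le. intro L. apply Na. split; [assumption|lra].
  - assert (x = a) by (destruct Hx as [->|Hx]; [reflexivity|exfalso; apply N; eauto]). subst x.
    exists a. split; [left; reflexivity|]. split; [assumption|].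
    intros y [<-|Hy] Py; [lra|]. exfalso; apply N; eauto.
Qed.

Definition zlist (K : nat) : list Z := map (fun n => (Z.of_nat n - Z.of_nat K)%Z) (seq 0 (2 * K + 1)).

Lemma in_zlist (K : nat) (n : Z) : (Z.abs n <= Z.of_nat K)%Z -> In n (zlist K).
Proof.
  intro H. apply in_map_iff. exists (Z.to_nat (n + Z.of_nat K)). split; [lia|].
  apply in_seq. lia.
Qed.

Lemma floor_exists (x : R) : exists m : Z, IZR m <= x < IZR m + 1.
Proof.
  exists (up x - 1)%Z. destruct (archimed x). rewrite minus_IZR. lra.
Qed.

Lemma abs_IZR_le (n : Z) (K : nat) : Rabs (IZR n) <= INR K -> (Z.abs n <= Z.of_nat K)%Z.
Proof. intro H. apply le_IZR. rewrite abs_IZR, <- INR_IZR_INZ. exact H. Qed.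

(** The pairs with [|c z + d| <= 1] lie in a finite box, which contains the row [(0, 1)] of the
    identity; the minimum is taken over the rows in that box. *)
Lemma denom_min (z : C) : 0 < Im z ->
  exists g, forall g', Cmod (denom g z) <= Cmod (denom g' z).
Proof.
  intro Hz.
  destruct (nat_above (Rmax (/ Im z) (1 + Rabs (Re z) / Im z))) as [K HK].
  pose proof (Rmax_l (/ Im z) (1 + Rabs (Re z) / Im z)).
  pose proof (Rmax_r (/ Im z) (1 + Rabs (Re z) / Im z)).
  set (v := fun p : Z * Z => Cmod (IZR (fst p) * z + IZR (snd p))%C).
  set (P := fun p : Z * Z => exists g, mc g = fst p /\ md g = snd p).
  assert (Hbox : forall p, v p <= 1 -> In p (list_prod (zlist K) (zlist K))).
  { intros [c d] Hp. unfold v in Hp; simpl in Hp.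
    pose proof (re_le_Cmod (IZR c * z + IZR d)%C) as HR.
    pose proof (Im_le_Cmod (IZR c * z + IZR d)%C) as HI.
    autorewrite with reim in HR, HI.
    assert (HI' : Rabs (IZR c) * Im z <= 1).
    { rewrite <- (Rabs_right (Im z)) by lra. rewrite <- Rabs_mult.
      replace (IZR c * Im z) with (IZR c * Im z + 0 * Re z + 0) by ring. lra. }
    assert (Hc : Rabs (IZR c) <= / Im z).
    { apply Rmult_le_reg_r with (Im z); [assumption|]. rewrite Rinv_l; lra. }
    assert (Hd : Rabs (IZR d) <= 1 + Rabs (Re z) / Im z).
    { replace (IZR d) with ((IZR c * Re z - 0 * Im z + IZR d) + - (IZR c * Re z)) by ring.
      eapply Rle_trans; [apply Rabs_triang|]. rewrite Rabs_Ropp, Rabs_mult.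
      pose proof (Rabs_pos (Re z)).
      assert (Rabs (IZR c) * Rabs (Re z) <= / Im z * Rabs (Re z)) by (apply Rmult_le_compat_r; assumption).
      unfold Rdiv. lra. }
    apply in_prod; apply in_zlist, abs_IZR_le; lra. }
  assert (V1 : v (0, 1)%Z = 1).
  { unfold v; simpl. replace (0 * z + 1)%C with (RtoC 1) by ring. apply Cmod_1. }
  destruct (list_argmin v P (list_prod (zlist K) (zlist K))) as [p [Hp [[g [G1 G2]] Hmin]]].
  { exists (0, 1)%Z. split; [apply Hbox; lra|]. exists SL2Z_one; split; reflexivity. }
  exists g. intro g'.
  assert (Eg : Cmod (denom g z) = v p) by (unfold v, denom; rewrite G1, G2; reflexivity).
  rewrite Eg. change (Cmod (denom g' z)) with (v (mc g', md g')).
  assert (v p <= 1).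
  { rewrite <- V1. apply Hmin; [apply Hbox; lra|]. exists SL2Z_one; split; reflexivity. }
  destruct (Rle_dec (v (mc g', md g')) 1) as [L|L]; [|lra].
  apply Hmin; [apply Hbox, L|]. exists g'. split; reflexivity.
Qed.

Lemma SL2Z_opp_det (g : SL2Z) : (- ma g * - md g - - mb g * - mc g = 1)%Z.
Proof. rewrite <- (SL2Z_det g). ring. Qed.

Definition SL2Z_opp (g : SL2Z) : SL2Z := mkSL2Z (- ma g) (- mb g) (- mc g) (- md g) (SL2Z_opp_det g).

Definition SL2Z_S : SL2Z := mkSL2Z 0 (-1) 1 0 eq_refl.

Lemma Im_moebius_opp (g : SL2Z) (z : C) : 0 < Im z -> Im (moebius (SL2Z_opp g) z) = Im (moebius g z).
Proof.
  intro Hz. rewrite !Im_moebius by assumption.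
  replace (denom (SL2Z_opp g) z) with (- denom g z)%C; [rewrite Cmod_opp; reflexivity|].
  unfold denom, SL2Z_opp; simpl. rewrite !opp_IZR, !RtoC_opp. ring.
Qed.

(** The least denominator gives the highest image. A translation brings its real part into
    [[-1/2, 1/2]], and comparison with [SL2Z_S] shows that its modulus is at least 1, so its height
    exceeds 1/2. As [z] lies lower than that, [c = 0] is impossible, and [- g] adjusts the sign of
    [c]. *)
Lemma reduction (z : C) : 0 < Im z < 1 / 2 ->
  exists g, (0 < mc g)%Z /\ 1 / 2 <= Im (moebius g z).
Proof.
  intros [Hz Hz2]. destruct (denom_min z Hz) as [g0 Hg0].
  set (w := moebius g0 z).
  destruct (floor_exists (Re w + 1 / 2)) as [m Hm].
  set (g1 := SL2Z_mul (SL2Z_T (- m)%Z) g0).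
  set (w1 := moebius g1 z).
  assert (E1 : w1 = (w + IZR (- m))%C) by (unfold w1, g1; rewrite moebius_mul, moebius_T by assumption; reflexivity).
  assert (D1 : denom g1 z = denom g0 z).
  { unfold g1. rewrite denom_mul, denom_T by assumption. ring. }
  assert (R1 : - (1/2) <= Re w1 <= 1/2) by (rewrite E1; reim; rewrite opp_IZR; lra).
  assert (I1 : 0 < Im w1) by (apply Im_moebius_pos; assumption).
  assert (M1 : 1 <= Cmod w1).
  { pose proof (Hg0 (SL2Z_mul SL2Z_S g1)) as Q. rewrite denom_mul in Q by assumption. fold w1 in Q.
    rewrite D1 in Q. replace (denom SL2Z_S w1) with w1 in Q by (unfold denom, SL2Z_S; simpl; ring).
    rewrite Cmod_mult in Q. pose proof (Cmod_denom_pos g0 z Hz).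
    apply Rmult_le_reg_r with (Cmod (denom g0 z)); lra. }
  assert (I2 : 1 / 2 <= Im w1).
  { pose proof (Cmod_sqr w1). revert M1 I1 H. generalize (Cmod w1) (Im w1). intros x y Hx Hy E. apply Rnot_lt_le. intro L.
    assert (1 * 1 <= x * x) by (apply Rmult_le_compat; lra).
    assert (0 <= (1 / 2 - Re w1) * (1 / 2 + Re w1)) by (apply Rmult_le_pos; lra).
    assert (y * y <= (1 / 2) * (1 / 2)) by (apply Rmult_le_compat; lra). lra. }
  destruct (Z.lt_trichotomy (mc g1) 0) as [L|[L|L]].
  - exists (SL2Z_opp g1). split; [change (0 < - mc g1)%Z; lia|]. rewrite Im_moebius_opp by assumption. exact I2.
  (* With [c = 0] the determinant forces [d = 1] or [d = -1], so the height of [z] would be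
     unchanged. *)
  - exfalso. unfold w1 in I2. rewrite Im_moebius in I2 by assumption.
    assert (Cd : Cmod (denom g1 z) * Cmod (denom g1 z) = 1).
    { rewrite Cmod_sqr. unfold denom. rewrite L. reim.
      pose proof (IZR_det g1) as Q. rewrite L in Q.
      pose proof (SL2Z_det g1) as Q2. rewrite L in Q2.
      assert (Q3 : (md g1 * md g1 = 1)%Z).
      { assert (Q4 : (md g1 * ma g1 = 1)%Z) by lia.
        destruct (Z.eq_mul_1 _ _ Q4) as [->| ->]; reflexivity. }
      assert (Q4 : IZR (md g1) * IZR (md g1) = 1) by (rewrite <- mult_IZR, Q3; reflexivity). nra. }
    rewrite Cd in I2. lra.
  - exists g1. split; assumption.
Qed.

(** * Bounds at the cusps *)

Definition modular_setup (k : R) (G : SL2Z -> Prop) (f : C -> C) (j : SL2Z -> C -> C) : Prop :=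
  is_subgroup G /\ finite_index G /\ automorphic k G f j /\ holomorphic_on (half_plane 0) f /\
  0 <= k /\ forall g, finite_order_at_infty (slash k f g).

Lemma moebius_sub (g : SL2Z) (z w : C) : 0 < Im z -> 0 < Im w ->
  (moebius g w - moebius g z)%C = ((w - z) / (denom g w * denom g z))%C.
Proof.
  intros Hz Hw. pose proof (denom_neq_0 g z Hz). pose proof (denom_neq_0 g w Hw).
  unfold moebius.
  transitivity (((IZR (ma g) * w + IZR (mb g)) * denom g z - (IZR (ma g) * z + IZR (mb g)) * denom g w)
     / (denom g w * denom g z))%C; [field; split; assumption|].
  f_equal. unfold denom.
  transitivity ((IZR (ma g) * IZR (md g) - IZR (mb g) * IZR (mc g)) * (w - z))%C; [ring|].
  rewrite <- !RtoC_mult, <- RtoC_minus, IZR_det. ring.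
Qed.

Lemma Rpower_anti (x y k : R) : 0 <= k -> 0 < x -> x <= y -> Rpower y (- k) <= Rpower x (- k).
Proof.
  intros Hk Hx [Hxy| ->]; [|lra].
  unfold Rpower. apply exp_le. pose proof (ln_increasing x y Hx Hxy). nra.
Qed.

(** Working with the modulus avoids all discussion of the branch of the power. *)
Lemma slash_locally_bounded (k : R) (f : C -> C) (g : SL2Z) (z : C) :
  0 <= k -> holomorphic_on (half_plane 0) f -> 0 < Im z ->
  exists del K, 0 < del /\ forall w, Cmod (w - z)%C < del -> 0 < Im w /\ Cmod (slash k f g w) <= K.
Proof.
  intros Hk Hf Hz. pose proof (Cmod_denom_pos g z Hz) as PD.
  set (D := Cmod (denom g z)) in *.
  destruct (holomorphic_Cderiv _ _ _ Hf (Im_moebius_pos g z Hz)) as [l Hl].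
  destruct (Cderiv_continuous _ _ _ Hl 1 Rlt_0_1) as [d [Hd0 Hd]].
  set (c := Rabs (IZR (mc g))). assert (Hc : 0 <= c) by apply Rabs_pos.
  (* The three bounds keep [w] in the half plane, keep its denominator at least [D / 2], and keep
     the images under [g] closer than [d]. *)
  set (del := Rmin (Im z) (Rmin (D / (2 * (1 + c))) (d * (D * D / 2)))).
  assert (B1 : del <= Im z) by apply Rmin_l.
  assert (B2 : del <= D / (2 * (1 + c))) by (eapply Rle_trans; [apply Rmin_r|apply Rmin_l]).
  assert (B3 : del <= d * (D * D / 2)) by (eapply Rle_trans; [apply Rmin_r|apply Rmin_r]).
  exists del, (Rpower (D / 2) (- k) * (Cmod (f (moebius g z)) + 1)).
  split.
  { repeat apply Rmin_pos; [assumption| |]; [apply Rdiv_lt_0_compat; lra|].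
    apply Rmult_lt_0_compat; [assumption|]. nra. }
  intros w Hw. pose proof (Cmod_ge_0 (w - z)).
  assert (Iw : 0 < Im w).
  { pose proof (Im_le_Cmod (w - z)) as Q. apply Rabs_le_between in Q. autorewrite with reim in Q. lra. }
  split; [assumption|].
  assert (Dw : D / 2 <= Cmod (denom g w)).
  { pose proof (Cmod_triangle_sub (denom g z) (denom g w)) as Tr. fold D in Tr.
    replace (denom g z - denom g w)%C with (- (IZR (mc g) * (w - z)))%C in Tr by (unfold denom; ring).
    rewrite Cmod_opp, Cmod_RtoC_mult in Tr. fold c in Tr.
    assert (c * Cmod (w - z)%C <= D / 2).
    { apply Rle_trans with ((1 + c) * (D / (2 * (1 + c)))).
      - apply Rmult_le_compat; lra.
      - right; field; lra. }
    lra. }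
  rewrite Cmod_slash. apply Rmult_le_compat; [left; apply Rpower_pos|apply Cmod_ge_0| |].
  - apply Rpower_anti; lra.
  - specialize (Hd (moebius g w - moebius g z)%C).
    replace (moebius g z + (moebius g w - moebius g z))%C with (moebius g w) in Hd by ring.
    pose proof (Cmod_triangle_sub (f (moebius g w)) (f (moebius g z))).
    assert (Q : Cmod (moebius g w - moebius g z)%C < d); [|specialize (Hd Q); lra].
    pose proof (Cmod_denom_pos g w Iw).
    rewrite moebius_sub, Cmod_div, Cmod_mult by (try assumption; apply Cmult_neq_0; apply denom_neq_0; assumption).
    fold D. apply Rmult_lt_reg_r with (Cmod (denom g w) * D); [nra|].
    unfold Rdiv. rewrite Rmult_assoc, Rinv_l, Rmult_1_r by nra.
    assert (D / 2 * D <= Cmod (denom g w) * D) by (apply Rmult_le_compat_r; lra). nra.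
Qed.

Lemma slash_rect_bounded (k : R) (f : C -> C) (g : SL2Z) (a b c d : R) :
  0 <= k -> holomorphic_on (half_plane 0) f -> a < b -> 0 < c -> c < d ->
  exists K, forall x y, a <= x <= b -> c <= y <= d -> Cmod (slash k f g (x, y)) <= K.
Proof.
  intros Hk Hf Hab Hc Hcd.
  apply (rectangle_bisection (fun a b c d => exists K, forall x y, a <= x <= b -> c <= y <= d ->
    Cmod (slash k f g (x, y)) <= K)); auto.
  - clear. intros a b c d [K1 H1] [K2 H2] [K3 H3] [K4 H4].
    exists (Rmax (Rmax K1 K2) (Rmax K3 K4)). intros x y Hx Hy.
    pose proof (Rmax_l (Rmax K1 K2) (Rmax K3 K4)). pose proof (Rmax_r (Rmax K1 K2) (Rmax K3 K4)).
    pose proof (Rmax_l K1 K2). pose proof (Rmax_r K1 K2). pose proof (Rmax_l K3 K4). pose proof (Rmax_r K3 K4).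
    destruct (Rle_dec x ((a + b) / 2)), (Rle_dec y ((c + d) / 2)).
    + specialize (H1 x y ltac:(lra) ltac:(lra)). lra.
    + specialize (H3 x y ltac:(lra) ltac:(lra)). lra.
    + specialize (H2 x y ltac:(lra) ltac:(lra)). lra.
    + specialize (H4 x y ltac:(lra) ltac:(lra)). lra.
  - intros x y Hx Hy. destruct (slash_locally_bounded k f g (x, y) Hk Hf) as [del [K [Hd H]]]; [simpl; lra|].
    exists (del / 2). split; [lra|]. intros n a' c' w h. intros. exists K. intros x' y' Hx' Hy'.
    apply H. eapply Rle_lt_trans; [apply Cmod_le_Re_Im|]. reim.
    assert (Rabs (x' - x) <= w) by (apply Rabs_le; lra).
    assert (Rabs (y' - y) <= h) by (apply Rabs_le; lra). lra.
Qed.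

Lemma slash_T (k : R) (f : C -> C) (g : SL2Z) (n : Z) (w : C) : 0 < Im w ->
  Cmod (slash k f (SL2Z_mul g (SL2Z_T n)) w) = Cmod (slash k f g (w + IZR n)%C).
Proof.
  intro Hw. rewrite !Cmod_slash, denom_mul, moebius_mul, moebius_T, denom_T by assumption.
  rewrite Cmult_1_r. reflexivity.
Qed.

Lemma slash_period (k : R) (G : SL2Z -> Prop) (f : C -> C) (j : SL2Z -> C -> C) (g : SL2Z) :
  modular_setup k G f j -> exists N : nat, (1 <= N)%nat /\ forall (m : Z) (w : C), 0 < Im w ->
    Cmod (slash k f g (w + RtoC (IZR m * INR N))%C) = Cmod (slash k f g w).
Proof.
  intros (Hs & Hi & Ha & Hf & Hk & _). destruct (conj_T_in G g Hs Hi) as [N [HN HG]].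
  exists N. split; [assumption|].
  assert (H1 : forall w, 0 < Im w -> Cmod (slash k f g (w + INR N)%C) = Cmod (slash k f g w)).
  { intros w Hw. rewrite INR_IZR_INZ, <- slash_T by assumption.
    rewrite <- (slash_coset k G f j _ g w Hf Ha HG Hw). f_equal. f_equal.
    rewrite <- SL2Z_mul_assoc, SL2Z_mul_inv_l, SL2Z_mul_1_r. reflexivity. }
  assert (H2 : forall (n : nat) w, 0 < Im w -> Cmod (slash k f g (w + RtoC (INR n * INR N))%C) = Cmod (slash k f g w)).
  { induction n as [|n IH]; intros w Hw.
    - simpl. replace (w + RtoC (0 * INR N))%C with w; [reflexivity|]. rewrite Rmult_0_l. ring.
    - rewrite S_INR. replace (w + RtoC ((INR n + 1) * INR N))%C with ((w + RtoC (INR n * INR N)) + INR N)%C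
        by (rewrite Rmult_plus_distr_r, RtoC_plus, Rmult_1_l; ring).
      rewrite H1; [apply IH, Hw|]. reim. lra. }
  intros m w Hw. destruct (Z_le_dec 0 m) as [L|L].
  - rewrite <- (Z2Nat.id m L), <- INR_IZR_INZ. apply H2, Hw.
  - rewrite <- (H2 (Z.to_nat (- m)) (w + RtoC (IZR m * INR N))%C) by (reim; lra).
    f_equal. f_equal. rewrite <- Cplus_assoc, <- RtoC_plus.
    rewrite (INR_IZR_INZ (Z.to_nat (- m))), Z2Nat.id by lia. rewrite opp_IZR.
    replace (IZR m * INR N + - IZR m * INR N) with 0 by ring. ring.
Qed.

(** The order controls the slash only from some height [Y] on. Between 1/2, the height guaranteed by
    [reduction], and [Y], periodicity of the modulus reduces the bound to a rectangle. *)
Lemma slash_bound (k : R) (G : SL2Z -> Prop) (f : C -> C) (j : SL2Z -> C -> C) (g : SL2Z) :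
  modular_setup k G f j -> exists nu K, 0 <= nu /\ 0 <= K /\ order_at (slash k f g) nu /\
    forall w, 1 / 2 <= Im w -> Cmod (slash k f g w) <= K * exp (2 * PI * nu * Im w).
Proof.
  intros S. pose proof S as (Hs & Hi & Ha & Hf & Hk & Ho).
  destruct (order_exists _ (Ho g)) as [nu [Hnu [Hord _]]].
  destruct (order_upper _ _ Hord) as (Y & K & HY & HK & HU).
  destruct (slash_period k G f j g S) as [N [HN HP]].
  assert (PN : 1 <= INR N) by (apply (le_INR 1); assumption).
  destruct (slash_rect_bounded k f g 0 (INR N) (1 / 2) (Y + 1)) as [K' HK']; auto; try lra.
  exists nu, (Rmax K K'). split; [assumption|]. split; [eapply Rle_trans; [exact HK|apply Rmax_l]|].
  split; [assumption|]. intros w Hw.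
  pose proof (exp_pos (2 * PI * nu * Im w)) as PE.
  destruct (Rle_dec Y (Im w)) as [L|L].
  - eapply Rle_trans; [apply HU, L|]. apply Rmult_le_compat_r; [lra|apply Rmax_l].
  - destruct (floor_exists (Re w / INR N)) as [m Hm].
    assert (Hm1 : IZR m * INR N <= Re w).
    { replace (Re w) with (Re w / INR N * INR N) by (field; lra). apply Rmult_le_compat_r; lra. }
    assert (Hm2 : Re w <= (IZR m + 1) * INR N).
    { replace (Re w) with (Re w / INR N * INR N) by (field; lra). apply Rmult_le_compat_r; lra. }
    rewrite <- (HP (- m)%Z w) by lra.
    assert (HB : Cmod (slash k f g (w + RtoC (IZR (- m) * INR N))%C) <= K').
    { replace (w + RtoC (IZR (- m) * INR N))%C with ((Re w - IZR m * INR N, Im w) : C)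
        by (apply C_ext; reim; rewrite ?opp_IZR; ring).
      apply HK'; lra. }
    eapply Rle_trans; [exact HB|].
    assert (1 <= exp (2 * PI * nu * Im w)).
    { rewrite <- exp_0. apply exp_le. pose proof PI_RGT_0.
      apply Rmult_le_pos; [|lra]. apply Rmult_le_pos; lra. }
    pose proof (Rmax_l K K'). pose proof (Rmax_r K K').
    apply Rle_trans with (Rmax K K' * 1); [lra|]. apply Rmult_le_compat_l; lra.
Qed.

(** Finite index makes the constant uniform: the bounds at the finitely many representatives pass to
    their cosets by [slash_coset], and [V] lists the orders that can occur. *)
Lemma uniform_bound (k : R) (G : SL2Z -> Prop) (f : C -> C) (j : SL2Z -> C -> C) :
  modular_setup k G f j -> exists (V : list R) (K : R), 0 <= K /\ forall g, exists nu,
    In nu V /\ 0 <= nu /\ order_at (slash k f g) nu /\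
    forall w, 1 / 2 <= Im w -> Cmod (slash k f g w) <= K * exp (2 * PI * nu * Im w).
Proof.
  intros S. pose proof S as (Hs & [l Hl] & Ha & Hf & Hk & Ho).
  assert (HV : exists (V : list R) (K : R), 0 <= K /\ forall rho, In rho l -> exists nu,
    In nu V /\ 0 <= nu /\ order_at (slash k f rho) nu /\
    forall w, 1 / 2 <= Im w -> Cmod (slash k f rho w) <= K * exp (2 * PI * nu * Im w)).
  { clear Hl. induction l as [|rho l [V [K [HK IH]]]].
    - exists nil, 0. split; [lra|]. intros rho [].
    - destruct (slash_bound k G f j rho S) as (nu & K' & H1 & H2 & H3 & H4).
      exists (nu :: V), (Rmax K K'). split; [eapply Rle_trans; [exact HK|apply Rmax_l]|].
      intros r [<-|Hr].
      + exists nu. split; [left; reflexivity|]. split; [assumption|]. split; [assumption|].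
        intros w Hw. eapply Rle_trans; [apply H4, Hw|].
        apply Rmult_le_compat_r; [left; apply exp_pos|apply Rmax_r].
      + destruct (IH r Hr) as (nu' & I1 & I2 & I3 & I4).
        exists nu'. split; [right; assumption|]. split; [assumption|]. split; [assumption|].
        intros w Hw. eapply Rle_trans; [apply I4, Hw|].
        apply Rmult_le_compat_r; [left; apply exp_pos|apply Rmax_l]. }
  destruct HV as (V & K & HK & HV). exists V, K. split; [assumption|]. intro g.
  destruct (Hl g) as [rho [Hr HG]]. destruct (HV rho Hr) as (nu & I1 & I2 & I3 & I4).
  assert (E : forall w, 0 < Im w -> Cmod (slash k f g w) = Cmod (slash k f rho w)).
  { intros w Hw. rewrite <- (slash_coset k G f j _ rho w Hf Ha HG Hw).
    rewrite <- SL2Z_mul_assoc, SL2Z_mul_inv_l, SL2Z_mul_1_r. reflexivity. }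
  destruct (order_exists _ (Ho g)) as [nu' [Hnu' [Hord _]]].
  assert (nu' = nu) by (apply (order_unique _ _ nu' nu Hnu' I2 Hord I3 E)). subst nu'.
  exists nu. split; [assumption|]. split; [assumption|]. split; [assumption|].
  intros w Hw. rewrite E by lra. apply I4, Hw.
Qed.

(** [P] may hold at infinitely many points below [t]; finiteness above [t] suffices. The witness
    [M'] is the second largest value above [t] if there is one, and [t] otherwise. *)
Lemma list_max_gap (P : R -> Prop) (L : list R) (t : R) : 0 <= t ->
  (exists v, P v /\ t < v) -> (forall v, P v -> t < v -> In v L) ->
  exists M M', P M /\ t < M /\ 0 <= M' < M /\ forall v, P v -> v = M \/ v <= M'.
Proof.
  intros Ht [v0 [Pv0 Hv0]] HL.
  destruct (list_argmin (fun v => - v) (fun v => P v /\ t < v) L) as [M [HM1 [[HM2 HM3] HM4]]].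
  { exists v0. auto. }
  destruct (classic (exists v, In v L /\ (P v /\ t < v /\ v <> M))) as [E|N].
  - destruct (list_argmin (fun v => - v) (fun v => P v /\ t < v /\ v <> M) L E)
      as [M' [H1 [[H2 [H3 H4]] H5]]].
    exists M, M'. split; [assumption|]. split; [assumption|].
    assert (M' <= M) by (specialize (HM4 M' H1 (conj H2 H3)); lra).
    split; [split; [lra|destruct (Rle_lt_or_eq_dec M' M H); [assumption|contradiction]]|].
    intros v Pv. destruct (Req_dec v M) as [Q|Q]; [left; assumption|right].
    destruct (Rle_dec v t) as [Q'|Q']; [lra|].
    specialize (H5 v (HL v Pv ltac:(lra))). specialize (H5 ltac:(repeat split; auto; lra)). lra.
  - exists M, t. split; [assumption|]. split; [assumption|]. split; [lra|].
    intros v Pv. destruct (Req_dec v M) as [Q|Q]; [left; assumption|right].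
    apply Rnot_lt_le. intro Q'. apply N. exists v. split; [apply HL; assumption|].
    repeat split; assumption.
Qed.

(** The point of the real line that [g] sends to infinity. *)
Definition pole_point (g : SL2Z) : R := - IZR (md g) / IZR (mc g).

Lemma T_multiple_in (G : SL2Z -> Prop) (n m : Z) : is_subgroup G -> G (SL2Z_T n) -> G (SL2Z_T (m * n)).
Proof.
  intros [H1 [Hm Hi]] Hn.
  assert (K : forall p : nat, G (SL2Z_T (Z.of_nat p * n))).
  { induction p as [|p IH].
    - replace (SL2Z_T (Z.of_nat 0 * n)) with SL2Z_one; [assumption|].
      apply SL2Z_ext; reflexivity.
    - replace (Z.of_nat (S p) * n)%Z with (Z.of_nat p * n + n)%Z by lia.
      rewrite <- SL2Z_T_add. apply Hm; assumption. }
  destruct (Z_le_dec 0 m) as [L|L].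
  - rewrite <- (Z2Nat.id m L). apply K.
  - replace (m * n)%Z with (- (Z.of_nat (Z.to_nat (- m)) * n))%Z by lia.
    rewrite <- SL2Z_T_inv. apply Hi, K.
Qed.

Lemma order_coset (k : R) (G : SL2Z -> Prop) (f : C -> C) (j : SL2Z -> C -> C) (g del : SL2Z) (nu : R) :
  modular_setup k G f j -> G del -> 0 <= nu -> order_at (slash k f g) nu ->
  order_at (slash k f (SL2Z_mul del g)) nu.
Proof.
  intros (Hs & Hi & Ha & Hf & Hk & Ho) Hd Hnu H.
  destruct (order_exists _ (Ho (SL2Z_mul del g))) as [nu' [Hnu' [Hord _]]].
  replace nu with nu'; [assumption|].
  apply (order_unique (slash k f (SL2Z_mul del g)) (slash k f g)); auto.
  intros w Hw. apply (slash_coset k G f j); assumption.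
Qed.

Lemma order_opp (k : R) (G : SL2Z -> Prop) (f : C -> C) (j : SL2Z -> C -> C) (g : SL2Z) (nu : R) :
  modular_setup k G f j -> 0 <= nu -> order_at (slash k f g) nu ->
  order_at (slash k f (SL2Z_opp g)) nu.
Proof.
  intros (Hs & Hi & Ha & Hf & Hk & Ho) Hnu H.
  destruct (order_exists _ (Ho (SL2Z_opp g))) as [nu' [Hnu' [Hord _]]].
  replace nu with nu'; [assumption|].
  apply (order_unique (slash k f (SL2Z_opp g)) (slash k f g)); auto.
  intros w Hw. rewrite !Cmod_slash.
  assert (E : denom (SL2Z_opp g) w = (- denom g w)%C).
  { unfold denom, SL2Z_opp; simpl. rewrite !opp_IZR, !RtoC_opp. ring. }
  rewrite E, Cmod_opp. f_equal. f_equal. f_equal. unfold moebius. rewrite E.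
  unfold SL2Z_opp; simpl. rewrite !opp_IZR, !RtoC_opp. field.
  apply denom_neq_0, Hw.
Qed.

(** A pole at infinity also shows up at finite cusps: a conjugate of a translation, lying in the
    group, moves infinity to an equivalent finite cusp. *)
Lemma exists_finite_pole (k : R) (G : SL2Z -> Prop) (f : C -> C) (j : SL2Z -> C -> C) :
  modular_setup k G f j -> ~ finite_at_cusps k f ->
  exists g nu, (0 < mc g)%Z /\ 0 < nu /\ order_at (slash k f (SL2Z_inv g)) nu.
Proof.
  intros S NF. pose proof S as (Hs & Hi & Ha & Hf & Hk & Ho).
  apply not_all_ex_not in NF. destruct NF as [g NF].
  destruct (order_exists _ (Ho g)) as [nu [Hnu [Hord Hpos]]]. specialize (Hpos NF).
  assert (K : exists h, mc h <> 0%Z /\ order_at (slash k f (SL2Z_inv h)) nu).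
  { destruct (Z.eq_dec (mc g) 0) as [E|E].
    (* The element [S T^N S^(-1)] has lower row [(-N, 1)], so after multiplication by [g] the lower
       left entry is [- N * ma g], which is non-zero. *)
    - destruct (conj_T_in G SL2Z_S Hs Hi) as [N [HN HG]].
      set (del := SL2Z_mul (SL2Z_mul SL2Z_S (SL2Z_T (Z.of_nat N))) (SL2Z_inv SL2Z_S)) in *.
      exists (SL2Z_inv (SL2Z_mul del g)). split.
      + unfold del. cbn -[Z.mul Z.add Z.opp Z.of_nat]. pose proof (SL2Z_det g) as D. rewrite E in *.
        assert (ma g <> 0%Z) by (intro Q; rewrite Q in D; lia). nia.
      + rewrite SL2Z_inv_inv. apply (order_coset k G f j); assumption.
    - exists (SL2Z_inv g). rewrite SL2Z_inv_inv. split; [simpl; lia|assumption]. }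
  destruct K as [h [Hh1 Hh2]].
  destruct (Z_lt_dec 0 (mc h)) as [L|L].
  - exists h, nu. auto.
  - exists (SL2Z_opp h), nu. split; [simpl; lia|]. split; [assumption|].
    replace (SL2Z_inv (SL2Z_opp h)) with (SL2Z_opp (SL2Z_inv h)) by (apply SL2Z_ext; reflexivity).
    apply (order_opp k G f j); assumption.
Qed.

(** Since [g] sends the cusp to infinity, the expansion there is that of the slash by [SL2Z_inv g].
    The sign of [c] is normalised because [g] and [- g] give the same cusp. *)
Definition dominant_at (k : R) (f : C -> C) (M : R) (g : SL2Z) (nu : R) : Prop :=
  (0 < mc g)%Z /\ 0 <= nu /\ order_at (slash k f (SL2Z_inv g)) nu /\ nu / (IZR (mc g) * IZR (mc g)) = M.

(** Orders take finitely many values, so a ratio [nu / c^2] above half of one known positive ratio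
    [v0] bounds [c]. Hence finitely many ratios exceed [v0 / 2], and the largest is separated from
    the rest. The final alternative places a dominant cusp relative to the interval from [- eta] to
    [N - eta]: it belongs to [xs], or its distance from the interval is at least [eta]. *)
Lemma dominant_points (k : R) (G : SL2Z -> Prop) (f : C -> C) (j : SL2Z -> C -> C) (N : nat) :
  modular_setup k G f j -> ~ finite_at_cusps k f -> (1 <= N)%nat -> G (SL2Z_T (Z.of_nat N)) ->
  exists (M M' K eta : R) (xs : list R),
    0 <= M' < M /\ 0 <= K /\ 0 < eta /\ NoDup xs /\ xs <> nil /\
    (forall g, (0 < mc g)%Z -> exists nu,
       0 <= nu /\ (forall w, 1 / 2 <= Im w ->
         Cmod (slash k f (SL2Z_inv g) w) <= K * exp (2 * PI * nu * Im w)) /\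
       (nu / (IZR (mc g) * IZR (mc g)) <= M' \/
        nu / (IZR (mc g) * IZR (mc g)) = M /\
        (In (pole_point g) xs \/ pole_point g <= - (2 * eta) \/ INR N <= pole_point g))) /\
    (forall x, In x xs -> 0 <= x <= INR N - 2 * eta /\
       exists g nu, dominant_at k f M g nu /\ x = pole_point g).
Proof.
  intros S NF HN HT. pose proof S as (Hs & Hi & Ha & Hf & Hk & Ho).
  destruct (uniform_bound k G f j S) as (V & K & HK & HV).
  destruct (exists_finite_pole k G f j S NF) as (g0 & nu0 & Hg0 & Hnu0 & Hord0).
  assert (Pc : forall g, (0 < mc g)%Z -> 1 <= IZR (mc g)) by (intros; apply IZR_le; lia).
  set (val := fun g nu => nu / (IZR (mc g) * IZR (mc g))).
  set (v0 := val g0 nu0).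
  assert (Pv0 : 0 < v0) by (unfold v0, val; pose proof (Pc g0 Hg0); apply Rdiv_lt_0_compat; nra).
  destruct (list_bounded (fun x => x) V) as [numax [Pnumax Hnumax]].
  destruct (nat_above (2 * numax / v0)) as [cm Hcm].
  assert (Hcm' : 2 * numax <= INR cm * v0).
  { replace (2 * numax) with (2 * numax / v0 * v0) by (field; lra). apply Rmult_le_compat_r; lra. }
  assert (Hbd : forall g nu, (0 < mc g)%Z -> In nu V -> v0 / 2 < val g nu -> IZR (mc g) <= INR cm).
  { intros g nu Hg Hin Hv. specialize (Hnumax nu Hin). pose proof (Pc g Hg).
    assert (Hv' : v0 / 2 * (IZR (mc g) * IZR (mc g)) < nu).
    { replace nu with (val g nu * (IZR (mc g) * IZR (mc g))) by (unfold val; field; lra).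
      apply Rmult_lt_compat_r; [nra|assumption]. }
    apply Rmult_le_reg_r with (v0 / 2); [lra|]. nra. }
  assert (HinV : forall g nu, 0 <= nu -> order_at (slash k f (SL2Z_inv g)) nu -> In nu V).
  { intros g nu P O. destruct (HV (SL2Z_inv g)) as (nu' & I1 & I2 & I3 & _).
    replace nu with nu'; [assumption|]. apply (order_unique _ _ _ _ I2 P I3 O); reflexivity. }
  set (L := map (fun p => fst p / (IZR (snd p) * IZR (snd p))) (list_prod V (zlist cm))).
  destruct (list_max_gap (fun v => exists g nu, (0 < mc g)%Z /\ 0 <= nu /\
      order_at (slash k f (SL2Z_inv g)) nu /\ v = val g nu) L (v0 / 2))
    as (M & M' & (g1 & nu1 & Hg1 & Hnu1 & Hord1 & HM) & HMt & HM' & Hgap).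
  { lra. }
  { exists v0. split; [|lra]. exists g0, nu0. split; [assumption|]. split; [lra|]. split; [assumption|reflexivity]. }
  { intros v (g & nu & Q1 & Q2 & Q3 & ->) Hv.
    pose proof (HinV g nu Q2 Q3) as Hin. pose proof (Hbd g nu Q1 Hin Hv) as Hc.
    apply in_map_iff. exists (nu, mc g). split; [reflexivity|]. apply in_prod; [assumption|].
    apply in_zlist, abs_IZR_le. rewrite Rabs_right; [assumption|]. pose proof (Pc g Q1). lra. }
  assert (Hmc : forall g nu, dominant_at k f M g nu -> 1 <= IZR (mc g) <= INR cm).
  { intros g nu (Q1 & Q2 & Q3 & Q4). split; [apply Pc, Q1|].
    apply (Hbd g nu); auto. - apply (HinV g); assumption. - unfold val. lra. }
  assert (Pcm : 1 <= INR cm).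
  { assert (Q : dominant_at k f M g1 nu1) by (split; [|split; [|split]]; auto). apply Hmc in Q. lra. }
  (* Dominant cusps have denominators at most [cm], so a negative one is at most [- / cm], and one
     below the integer [N] is at most [N - / cm]. With [2 * eta = / cm], none comes within [eta] of
     an end of the interval from [- eta] to [N - eta]. *)
  set (eta := / (2 * INR cm)).
  assert (Heta : 2 * eta * INR cm = 1) by (unfold eta; field; lra).
  assert (Peta : 0 < eta) by (apply Rinv_0_lt_compat; lra).
  assert (HptL : forall g nu, dominant_at k f M g nu -> pole_point g < 0 -> pole_point g <= - (2 * eta)).
  { intros g nu Q Hlt. apply Hmc in Q.
    assert (E : pole_point g * IZR (mc g) = - IZR (md g)) by (unfold pole_point; field; lra).
    assert (HI : 0 < IZR (md g)) by nra.
    assert (1 <= IZR (md g)) by (apply IZR_le; apply lt_IZR in HI; lia).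
    apply Rmult_le_reg_r with (IZR (mc g)); [lra|]. nra. }
  assert (HptR : forall g nu, dominant_at k f M g nu -> pole_point g < INR N -> pole_point g <= INR N - 2 * eta).
  { intros g nu Q Hlt. apply Hmc in Q.
    assert (E : pole_point g * IZR (mc g) = - IZR (md g)) by (unfold pole_point; field; lra).
    assert (HI : 0 < IZR (md g) + INR N * IZR (mc g)) by nra.
    rewrite INR_IZR_INZ, <- mult_IZR, <- plus_IZR in HI.
    assert (HI' : 1 <= IZR (md g + Z.of_nat N * mc g)) by (apply IZR_le; apply lt_IZR in HI; lia).
    rewrite plus_IZR, mult_IZR, <- INR_IZR_INZ in HI'.
    apply Rmult_le_reg_r with (IZR (mc g)); [lra|]. nra. }
  assert (PN : 1 <= INR N) by (apply (le_INR 1); assumption).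
  set (Xp := fun x => 0 <= x < INR N /\ exists g nu, dominant_at k f M g nu /\ x = pole_point g).
  set (Lx := map (fun p => - IZR (snd p) / IZR (fst p)) (list_prod (zlist cm) (zlist (N * cm)))).
  set (xs := nodup Req_EM_T (filter (fun x => pbool (Xp x)) Lx)).
  assert (Hxs : forall x, In x xs <-> Xp x).
  { intro x. unfold xs. rewrite nodup_In, filter_In, pbool_true. split; [tauto|].
    intro HX. split; [|assumption]. destruct HX as [Hx (g & nu & Q & E)].
    apply Hmc in Q. apply in_map_iff. exists (mc g, md g). split; [rewrite E; reflexivity|].
    apply in_prod; apply in_zlist, abs_IZR_le.
    - rewrite Rabs_right; lra.
    - assert (E' : IZR (md g) = - (x * IZR (mc g))) by (rewrite E; unfold pole_point; field; lra).
      rewrite E', Rabs_Ropp, Rabs_mult, !Rabs_right, mult_INR by lra.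
      apply Rmult_le_compat; lra. }
  exists M, M', K, eta, xs. split; [assumption|]. split; [assumption|]. split; [assumption|].
  split; [apply NoDup_nodup|]. split; [|split].
  - destruct (floor_exists (pole_point g1 / INR N)) as [m Hm].
    assert (Hm1 : IZR m * INR N <= pole_point g1).
    { replace (pole_point g1) with (pole_point g1 / INR N * INR N) by (field; lra). apply Rmult_le_compat_r; lra. }
    assert (Hm2 : pole_point g1 < (IZR m + 1) * INR N).
    { replace (pole_point g1) with (pole_point g1 / INR N * INR N) by (field; lra). apply Rmult_lt_compat_r; lra. }
    (* Translation by a multiple of [N] brings the cusp of [g1] between 0 and [N] and changes
       neither [c] nor the order, so [xs] is not empty. *)
    set (g2 := SL2Z_mul g1 (SL2Z_T (m * Z.of_nat N))).
    assert (Hc2 : mc g2 = mc g1) by (unfold g2; cbn -[Z.mul Z.add]; ring).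
    assert (Hp2 : pole_point g2 = pole_point g1 - IZR m * INR N).
    { unfold pole_point. rewrite Hc2. unfold g2; cbn -[Z.mul Z.add].
      rewrite plus_IZR, !mult_IZR, <- INR_IZR_INZ. pose proof (Pc g1 Hg1). field. lra. }
    assert (Hx : Xp (pole_point g2)).
    { split; [rewrite Hp2; lra|]. exists g2, nu1. split; [|reflexivity].
      split; [rewrite Hc2; assumption|]. split; [assumption|]. split; [|rewrite Hc2; symmetry; exact HM].
      unfold g2. rewrite SL2Z_inv_mul, SL2Z_T_inv.
      apply (order_coset k G f j); auto.
      replace (- (m * Z.of_nat N))%Z with ((- m) * Z.of_nat N)%Z by ring.
      apply T_multiple_in; assumption. }
    apply Hxs in Hx. intro E. rewrite E in Hx. destruct Hx.
  - intros g Hg. destruct (HV (SL2Z_inv g)) as (nu & I1 & I2 & I3 & I4).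
    exists nu. split; [assumption|]. split; [assumption|].
    destruct (Hgap (val g nu)) as [E|E]; [exists g, nu; auto| |left; exact E].
    right. split; [exact E|].
    assert (Q : dominant_at k f M g nu) by (split; [|split; [|split]]; auto).
    destruct (Rlt_le_dec (pole_point g) 0) as [L1|L1]; [right; left; apply (HptL g nu); assumption|].
    destruct (Rlt_le_dec (pole_point g) (INR N)) as [L2|L2]; [|right; right; assumption].
    left. apply Hxs. split; [lra|]. exists g, nu. auto.
  - intros x Hx. apply Hxs in Hx. destruct Hx as [Hx (g & nu & Q & E)].
    split; [|exists g, nu; auto]. split; [lra|]. rewrite E in *. apply (HptR g nu); [assumption|lra].
Qed.

(** * The circle method *)

Lemma Cpowr_scal (r : R) (z : C) (k : R) : 0 < r -> z <> 0 ->
  Cpowr (r * z) k = (Rpower r k * Cpowr z k)%C.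
Proof.
  intros Hr Hz. assert (Pz : 0 < Cmod z) by (apply Cmod_gt_0; assumption).
  unfold Cpowr, Rpower. rewrite <- Cexp_RtoC, <- Cexp_plus. f_equal.
  assert (E : Clog (r * z) = (ln r + Clog z)%C).
  { unfold Clog, Carg. rewrite Cmod_RtoC_mult, Rabs_right by lra.
    apply C_ext; reim.
    - apply ln_mult; assumption.
    - rewrite Rmult_0_l, Rplus_0_r, Rmult_0_l, Rminus_0_r, Rplus_0_l.
      replace (r * Re z / (r * Cmod z)) with (Re z / Cmod z) by (field; lra).
      destruct (Rle_dec 0 (r * Im z)), (Rle_dec 0 (Im z)); try reflexivity; exfalso; nra. }
  rewrite E, RtoC_mult. ring.
Qed.

Lemma shift_Ci_neq_0 (s : R) : (s + Ci)%C <> 0.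
Proof. intro E. apply (f_equal Im) in E. autorewrite with reim in E. lra. Qed.

Lemma Cmod_shift_Ci (s : R) : Cmod (s + Ci)%C * Cmod (s + Ci)%C = 1 + s * s.
Proof. rewrite Cmod_sqr. reim. ring. Qed.

Lemma Cmod_shift_Ci_ge_1 (s : R) : 1 <= Cmod (s + Ci)%C.
Proof.
  eapply Rle_trans; [|apply Im_le_Cmod]. reim. rewrite Rplus_0_l, Rabs_R1. lra.
Qed.

Lemma Re_Cinv (z : C) : z <> 0 -> Re (/ z)%C = Re z / (Cmod z * Cmod z).
Proof.
  intro Hz. assert (P : 0 < Cmod z) by (apply Cmod_gt_0; assumption).
  pose proof (Cmod_sqr z) as S. rewrite S. destruct z as [x y]. unfold Cinv, Re, Im in *; simpl in *.
  field. nra.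
Qed.

Lemma Im_Cinv (z : C) : z <> 0 -> Im (/ z)%C = - Im z / (Cmod z * Cmod z).
Proof.
  intro Hz. assert (P : 0 < Cmod z) by (apply Cmod_gt_0; assumption).
  pose proof (Cmod_sqr z) as S. rewrite S. destruct z as [x y]. unfold Cinv, Re, Im in *; simpl in *.
  field. nra.
Qed.

(** [(s + i)^(-k)], in the branch produced by the principal power of [-c w + a = / (c z + d)] at
    [z = x + y (s + i)]; positive factors come out of [Cpowr], so this does not depend on the cusp. *)
Definition arc_factor (k s : R) : C := (/ Cpowr (/ (s + Ci)) (- k))%C.

(** The number [/ (s + Ci)] lies in the lower half plane, and [atan s - PI / 2] is its principal
    argument. *)
Lemma arc_factor_formula (k s : R) :
  arc_factor k s = Cexp (- (k / 2 * ln (1 + s * s)), - (k * (PI / 2 - atan s))).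
Proof.
  pose proof (shift_Ci_neq_0 s) as NZ. pose proof (Cmod_shift_Ci s) as S. pose proof (Cmod_shift_Ci_ge_1 s) as G1.
  assert (Ps : 0 < 1 + s * s) by nra.
  assert (Es : Cmod (s + Ci)%C = sqrt (1 + s * s)).
  { rewrite <- S. symmetry. apply sqrt_square. lra. }
  unfold arc_factor, Cpowr. rewrite <- Cexp_opp. f_equal.
  assert (E : Clog (/ (s + Ci)) = (- (/ 2 * ln (1 + s * s)), - (PI / 2 - atan s))).
  { unfold Clog. f_equal.
    - rewrite Cmod_inv, ln_Rinv by (try assumption; lra). f_equal. rewrite <- S, ln_mult by lra. field.
    - unfold Carg. rewrite Im_Cinv, Re_Cinv by assumption. rewrite S.
      reim.
      destruct (Rle_dec 0 (- (0 + 1) / (1 + s * s))) as [L|L].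
      { exfalso. assert (0 < / (1 + s * s)) by (apply Rinv_0_lt_compat; assumption). unfold Rdiv in L. nra. }
      f_equal. pose proof (atan_bound s).
      rewrite <- (acos_cos (PI / 2 - atan s)) by lra. f_equal.
      rewrite cos_shift, sin_atan. rewrite Cmod_inv, Es by assumption.
      rewrite Rplus_0_r. unfold Rsqr.
      assert (0 < sqrt (1 + s * s)) by (apply sqrt_lt_R0; assumption).
      pose proof (sqrt_sqrt (1 + s * s) ltac:(lra)) as Q. rewrite <- Q at 1. field. lra. }
  rewrite E. apply C_ext; reim; field.
Qed.

Lemma Cmod_arc_factor_le_1 (k s : R) : 0 <= k -> Cmod (arc_factor k s) <= 1.
Proof.
  intro Hk. rewrite arc_factor_formula, Cmod_Cexp, Re_pair. apply exp_le_1.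
  assert (0 <= ln (1 + s * s)).
  { rewrite <- ln_1. destruct (Req_dec s 0) as [->|N].
    - rewrite Rmult_0_l, Rplus_0_r. lra.
    - left. apply ln_increasing; nra. }
  nra.
Qed.

Lemma pow5_le (t : R) : 0 < t <= 1 -> 0 < t ^ 5 <= t.
Proof.
  intros [H0 H1]. split; [apply pow_lt; assumption|].
  replace t with (t * 1) at 2 by ring. replace (t ^ 5) with (t * t ^ 4) by ring.
  apply Rmult_le_compat_l; [lra|]. rewrite <- (pow1 4). apply pow_incr. lra.
Qed.

Lemma inv_pow5_ge (t : R) : 0 < t <= 1 -> / t <= / t ^ 5.
Proof. intro H. apply pow5_le in H as H'. apply Rinv_le_contravar; lra. Qed.

(** The coefficient [1 / c^2] of [1 / zeta] is the reason why an order [nu] counts as [nu / c^2] at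
    the cusp. *)
Lemma moebius_near_pole (g : SL2Z) (zeta : C) : (0 < mc g)%Z -> zeta <> 0 ->
  denom g (pole_point g + zeta) = (IZR (mc g) * zeta)%C /\
  moebius g (pole_point g + zeta) = (RtoC (IZR (ma g) / IZR (mc g)) - RtoC (/ (IZR (mc g) * IZR (mc g))) / zeta)%C.
Proof.
  intros Hc Hz. assert (Pc : 0 < IZR (mc g)) by (apply IZR_lt; assumption).
  assert (NC : RtoC (IZR (mc g)) <> 0) by (intro Q; injection Q; lra).
  assert (E : denom g (pole_point g + zeta) = (IZR (mc g) * zeta)%C).
  { unfold denom, pole_point. rewrite RtoC_div by lra. rewrite RtoC_opp. field. assumption. }
  split; [assumption|]. unfold moebius. rewrite E. unfold pole_point.
  rewrite !RtoC_div, RtoC_inv, RtoC_mult, RtoC_opp by nra.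
  pose proof (IZR_det g) as D.
  replace (IZR (ma g) * (- IZR (md g) / IZR (mc g) + zeta) + IZR (mb g))%C
    with (IZR (ma g) * zeta - (IZR (ma g) * IZR (md g) - IZR (mb g) * IZR (mc g)) / IZR (mc g))%C
    by (field; assumption).
  rewrite <- !RtoC_mult, <- RtoC_minus, D, RtoC_mult. field. split; assumption.
Qed.

Lemma Cmod_ee_pole (M y s : R) : 0 < y ->
  Cmod (ee (M / (y * (s + Ci)))) = exp (2 * PI * M / (y * (1 + s * s))).
Proof.
  intro Hy. pose proof (shift_Ci_neq_0 s). assert (Hy' : RtoC y <> 0) by (intro Q; injection Q; lra).
  rewrite Cmod_ee. f_equal. unfold Cdiv. reim.
  rewrite Im_Cinv by (apply Cmult_neq_0; assumption).
  rewrite Cmod_RtoC_mult, Rabs_right by lra.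
  replace (y * Cmod (s + Ci)%C * (y * Cmod (s + Ci)%C)) with (y * y * (Cmod (s + Ci)%C * Cmod (s + Ci)%C)) by ring.
  rewrite Cmod_shift_Ci. reim. field. split; nra.
Qed.

(** The parameter [t] is the fifth root of the height [y = t ^ 5]. *)
Definition approximates (k : R) (f : C -> C) (M K kap t0 X : R) (beta : C) : Prop :=
  forall t s : R, 0 < t <= t0 -> Rabs s <= 1 ->
    Cmod (f (X + RtoC (t ^ 5) * (s + Ci))
          - beta * RtoC (Rpower (t ^ 5) (- k)) * (arc_factor k s * ee (M / (RtoC (t ^ 5) * (s + Ci)))))%C
      <= K * Rpower (t ^ 5) (- k) * exp (2 * PI * M / t ^ 5 - kap / t).

(** The leading term [b * ee (- nu * w)] is pulled back along [w = g z]. By [moebius_near_pole] it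
    splits off the constant [ee (- nu * a / c)] and leaves [ee (M / zeta)]; the power of [c * zeta]
    contributes [c^(-k)], which also goes into [beta]. The error [exp (- del * Im w)] becomes
    [exp (- kap / t)], because [Im w] is at least [1 / (2 c^2 t)]. *)
Lemma local_approx (k : R) (f : C -> C) (M : R) (g : SL2Z) (nu : R) :
  0 <= k -> 0 < M -> dominant_at k f M g nu ->
  exists (beta : C) (K kap t0 : R), beta <> 0 /\ 0 <= K /\ 0 < kap /\ 0 < t0 <= 1 /\
    approximates k f M K kap t0 (pole_point g) beta.
Proof.
  intros Hk HM (Hc & Hnu & Hord & Hval).
  assert (Pc : 0 < IZR (mc g)) by (apply IZR_lt; assumption).
  set (c := IZR (mc g)) in *.
  assert (Enu : nu = M * (c * c)) by (rewrite <- Hval; field; lra).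
  assert (Pnu : 0 < nu) by (rewrite Enu; apply Rmult_lt_0_compat; nra).
  destruct Hord as [[_ (b & Y & K & del & Hb & HY & HK & Hdel & H)]|[E _]]; [|lra].
  set (a := IZR (ma g)).
  exists (RtoC (Rpower c (- k)) * ee (RtoC (- (nu * (a / c)))) * b)%C, (Rpower c (- k) * K), (del / (2 * (c * c))),
    (* This bound on [t] puts [w] at height at least [Y], where the asymptotics hold. *)
    (Rmin 1 (/ (2 * (c * c) * Y))).
  pose proof (Rpower_pos c (- k)) as PR.
  split. { repeat apply Cmult_neq_0; [intro Q; injection Q; lra|apply ee_neq_0|assumption]. }
  split; [apply Rmult_le_pos; lra|].
  split; [apply Rdiv_lt_0_compat; nra|].
  assert (Pi : 0 < / (2 * (c * c) * Y)) by (apply Rinv_0_lt_compat; repeat apply Rmult_lt_0_compat; lra).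
  split; [split; [apply Rmin_pos; lra|apply Rmin_l]|].
  intros t s [Ht0 Ht] Hs.
  assert (Ht1 : t <= 1) by (eapply Rle_trans; [exact Ht|apply Rmin_l]).
  assert (Ht2 : t <= / (2 * (c * c) * Y)) by (eapply Rle_trans; [exact Ht|apply Rmin_r]).
  destruct (pow5_le t (conj Ht0 Ht1)) as [Py Hyt].
  set (y := t ^ 5) in *.
  set (zeta := (RtoC y * (s + Ci))%C).
  pose proof (shift_Ci_neq_0 s) as NS.
  assert (Ny : RtoC y <> 0) by (intro Q; injection Q; lra).
  assert (Nz : zeta <> 0) by (apply Cmult_neq_0; assumption).
  destruct (moebius_near_pole g zeta Hc Nz) as [ED EM]. fold c in ED, EM. fold a in EM.
  set (z := (pole_point g + zeta)%C) in *.
  assert (Iz : Im z = y) by (unfold z, zeta; reim; ring).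
  assert (Pz : 0 < Im z) by lra.
  set (w := moebius g z) in *.
  assert (Iw : Im w = / (c * c * y * (1 + s * s))).
  { unfold w. rewrite Im_moebius by assumption. rewrite ED, Iz. unfold zeta.
    rewrite !Cmod_RtoC_mult, !Rabs_right by lra. fold c.
    replace (c * (y * Cmod (s + Ci)%C) * (c * (y * Cmod (s + Ci)%C)))
      with (c * c * (y * y) * (Cmod (s + Ci)%C * Cmod (s + Ci)%C)) by ring.
    rewrite Cmod_shift_Ci. field. repeat split; nra. }
  assert (Hs2 : s * s <= 1).
  { apply Rabs_le_between in Hs. nra. }
  assert (Ps : 0 < 1 + s * s) by (pose proof (Rle_0_sqr s) as Q; unfold Rsqr in Q; lra).
  assert (Pcc : 0 < c * c) by (apply Rmult_lt_0_compat; lra).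
  assert (Iw2 : / (2 * (c * c) * t) <= Im w).
  { rewrite Iw. apply Rinv_le_contravar; [repeat apply Rmult_lt_0_compat; lra|].
    replace (2 * (c * c) * t) with (c * c * t * 2) by ring.
    apply Rmult_le_compat; [|lra| |lra].
    - repeat apply Rmult_le_pos; lra.
    - apply Rmult_le_compat_l; lra. }
  assert (YIw : Y <= Im w).
  { eapply Rle_trans; [|exact Iw2]. rewrite <- (Rinv_inv Y).
    apply Rinv_le_contravar; [repeat apply Rmult_lt_0_compat; lra|].
    replace (/ Y) with (2 * (c * c) * / (2 * (c * c) * Y)) by (field; split; lra).
    apply Rmult_le_compat_l; [lra|assumption]. }
  specialize (H w YIw).
  set (G := slash k f (SL2Z_inv g) w) in *.
  assert (Ef : f z = (RtoC (Rpower c (- k)) * RtoC (Rpower y (- k)) * arc_factor k s * G)%C).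
  { unfold G, slash, w. rewrite denom_inv_l, moebius_inv_l by assumption.
    rewrite ED. unfold zeta. fold c.
    replace (/ (c * (y * (s + Ci))))%C with (RtoC (/ (c * y)) * / (s + Ci))%C.
    2:{ rewrite RtoC_inv, RtoC_mult by nra. field. repeat split; auto. intro Q; injection Q; lra. }
    assert (Pcy : 0 < c * y) by nra.
    rewrite Cpowr_scal; [|apply Rinv_0_lt_compat, Pcy|].
    2:{ intro Q. apply C1_nz. replace (RtoC 1) with (/ (s + Ci) * (s + Ci))%C by (field; assumption).
        rewrite Q. ring. }
    unfold arc_factor.
    assert (NP : Cpowr (/ (s + Ci)) (- k) <> 0) by apply Cexp_neq_0.
    rewrite <- RtoC_mult, Rpower_mult_distr by assumption.
    assert (EP : Rpower (c * y) (- k) * Rpower (/ (c * y)) (- k) = 1).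
    { rewrite Rpower_mult_distr by (try apply Rinv_0_lt_compat; assumption).
      rewrite Rinv_r by lra. unfold Rpower. rewrite ln_1, Rmult_0_r. apply exp_0. }
    transitivity (RtoC (Rpower (c * y) (- k) * Rpower (/ (c * y)) (- k)) * f z)%C; [rewrite EP; ring|].
    rewrite RtoC_mult. field. assumption. }
  assert (Eee : ee (- (nu * w)) = (ee (RtoC (- (nu * (a / c)))) * ee (M / zeta))%C).
  { rewrite <- ee_plus. f_equal. rewrite EM. fold c a. rewrite Enu.
    rewrite RtoC_opp, !RtoC_mult, RtoC_inv, RtoC_mult by nra. field. split; [assumption|].
    intro Q; injection Q; lra. }
  assert (EG : G = (ee (- (nu * w)) * (G * ee (nu * w)))%C).
  { rewrite ee_opp. field. apply ee_neq_0. }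
  rewrite Ef, EG, Eee. fold zeta.
  set (P := RtoC (Rpower c (- k))). set (Q := RtoC (Rpower y (- k))).
  set (e1 := ee (RtoC (- (nu * (a / c))))). set (e2 := ee (M / zeta)).
  replace (P * Q * arc_factor k s * (e1 * e2 * (G * ee (nu * w))) - P * e1 * b * Q * (arc_factor k s * e2))%C
    with (P * Q * e1 * arc_factor k s * e2 * (G * ee (nu * w) - b))%C by ring.
  rewrite !Cmod_mult. unfold P, Q, e1, e2, zeta. rewrite Cmod_ee_R, !Cmod_R, Cmod_ee_pole by assumption.
  pose proof (Rpower_pos y (- k)) as PR'.
  rewrite !Rabs_right by lra. rewrite Rmult_1_r.
  pose proof (Cmod_arc_factor_le_1 k s Hk) as Pw1. pose proof (Cmod_ge_0 (arc_factor k s)).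
  pose proof PI_RGT_0 as HPI.
  assert (X1 : exp (2 * PI * M / (y * (1 + s * s))) <= exp (2 * PI * M / y)).
  { apply exp_le. unfold Rdiv. apply Rmult_le_compat_l; [apply Rmult_le_pos; [apply Rmult_le_pos|]; lra|]. apply Rinv_le_contravar; [assumption|].
    rewrite <- (Rmult_1_r y) at 1. apply Rmult_le_compat_l; [lra|].
    pose proof (Rle_0_sqr s) as Q'; unfold Rsqr in Q'; lra. }
  assert (X2 : exp (- (del * Im w)) <= exp (- (del / (2 * (c * c)) / t))).
  { apply exp_le. apply Ropp_le_contravar.
    replace (del / (2 * (c * c)) / t) with (del * / (2 * (c * c) * t)) by (field; split; lra).
    apply Rmult_le_compat_l; lra. }
  unfold Rminus. rewrite exp_plus.
  set (E1 := exp (2 * PI * M / (y * (1 + s * s)))) in *. set (E2 := exp (2 * PI * M / y)) in *.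
  set (E3 := exp (- (del * Im w))) in *. set (E4 := exp (- (del / (2 * (c * c)) / t))) in *.
  assert (0 < E1) by apply exp_pos. assert (0 < E3) by apply exp_pos.
  set (R1 := Rpower c (- k)) in *. set (R2 := Rpower y (- k)) in *.
  apply Rle_trans with (R1 * R2 * 1 * E2 * (K * E4)); [|right; ring].
  apply Rmult_le_compat.
  - repeat apply Rmult_le_pos; lra.
  - apply Cmod_ge_0.
  - apply Rmult_le_compat; try lra; [repeat apply Rmult_le_pos; lra|].
    apply Rmult_le_compat_l; [apply Rmult_le_pos|]; lra.
  - eapply Rle_trans; [exact H|]. apply Rmult_le_compat_l; lra.
Qed.

Lemma abs_f_slash (k : R) (f : C -> C) (g : SL2Z) (z : C) : 0 < Im z ->
  Cmod (f z) = Rpower (Cmod (denom g z)) (- k) * Cmod (slash k f (SL2Z_inv g) (moebius g z)).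
Proof.
  intro Hz. rewrite Cmod_slash, denom_inv_l, moebius_inv_l by assumption.
  pose proof (Cmod_denom_pos g z Hz) as P. rewrite Cmod_inv by (apply denom_neq_0; assumption).
  rewrite <- Rmult_assoc, Rpower_mult_distr by (try apply Rinv_0_lt_compat; assumption).
  rewrite Rinv_r by lra. unfold Rpower. rewrite ln_1, Rmult_0_r, exp_0. ring.
Qed.

(** As [0 <= k] and [c >= 1], one has [|c z + d|^(-k) <= y^(-k)]. *)
Lemma off_arcs (k : R) (f : C -> C) (M M' K eta N : R) (xs : list R) :
  0 <= k -> 0 <= M' < M -> 0 <= K -> 0 < eta ->
  (forall g, (0 < mc g)%Z -> exists nu,
     0 <= nu /\ (forall w, 1 / 2 <= Im w ->
       Cmod (slash k f (SL2Z_inv g) w) <= K * exp (2 * PI * nu * Im w)) /\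
     (nu / (IZR (mc g) * IZR (mc g)) <= M' \/
      nu / (IZR (mc g) * IZR (mc g)) = M /\
      (In (pole_point g) xs \/ pole_point g <= - (2 * eta) \/ N <= pole_point g))) ->
  exists kap t0, 0 < kap /\ 0 < t0 <= 1 /\ forall t x, 0 < t <= t0 ->
    - eta <= x <= N - eta -> (forall X, In X xs -> t ^ 2 * t ^ 5 <= Rabs (x - X)) ->
    Cmod (f (x, t ^ 5)) <= K * Rpower (t ^ 5) (- k) * exp (2 * PI * M / t ^ 5 - kap / t).
Proof.
  intros Hk HM HK Heta H.
  pose proof PI_RGT_0 as HPI.
  (* The exponent loses at least [2 * PI * (M - M') / y] at a non-dominant cusp and [PI * M / t] at
     a dominant one that is not too close. The bound 1/4 ensures [y < 1 / 2], as [reduction]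
     requires. *)
  exists (Rmin (PI * M) (2 * PI * (M - M'))), (Rmin (1 / 4) eta).
  pose proof (Rmin_l (PI * M) (2 * PI * (M - M'))) as K1.
  pose proof (Rmin_r (PI * M) (2 * PI * (M - M'))) as K2.
  set (kap := Rmin (PI * M) (2 * PI * (M - M'))) in *.
  pose proof (Rmin_l (1 / 4) eta). pose proof (Rmin_r (1 / 4) eta).
  split. { apply Rmin_pos; [apply Rmult_lt_0_compat; lra|apply Rmult_lt_0_compat; lra]. }
  assert (0 < Rmin (1 / 4) eta) by (apply Rmin_pos; lra).
  split; [split; lra|].
  intros t x Ht Hx Hfar.
  destruct (pow5_le t ltac:(lra)) as [Py Hyt]. pose proof (inv_pow5_ge t ltac:(lra)) as Hinv.
  set (y := t ^ 5) in *.
  set (z := ((x, y) : C)). assert (Iz : Im z = y) by reflexivity.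
  destruct (reduction z) as [g [Hc Hw]]; [rewrite Iz; lra|].
  assert (Pz : 0 < Im z) by lra.
  destruct (H g Hc) as (nu & Hnu & HB & Hcase). specialize (HB _ Hw).
  rewrite (abs_f_slash k f g z Pz).
  assert (Pc : 1 <= IZR (mc g)) by (apply IZR_le; lia).
  set (c := IZR (mc g)) in *.
  set (D := Cmod (denom g z)).
  assert (ED : denom g z = (c * (z - pole_point g))%C).
  { unfold denom, pole_point. fold c. rewrite RtoC_div, RtoC_opp by lra. field. intro Q; injection Q; lra. }
  assert (D2 : D * D = c * c * ((x - pole_point g) * (x - pole_point g) + y * y)).
  { unfold D. rewrite Cmod_sqr, ED. reim. unfold z. reim. ring. }
  assert (PD : 0 < D) by (apply Cmod_denom_pos; assumption).
  assert (Dy : y <= D).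
  { apply Rsqr_incr_0_var; [|lra]. unfold Rsqr. rewrite D2.
    pose proof (Rle_0_sqr (x - pole_point g)) as Q; unfold Rsqr in Q.
    apply Rle_trans with (1 * (y * y)); [lra|].
    apply Rmult_le_compat; nra. }
  rewrite (Rmult_comm K), Rmult_assoc.
  apply Rmult_le_compat; [left; apply Rpower_pos|apply Cmod_ge_0|apply Rpower_anti; assumption|].
  eapply Rle_trans; [exact HB|]. apply Rmult_le_compat_l; [assumption|]. apply exp_le.
  rewrite Im_moebius by assumption. fold D. rewrite D2, Iz.
  set (q := (x - pole_point g) * (x - pole_point g)).
  assert (Pq : 0 <= q) by (apply Rle_0_sqr).
  assert (Pyy : 0 < y * y) by nra.
  replace (2 * PI * nu * (y / (c * c * (q + y * y)))) with (2 * PI * (nu / (c * c)) * (y / (q + y * y)))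
    by (field; split; lra).
  set (v := nu / (c * c)) in *.
  assert (Pv : 0 <= v) by (unfold v, Rdiv; apply Rmult_le_pos; [assumption|left; apply Rinv_0_lt_compat; nra]).
  assert (Hiy : 0 < / y) by (apply Rinv_0_lt_compat; assumption).
  assert (Hit : 0 < / t) by (apply Rinv_0_lt_compat; lra).
  destruct Hcase as [Hv|[Hv Hp]].
  - assert (F1 : y / (q + y * y) <= / y).
    { replace (/ y) with (y / (y * y)) by (field; lra). unfold Rdiv.
      apply Rmult_le_compat_l; [lra|]. apply Rinv_le_contravar; lra. }
    assert (F0 : 0 <= y / (q + y * y)).
    { apply Rmult_le_pos; [lra|left; apply Rinv_0_lt_compat; lra]. }
    assert (F2 : v * (y / (q + y * y)) <= M' * / y) by (apply Rmult_le_compat; lra).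
    assert (F3 : kap * / t <= 2 * PI * (M - M') * / y).
    { apply Rmult_le_compat; try lra. unfold kap. apply Rmin_glb; apply Rmult_le_pos; lra. }
    replace (2 * PI * v * (y / (q + y * y))) with (2 * PI * (v * (y / (q + y * y)))) by ring.
    assert (2 * PI * (v * (y / (q + y * y))) <= 2 * PI * (M' * / y)) by (apply Rmult_le_compat_l; lra).
    unfold Rdiv. lra.
  (* A dominant cusp outside [xs] is at distance at least [eta] from [x], and
     [t^2 y <= t <= eta]. *)
  - assert (Hd : t ^ 2 * y <= Rabs (x - pole_point g)).
    { assert (Hty : t ^ 2 * y <= eta).
      { apply Rle_trans with (1 * t); [|lra]. apply Rmult_le_compat; try lra.
        - apply pow_le; lra.
        - rewrite <- (pow1 2). apply pow_incr. lra. }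
      destruct Hp as [Hp|[Hp|Hp]]; [apply Hfar, Hp| |].
      - rewrite Rabs_right; lra.
      - rewrite Rabs_left1; lra. }
    assert (Hq : t ^ 4 * (y * y) <= q).
    { unfold q. rewrite <- (Rabs_right ((x - pole_point g) * (x - pole_point g))) by (apply Rle_ge, Rle_0_sqr).
      rewrite Rabs_mult. replace (t ^ 4 * (y * y)) with ((t ^ 2 * y) * (t ^ 2 * y)) by ring.
      assert (0 <= t ^ 2 * y) by (apply Rmult_le_pos; [apply pow_le|]; lra).
      apply Rmult_le_compat; assumption. }
    rewrite Hv.
    assert (Ht4 : 0 < t ^ 4 <= 1).
    { split; [apply pow_lt; lra|]. rewrite <- (pow1 4). apply pow_incr. lra. }
    (* This is [1 / (1 + u) <= 1 - u / 2] at [u = t^4]; relative to [1 / y = 1 / t^5], the loss is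
       of order [1 / t]. *)
    assert (F1 : y / (q + y * y) <= / y * (1 - t ^ 4 / 2)).
    { apply Rle_trans with (y / ((1 + t ^ 4) * (y * y))).
      - unfold Rdiv. apply Rmult_le_compat_l; [lra|]. apply Rinv_le_contravar; [|lra].
        apply Rmult_lt_0_compat; lra.
      - replace (y / ((1 + t ^ 4) * (y * y))) with (/ y * / (1 + t ^ 4)) by (field; lra).
        apply Rmult_le_compat_l; [lra|].
        apply Rmult_le_reg_r with (1 + t ^ 4); [lra|]. rewrite Rinv_l by lra. nra. }
    assert (F2 : 2 * PI * M * (y / (q + y * y)) <= 2 * PI * M * (/ y * (1 - t ^ 4 / 2))).
    { apply Rmult_le_compat_l; [|assumption]. apply Rmult_le_pos; [|lra]. lra. }
    assert (F3 : kap * / t <= PI * M * / t) by (apply Rmult_le_compat_r; lra).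
    assert (F4 : / y * t ^ 4 = / t) by (unfold y; field; lra).
    replace (2 * PI * M * (/ y * (1 - t ^ 4 / 2))) with (2 * PI * M * / y - PI * M * (/ y * t ^ 4)) in F2 by (field; lra).
    rewrite F4 in F2. unfold Rdiv. lra.
Qed.

(** The integrand of the coefficient on an arc around [x_j], in the variable [s = (x - x_j) / y],
    stripped of [beta_j], [y^(-k)] and [ee (- lam * x_j)]; what remains is common to all dominant
    cusps. *)
Definition arc (k M t s : R) : C :=
  (arc_factor k s * ee (M / (RtoC (t ^ 5) * (s + Ci))) * ee (- RtoC (M / (t ^ 5 * t ^ 5)) * (RtoC (t ^ 5) * (s + Ci))))%C.

Definition arc_mod (k M t s : R) : R :=
  exp (- (k / 2 * ln (1 + s * s)) + 2 * PI * M / t ^ 5 * (2 - s * s / (1 + s * s))).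
Definition arc_ang (k M t s : R) : R := k * atan s - 2 * PI * M / t ^ 5 * (s * s * s / (1 + s * s)).

(** Saddle point identity: [i / (s + i) - i (s + i) = 2 - s^2 / (1 - i s)], whose real part is
    [2 - s^2 / (1 + s^2)] and imaginary part [- s^3 / (1 + s^2)]. *)
Lemma arc_formula (k M t s : R) : 0 < t ->
  arc k M t s = (Cexp (0, - (k * (PI / 2)))%R *
    (arc_mod k M t s * cos (arc_ang k M t s), arc_mod k M t s * sin (arc_ang k M t s))%R)%C.
Proof.
  intro Ht. pose proof (shift_Ci_neq_0 s) as NS.
  assert (Py : 0 < t ^ 5) by (apply pow_lt; assumption). set (y := t ^ 5) in *.
  assert (Ny : RtoC y <> 0) by (intro Q; injection Q; lra).
  assert (Ps : 0 < 1 + s * s) by (pose proof (Rle_0_sqr s) as Q; unfold Rsqr in Q; lra).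
  unfold arc. fold y. rewrite arc_factor_formula. unfold ee. rewrite <- !Cexp_plus.
  change ((arc_mod k M t s * cos (arc_ang k M t s))%R, (arc_mod k M t s * sin (arc_ang k M t s))%R)
    with (Cexp (- (k / 2 * ln (1 + s * s)) + 2 * PI * M / t ^ 5 * (2 - s * s / (1 + s * s)), arc_ang k M t s)%R).
  rewrite <- Cexp_plus. f_equal. fold y.
  replace (M / (y * (s + Ci)))%C with (RtoC (M / y) * / (s + Ci))%C
    by (rewrite RtoC_div by lra; field; split; assumption).
  replace (- RtoC (M / (y * y)) * (y * (s + Ci)))%C with (- (RtoC (M / y) * (s + Ci)))%C.
  2:{ rewrite !RtoC_div, RtoC_mult by nra. field. assumption. }
  apply C_ext; reim; rewrite ?Re_Cinv, ?Im_Cinv by assumption; rewrite ?Cmod_shift_Ci;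
    reim; unfold arc_ang; fold y; field; lra.
Qed.

Lemma continuous_of_ex_derive (f : R -> R) (x : R) : ex_derive f x -> continuous f x.
Proof. intro H. exact (ex_derive_continuous (K := R_AbsRing) (V := R_NormedModule) f x H). Qed.

Lemma abs_atan_le (s : R) : Rabs (atan s) <= Rabs s.
Proof.
  destruct (MVT_gen atan 0 s (fun x => / (1 + x * x))) as [c [_ E]].
  - intros x _. auto_derive; [trivial|]. unfold Rsqr. field. nra.
  - intros x _. apply derivable_continuous_pt, derivable_pt_atan.
  - rewrite atan_0, !Rminus_0_r in E. rewrite E, Rabs_mult.
    assert (0 < / (1 + c * c) <= 1).
    { split; [apply Rinv_0_lt_compat; nra|]. rewrite <- Rinv_1 at 2. apply Rinv_le_contravar; nra. }
    rewrite (Rabs_right (/ _)) by lra. pose proof (Rabs_pos s). nra.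
Qed.

(** For [|s| <= t^2] the phase is at most [k t^2 + 2 pi M t], hence small; for [|s| <= t^3] the
    Gaussian factor is bounded below. *)
Lemma arc_integral (k M : R) : 0 <= k -> 0 < M ->
  exists c t0, 0 < c /\ 0 < t0 <= 1 /\ forall t, 0 < t <= t0 -> exists I,
    is_CInt (fun s => arc k M t s) (- t ^ 2) (t ^ 2) I /\
    c * t ^ 3 * exp (2 * (2 * PI * M / t ^ 5)) <= Cmod I.
Proof.
  intros Hk HM. pose proof PI_RGT_0 as HPI.
  set (m := 2 * PI * M). assert (Pm : 0 < m) by (unfold m; apply Rmult_lt_0_compat; lra).
  (* For [|s| <= t^3] the power of [1 + s^2] is at least [2^(-k/2)], and the Gaussian factor at
     least [exp (-1)], because [m * s^2 / t^5 <= m * t <= 1]. The bound on [t] keeps the phase at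
     most 1, so that its cosine is at least 1/2; this 1/2 cancels against the length [2 t^3]. *)
  exists (exp (- (k / 2 * ln 2) - 1)), (/ (1 + k + m)).
  split; [apply exp_pos|].
  assert (Pi : 0 < / (1 + k + m)) by (apply Rinv_0_lt_compat; lra).
  split; [split; [assumption|rewrite <- Rinv_1 at 2; apply Rinv_le_contravar; lra]|].
  intros t [Ht0 Ht].
  assert (Ht' : t * (1 + k + m) <= 1).
  { apply Rmult_le_reg_r with (/ (1 + k + m)); [assumption|]. rewrite Rmult_assoc, Rinv_r by lra. lra. }
  assert (Pkt : 0 <= t * k) by (apply Rmult_le_pos; lra).
  assert (Pmt : 0 < t * m) by (apply Rmult_lt_0_compat; lra).
  assert (Ht1 : t <= 1) by lra.
  assert (Hmt : t * m <= 1) by lra. assert (Hkm : t * k + t * m <= 1) by lra.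
  assert (Pt2 : 0 < t ^ 2) by (apply pow_lt; assumption).
  assert (Pt3 : 0 < t ^ 3) by (apply pow_lt; assumption).
  assert (Pt5 : 0 < t ^ 5) by (apply pow_lt; assumption).
  assert (Ht23 : t ^ 3 <= t ^ 2) by (simpl; nra).
  assert (Ht2t : t ^ 2 <= t) by (simpl; nra).
  fold m. set (A := m / t ^ 5).
  assert (PA : 0 < A) by (apply Rdiv_lt_0_compat; assumption).
  assert (EA : A * t ^ 6 = t * m) by (unfold A; field; lra).
  set (gc := fun s => arc_mod k M t s * cos (arc_ang k M t s)).
  set (gs := fun s => arc_mod k M t s * sin (arc_ang k M t s)).
  assert (Pss : forall s, 0 < 1 + s * s) by (intro s; pose proof (Rle_0_sqr s) as Q; unfold Rsqr in Q; lra).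
  assert (Cc : forall s, continuous gc s).
  { intro s. apply continuous_of_ex_derive. unfold gc, arc_mod, arc_ang. specialize (Pss s).
    auto_derive. repeat split; try lra; trivial. }
  assert (Cs : forall s, continuous gs s).
  { intro s. apply continuous_of_ex_derive. unfold gs, arc_mod, arc_ang. specialize (Pss s).
    auto_derive. repeat split; try lra; trivial. }
  assert (Ec : forall a b, ex_RInt gc a b) by (intros; apply (ex_RInt_continuous (V := R_CompleteNormedModule)); intros; apply Cc).
  assert (Es : forall a b, ex_RInt gs a b) by (intros; apply (ex_RInt_continuous (V := R_CompleteNormedModule)); intros; apply Cs).
  set (u0 := Cexp (0, - (k * (PI / 2)))).
  set (J := ((RInt gc (- t ^ 2) (t ^ 2), RInt gs (- t ^ 2) (t ^ 2)) : C)).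
  exists (u0 * J)%C. split.
  - apply (is_CInt_ext (fun s => u0 * (gc s, gs s)%R)%C); [lra| |apply is_CInt_scal].
    + intros s _. rewrite (arc_formula k M t s Ht0). reflexivity.
    + apply is_CInt_components. split.
      * apply (RInt_correct (V := R_CompleteNormedModule)). apply Ec.
      * apply (RInt_correct (V := R_CompleteNormedModule)). apply Es.
  - rewrite Cmod_mult. unfold u0. rewrite Cmod_Cexp, Re_pair, exp_0, Rmult_1_l.
    (* Up to the constant [u0] the real part suffices: its integrand is non-negative on the whole
       arc, so the middle part [|s| <= t^3] bounds it from below. *)
    eapply Rle_trans; [|apply re_le_Cmod]. eapply Rle_trans; [|apply Rle_abs].
    unfold J. rewrite Re_pair.
    assert (Hcos : forall s, Rabs s <= t ^ 2 -> 1 / 2 <= cos (arc_ang k M t s)).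
    { intros s Hs.
      assert (Ha : Rabs (arc_ang k M t s) <= 1).
      { unfold arc_ang. fold m. fold A. eapply Rle_trans; [apply Rabs_triang|].
        rewrite Rabs_Ropp, !Rabs_mult. rewrite (Rabs_right k), (Rabs_right A) by lra.
        apply Rle_trans with (t * k + t * m); [|assumption]. apply Rplus_le_compat.
        - rewrite (Rmult_comm t). apply Rmult_le_compat_l; [assumption|].
          eapply Rle_trans; [apply abs_atan_le|]. lra.
        - rewrite <- EA. apply Rmult_le_compat_l; [lra|].
          unfold Rdiv. rewrite !Rabs_mult. rewrite (Rabs_right (/ _)) by (apply Rle_ge; left; apply Rinv_0_lt_compat, Pss).
          pose proof (Rabs_pos s).
          apply Rle_trans with (t ^ 2 * t ^ 2 * t ^ 2 * 1); [|right; ring].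
          apply Rmult_le_compat.
          + repeat apply Rmult_le_pos; assumption.
          + left; apply Rinv_0_lt_compat, Pss.
          + apply Rmult_le_compat; try assumption; [apply Rmult_le_pos; assumption|].
            apply Rmult_le_compat; assumption.
          + rewrite <- Rinv_1 at 2. apply Rinv_le_contravar; [lra|].
            pose proof (Rle_0_sqr s) as Q; unfold Rsqr in Q; lra. }
      pose proof (abs_cos_minus (arc_ang k M t s)) as Q. apply Rabs_le_between in Q.
      set (th := arc_ang k M t s) in *.
      assert (th * th <= 1).
      { apply Rabs_le_between in Ha. nra. }
      lra. }
    assert (Hpos : forall s, Rabs s <= t ^ 2 -> 0 <= gc s).
    { intros s Hs. apply Rmult_le_pos; [left; apply exp_pos|]. specialize (Hcos s Hs). lra. }
    set (low := exp (- (k / 2 * ln 2) - 1) * exp (2 * A) / 2).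
    assert (Hlow : forall s, Rabs s <= t ^ 3 -> low <= gc s).
    { intros s Hs. unfold low, gc. unfold Rdiv at 2.
      apply Rmult_le_compat; [rewrite <- exp_plus; left; apply exp_pos|lra| |].
      - rewrite <- exp_plus. unfold arc_mod. fold m. fold A. apply exp_le.
        assert (Hss : s * s <= t ^ 6).
        { rewrite <- (Rabs_right (s * s)) by (apply Rle_ge, Rle_0_sqr). rewrite Rabs_mult.
          replace (t ^ 6) with (t ^ 3 * t ^ 3) by ring. pose proof (Rabs_pos s).
          apply Rmult_le_compat; assumption. }
        assert (Ht6 : t ^ 6 <= 1) by (rewrite <- (pow1 6); apply pow_incr; lra).
        pose proof (Rle_0_sqr s) as Q; unfold Rsqr in Q.
        assert (L1 : ln (1 + s * s) <= ln 2).
        { destruct (Req_dec (s * s) 1) as [->|Ne]; [right; f_equal; lra|]. left; apply ln_increasing; lra. }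
        assert (L2 : k / 2 * ln (1 + s * s) <= k / 2 * ln 2) by (apply Rmult_le_compat_l; lra).
        assert (L3 : s * s / (1 + s * s) <= t ^ 6).
        { apply Rle_trans with (s * s * 1); [|lra]. unfold Rdiv. apply Rmult_le_compat_l; [assumption|].
          rewrite <- Rinv_1 at 2. apply Rinv_le_contravar; lra. }
        assert (L4 : A * (s * s / (1 + s * s)) <= A * t ^ 6) by (apply Rmult_le_compat_l; lra).
        lra.
      - specialize (Hcos s ltac:(lra)). lra. }
    assert (Split : RInt gc (- t ^ 2) (t ^ 2) = RInt gc (- t ^ 2) (- t ^ 3) + RInt gc (- t ^ 3) (t ^ 3) + RInt gc (t ^ 3) (t ^ 2)).
    { rewrite <- (RInt_Chasles gc (- t ^ 2) (t ^ 3) (t ^ 2)) by apply Ec.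
      rewrite <- (RInt_Chasles gc (- t ^ 2) (- t ^ 3) (t ^ 3)) by apply Ec. reflexivity. }
    rewrite Split.
    assert (I1 : 0 <= RInt gc (- t ^ 2) (- t ^ 3)).
    { apply RInt_ge_0; [lra|apply Ec|]. intros s Hs. apply Hpos. apply Rabs_le. lra. }
    assert (I3 : 0 <= RInt gc (t ^ 3) (t ^ 2)).
    { apply RInt_ge_0; [lra|apply Ec|]. intros s Hs. apply Hpos. apply Rabs_le. lra. }
    assert (I2 : RInt (fun _ => low) (- t ^ 3) (t ^ 3) <= RInt gc (- t ^ 3) (t ^ 3)).
    { apply RInt_le; [lra|apply ex_RInt_const|apply Ec|]. intros s Hs. apply Hlow. apply Rabs_le. lra. }
    rewrite RInt_const in I2. unfold scal in I2; simpl in I2. unfold mult in I2; simpl in I2.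
    unfold low in I2.
    apply Rle_trans with ((t ^ 3 - - t ^ 3) * (exp (- (k / 2 * ln 2) - 1) * exp (2 * A) / 2)); [right; field|].
    simpl in *. lra.
Qed.

(** * Linear independence of geometric sequences *)

Lemma lsum_cons (x : C) (l : list C) : lsum (x :: l) = (x + lsum l)%C.
Proof. reflexivity. Qed.

(** Subtracting [q1] times the relation at [n] from the relation at [n + 1] removes the first term
    and multiplies the others by [q - q1], which is non-zero as the ratios are distinct. *)
Lemma geometric_independent (l : list (C * C)) : NoDup (map snd l) ->
  (forall n, lsum (map (fun p => fst p * snd p ^ n)%C l) = 0) -> forall p, In p l -> fst p = 0.
Proof.
  remember (length l) as len eqn:E. revert l E.
  induction len as [|len IH]; intros l E Hnd H p Hp.
  - destruct l; [destruct Hp|discriminate].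
  - destruct l as [|[b1 q1] l]; [discriminate|]. simpl in E. injection E as E.
    simpl in Hnd. apply NoDup_cons_iff in Hnd. destruct Hnd as [Hn1 Hn2].
    set (T := fun p : C * C => ((fst p * (snd p - q1))%C, snd p)).
    assert (H' : forall p, In p l -> fst p = 0).
    { assert (K : forall p, In p (map T l) -> fst p = 0).
      { apply IH.
        - rewrite length_map. exact E.
        - rewrite map_map. exact Hn2.
        - intro n. rewrite map_map.
          pose proof (H n) as H1. pose proof (H (S n)) as H2.
          simpl in H1, H2. unfold lsum in H1, H2; simpl in H1, H2.
          transitivity (lsum (map (fun p => fst p * snd p ^ S n)%C l) - q1 * lsum (map (fun p => fst p * snd p ^ n)%C l))%C.
          + clear. induction l as [|p l IHl]; [unfold lsum; simpl; ring|].
            cbn [map]. rewrite !lsum_cons, IHl. simpl. ring.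
          + set (A := fold_right Cplus (RtoC 0) (map (fun p => (fst p * snd p ^ n)%C) l)) in *.
            set (B := fold_right Cplus (RtoC 0) (map (fun p => (fst p * (snd p * snd p ^ n))%C) l)) in *.
            change (B - q1 * A = 0)%C.
            replace B with (- (b1 * (q1 * q1 ^ n)) + (b1 * (q1 * q1 ^ n) + B))%C by ring. rewrite H2.
            replace A with (- (b1 * q1 ^ n) + (b1 * q1 ^ n + A))%C by ring. rewrite H1. ring. }
      intros p' Hp'. specialize (K (T p') (in_map T l p' Hp')). simpl in K.
      assert (N : (snd p' - q1)%C <> 0).
      { intro Q. apply Hn1. replace q1 with (snd p'); [apply in_map, Hp'|].
        replace (snd p') with ((snd p' - q1) + q1)%C by ring. rewrite Q. ring. }
      replace (fst p') with (fst p' * (snd p' - q1) / (snd p' - q1))%C by (field; exact N).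
      rewrite K. field; exact N. }
    destruct Hp as [<-|Hp]; [|apply H', Hp]. simpl.
    specialize (H 0%nat). simpl in H. unfold lsum in H; simpl in H.
    fold (lsum (map (fun p : C * C => (fst p * 1)%C) l)) in H.
    rewrite lsum_zero in H.
    + replace b1 with (b1 * 1 + 0)%C by ring. exact H.
    + intros x Hx. apply in_map_iff in Hx. destruct Hx as [p' [<- Hp']]. rewrite (H' p' Hp'). ring.
Qed.

(** * Comparison of the coefficient with the contributions of the arcs *)

Lemma list_gap (l : list R) :
  exists d, 0 < d /\ forall x y, In x l -> In y l -> x <> y -> d <= Rabs (x - y).
Proof.
  induction l as [|a l [d [Hd H]]].
  - exists 1. split; [lra|]. intros x y [].
  - assert (K : exists e, 0 < e /\ forall y, In y l -> a <> y -> e <= Rabs (a - y)).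
    { clear. induction l as [|b l [e [He H]]]; [exists 1; split; [lra|intros y []]|].
      destruct (Req_dec a b) as [->|N].
      - exists e. split; [assumption|]. intros y [<-|Hy] Hne; [contradiction|auto].
      - exists (Rmin e (Rabs (a - b))). split; [apply Rmin_pos; [assumption|apply Rabs_pos_lt; lra]|].
        intros y [<-|Hy] Hne; [apply Rmin_r|]. eapply Rle_trans; [apply Rmin_l|auto]. }
    destruct K as [e [He K]].
    exists (Rmin d e). split; [apply Rmin_pos; assumption|].
    intros x y [<-|Hx] [<-|Hy] Hne; [contradiction| | |].
    + eapply Rle_trans; [apply Rmin_r|auto].
    + rewrite Rabs_minus_sym. eapply Rle_trans; [apply Rmin_r|auto].
    + eapply Rle_trans; [apply Rmin_l|auto].
Qed.

Lemma is_CInt_zero (a b : R) : is_CInt (fun _ => RtoC 0) a b 0.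
Proof.
  pose proof (is_CInt_const a b 0) as H.
  replace ((b - a) * 0)%C with (RtoC 0) in H by ring. exact H.
Qed.

(** Cutting off by zero lets all arcs be subtracted under one integral over the full period, without
    subdividing it at their ends. *)
Definition restrict_to (X w : R) (G : R -> C) (x : R) : C := if Rle_dec (Rabs (x - X)) w then G x else 0.

Lemma is_CInt_restrict_to (G : R -> C) (X w p q : R) (v : C) : 0 <= w -> p <= X - w -> X + w <= q ->
  is_CInt G (X - w) (X + w) v -> is_CInt (restrict_to X w G) p q v.
Proof.
  intros Hw Hp Hq H.
  assert (Z : forall a b, a <= b -> (forall x, a < x < b -> w < Rabs (x - X)) -> is_CInt (restrict_to X w G) a b 0).
  { intros a b Hab Hx. apply (is_CInt_ext (fun _ => RtoC 0)); [assumption| |].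
    - intros x Hxx. unfold restrict_to. specialize (Hx x Hxx). destruct (Rle_dec _ _); [lra|reflexivity].
    - apply is_CInt_zero. }
  replace v with (0 + v + 0)%C by ring.
  apply is_CInt_Chasles with (X + w); [apply is_CInt_Chasles with (X - w)|].
  - apply Z; [assumption|]. intros x Hx. rewrite Rabs_left; lra.
  - apply (is_CInt_ext G); [lra| |exact H]. intros x Hx. unfold restrict_to.
    destruct (Rle_dec _ _) as [L|L]; [reflexivity|]. exfalso; apply L, Rabs_le; lra.
  - apply Z; [assumption|]. intros x Hx. rewrite Rabs_right; lra.
Qed.

Lemma is_CInt_lsum {A : Type} (l : list A) (F : A -> R -> C) (v : A -> C) (p q : R) : p <= q ->
  (forall a, In a l -> is_CInt (F a) p q (v a)) ->
  is_CInt (fun x => lsum (map (fun a => F a x) l)) p q (lsum (map v l)).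
Proof.
  intros Hpq. induction l as [|a l IH]; intro H.
  - apply is_CInt_zero.
  - unfold lsum in *; simpl. apply is_CInt_plus.
    + apply H. left; reflexivity.
    + apply IH. intros; apply H; right; assumption.
Qed.

Lemma lsum_restrict_far {A : Type} (l : list (R * A)) (w x : R) (G : R * A -> R -> C) :
  (forall p, In p l -> w < Rabs (x - fst p)) -> lsum (map (fun p => restrict_to (fst p) w (G p) x) l) = 0.
Proof.
  intro H. apply lsum_zero. intros z Hz. apply in_map_iff in Hz. destruct Hz as [p [<- Hp]].
  unfold restrict_to. specialize (H p Hp). destruct (Rle_dec _ _); [lra|reflexivity].
Qed.

(** As [2 * w < d], the arcs are disjoint, and a point of one sees no other. *)
Lemma lsum_restrict_near {A : Type} (l : list (R * A)) (w d x : R) (G : R * A -> R -> C) (p0 : R * A) :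
  NoDup (map fst l) ->
  (forall a b, In a (map fst l) -> In b (map fst l) -> a <> b -> d <= Rabs (a - b)) -> 2 * w < d ->
  In p0 l -> Rabs (x - fst p0) <= w ->
  lsum (map (fun p => restrict_to (fst p) w (G p) x) l) = G p0 x.
Proof.
  intros Hnd Hgap Hw Hin Hx. induction l as [|p l IH]; [destruct Hin|].
  simpl in Hnd. apply NoDup_cons_iff in Hnd. destruct Hnd as [N1 N2].
  change (lsum (map (fun p => restrict_to (fst p) w (G p) x) (p :: l)))
    with (restrict_to (fst p) w (G p) x + lsum (map (fun p => restrict_to (fst p) w (G p) x) l))%C.
  assert (Far : forall a b, In a (map fst (p :: l)) -> In b (map fst (p :: l)) -> a <> b ->
     Rabs (x - a) <= w -> w < Rabs (x - b)).
  { intros a b Ha Hb Hne Hxa. specialize (Hgap a b Ha Hb Hne).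
    replace (a - b) with (- (x - a) + (x - b)) in Hgap by ring.
    pose proof (Rabs_triang (- (x - a)) (x - b)) as T. rewrite Rabs_Ropp in T. lra. }
  destruct Hin as [->|Hin].
  - rewrite lsum_restrict_far.
    + unfold restrict_to. destruct (Rle_dec _ _); [ring|contradiction].
    + intros p' Hp'. apply (Far (fst p0)); auto; [left; reflexivity|right; apply in_map, Hp'|].
      intro Q. apply N1. rewrite Q. apply in_map, Hp'.
  - rewrite IH; auto.
    + unfold restrict_to. destruct (Rle_dec (Rabs (x - fst p)) w) as [L|L]; [|ring].
      exfalso. assert (w < Rabs (x - fst p)); [|lra].
      apply (Far (fst p0)); auto; [right; apply in_map, Hin|left; reflexivity|].
      intro Q. apply N1. rewrite <- Q. apply in_map, Hin.
    + intros a b Ha Hb. apply Hgap; right; assumption.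
Qed.

Lemma approximates_mono (k : R) (f : C -> C) (M K kap t0 K' kap' t0' X : R) (beta : C) :
  approximates k f M K kap t0 X beta -> 0 <= K -> K <= K' -> kap' <= kap -> t0' <= t0 ->
  approximates k f M K' kap' t0' X beta.
Proof.
  intros H P0 P1 P2 P3 t s Ht Hs. eapply Rle_trans; [apply H; [lra|assumption]|].
  pose proof (Rpower_pos (t ^ 5) (- k)).
  apply Rmult_le_compat.
  - apply Rmult_le_pos; lra.
  - left; apply exp_pos.
  - apply Rmult_le_compat_r; lra.
  - apply exp_le. unfold Rdiv. assert (0 < / t) by (apply Rinv_0_lt_compat; lra).
    assert (kap' * / t <= kap * / t) by (apply Rmult_le_compat_r; lra). lra.
Qed.

(** The dominant cusps being finitely many, the largest [K] and the smallest [kap] and [t0] serve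
    them all; [L] attaches its [beta] to each cusp. *)
Lemma uniform_approx (k : R) (f : C -> C) (M : R) (xs : list R) : 0 <= k -> 0 < M ->
  (forall x, In x xs -> exists g nu, dominant_at k f M g nu /\ x = pole_point g) ->
  exists (L : list (R * C)) (K kap t0 : R), map fst L = xs /\ 0 <= K /\ 0 < kap /\ 0 < t0 <= 1 /\
    forall p, In p L -> snd p <> 0 /\ approximates k f M K kap t0 (fst p) (snd p).
Proof.
  intros Hk HM. induction xs as [|x xs IH]; intro H.
  - exists nil, 0, 1, 1. repeat split; try lra; destruct H0.
  - destruct IH as (L & K & kap & t0 & E & HK & Hkap & Ht0 & HL); [intros; apply H; right; assumption|].
    destruct (H x (or_introl eq_refl)) as (g & nu & Hm & Ex).
    destruct (local_approx k f M g nu Hk HM Hm) as (b & K1 & kap1 & t1 & Hb & HK1 & Hkap1 & Ht1 & Happ).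
    rewrite <- Ex in Happ.
    exists ((x, b) :: L), (Rmax K K1), (Rmin kap kap1), (Rmin t0 t1).
    pose proof (Rmax_l K K1). pose proof (Rmax_r K K1). pose proof (Rmin_l kap kap1). pose proof (Rmin_r kap kap1).
    pose proof (Rmin_l t0 t1). pose proof (Rmin_r t0 t1).
    split; [simpl; rewrite E; reflexivity|]. split; [lra|]. split; [apply Rmin_pos; assumption|].
    split; [split; [apply Rmin_pos; lra|lra]|].
    intros p [<-|Hp].
    + split; [assumption|]. simpl. eapply approximates_mono; eassumption.
    + destruct (HL p Hp) as [P1 P2]. split; [assumption|]. eapply approximates_mono; eassumption.
Qed.

(** The arcs have half-width [t^2 y]: wide enough for the complement to lose a factor
    [exp (- kap / t)], and narrow enough for the phase on them to be small. *)
Lemma coefficient_estimate (k : R) (f : C -> C) (M K kap t0 eta N : R) (L : list (R * C)) (d t : R) (I v : C) :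
  0 < M -> 0 <= K -> 0 < t <= t0 -> t0 <= 1 -> 0 < N ->
  NoDup (map fst L) ->
  (forall a b, In a (map fst L) -> In b (map fst L) -> a <> b -> d <= Rabs (a - b)) ->
  2 * t < d -> t <= eta ->
  (forall x, In x (map fst L) -> 0 <= x <= N - 2 * eta) ->
  (forall p, In p L -> approximates k f M K kap t0 (fst p) (snd p)) ->
  (forall x, - eta <= x <= N - eta -> (forall X, In X (map fst L) -> t ^ 2 * t ^ 5 <= Rabs (x - X)) ->
     Cmod (f (x, t ^ 5)) <= K * Rpower (t ^ 5) (- k) * exp (2 * PI * M / t ^ 5 - kap / t)) ->
  is_CInt (fun s => arc k M t s) (- t ^ 2) (t ^ 2) I ->
  let lam := M / (t ^ 5 * t ^ 5) in
  is_CInt (fun x => f (x, t ^ 5)%R * ee (- RtoC lam * (x, t ^ 5)%R))%C (- eta) (- eta + N) v ->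
  Cmod (v - lsum (map (fun p => snd p * ee (- RtoC (lam * fst p)))%C L) * (RtoC (Rpower (t ^ 5) (- k) * t ^ 5) * I))%C
    <= N * (K * Rpower (t ^ 5) (- k) * exp (2 * (2 * PI * M / t ^ 5) - kap / t)).
Proof.
  intros HM HK Ht Ht0 HN Hnd Hgap Hd Heta Hxs Happ Hoff HI lam Hv.
  destruct (pow5_le t ltac:(lra)) as [Py Hyt]. set (y := t ^ 5) in *.
  assert (Ht2 : 0 < t ^ 2 <= 1).
  { split; [apply pow_lt; lra|]. rewrite <- (pow1 2). apply pow_incr. lra. }
  set (w := t ^ 2 * y) in *.
  assert (Pw : 0 < w) by (apply Rmult_lt_0_compat; lra).
  assert (Hwt : w <= t) by (unfold w; rewrite <- (Rmult_1_l t); apply Rmult_le_compat; lra).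
  set (rp := Rpower y (- k)) in *.
  assert (Prp : 0 < rp) by apply Rpower_pos.
  (* The approximate integrand near the cusp [fst p], as a function of [x]; the substitution
     [s = (x - fst p) / y] will produce the factor [y]. *)
  set (G := fun (p : R * C) x => (snd p * rp * ee (- RtoC (lam * fst p)) * arc k M t (/ y * x + - fst p / y)%R)%C).
  assert (Ny : RtoC y <> 0) by (intro Q; injection Q; lra).
  assert (HG : forall p, In p L -> is_CInt (restrict_to (fst p) w (G p)) (- eta) (- eta + N)
    (snd p * ee (- RtoC (lam * fst p)) * (RtoC (rp * y) * I))%C).
  { intros p Hp. specialize (Hxs (fst p) (in_map fst L p Hp)).
    apply is_CInt_restrict_to; try lra.
    replace (snd p * ee (- RtoC (lam * fst p)) * (RtoC (rp * y) * I))%C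
      with (snd p * rp * ee (- RtoC (lam * fst p)) * (/ RtoC (/ y) * I))%C.
    2:{ rewrite RtoC_inv, (RtoC_mult rp y) by lra. field. assumption. }
    unfold G. apply is_CInt_scal. apply (is_CInt_comp_lin (fun s => arc k M t s) (/ y) (- fst p / y)).
    - apply Rgt_not_eq, Rinv_0_lt_compat; lra.
    - replace (/ y * (fst p - w) + - fst p / y) with (- t ^ 2) by (unfold w; field; lra).
      replace (/ y * (fst p + w) + - fst p / y) with (t ^ 2) by (unfold w; field; lra). exact HI. }
  apply (is_CInt_lsum L (fun p => restrict_to (fst p) w (G p))) in HG; [|lra].
  assert (ES : lsum (map (fun p => snd p * ee (- RtoC (lam * fst p)) * (RtoC (rp * y) * I))%C L)
     = (lsum (map (fun p => snd p * ee (- RtoC (lam * fst p)))%C L) * (RtoC (rp * y) * I))%C).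
  { clear. induction L as [|p L IH]; unfold lsum in *; simpl; [ring|]. rewrite IH. ring. }
  rewrite ES in HG. pose proof (is_CInt_minus _ _ _ _ _ _ Hv HG) as HD.
  replace N with ((- eta + N) - - eta) at 1 by ring.
  refine (is_CInt_norm _ (- eta) (- eta + N) _ _ _ _ HD); [lra|].
  intros x Hx. cbv beta.
  (* At the saddle height [lam * y = M / y], so this factor is as large as the peak of [f] and
     doubles the exponent. *)
  assert (Eee : Cmod (ee (- RtoC lam * (x, y))) = exp (2 * PI * M / y)).
  { rewrite Cmod_ee. f_equal. reim. unfold lam. field. lra. }
  replace (exp (2 * (2 * PI * M / y) - kap / t)) with (exp (2 * PI * M / y - kap / t) * exp (2 * PI * M / y))
    by (rewrite <- exp_plus; f_equal; ring).
  rewrite <- Rmult_assoc.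
  pose proof (exp_pos (2 * PI * M / y)) as PE.
  destruct (classic (exists p, In p L /\ Rabs (x - fst p) <= w)) as [[p [Hp Hxp]]|Nex].
  - rewrite (lsum_restrict_near L w d x G p); auto; [|lra].
    set (s := / y * x + - fst p / y).
    assert (Es : s = (x - fst p) / y) by (unfold s; field; lra).
    assert (Hs : Rabs s <= 1).
    { rewrite Es. unfold Rdiv. rewrite Rabs_mult, (Rabs_right (/ y)) by (apply Rle_ge; left; apply Rinv_0_lt_compat; lra).
      apply Rmult_le_reg_r with y; [assumption|]. rewrite Rmult_assoc, Rinv_l, Rmult_1_r, Rmult_1_l by lra.
      apply (Rle_trans _ _ _ Hxp). unfold w. rewrite <- (Rmult_1_l y) at 2. apply Rmult_le_compat_r; lra. }
    specialize (Happ p Hp t s Ht Hs). fold y rp in Happ.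
    assert (Ez : ((x, y) : C) = (fst p + y * (s + Ci))%C).
    { rewrite Es. apply C_ext; reim; field; lra. }
    unfold G. fold s. unfold arc. fold y. fold lam.
    assert (Ex : ee (- RtoC lam * (x, y)) = (ee (- RtoC (lam * fst p)) * ee (- RtoC lam * (y * (s + Ci))))%C).
    { rewrite <- ee_plus, Ez. f_equal. rewrite RtoC_mult. ring. }
    match goal with |- Cmod ?a <= _ => replace a with
     ((f (fst p + y * (s + Ci)) - snd p * rp * (arc_factor k s * ee (M / (y * (s + Ci))))) * ee (- RtoC lam * (x, y)))%C end.
    + rewrite Cmod_mult, Eee. apply Rmult_le_compat_r; [lra|exact Happ].
    + rewrite <- Ez, Ex. ring.
  - rewrite lsum_restrict_far.
    + replace (f (x, y) * ee (- RtoC lam * (x, y)) - 0)%C with (f (x, y) * ee (- RtoC lam * (x, y)))%C by ring.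
      rewrite Cmod_mult, Eee. apply Rmult_le_compat_r; [lra|].
      apply Hoff; [lra|]. intros X HX. apply in_map_iff in HX. destruct HX as [p [<- Hp]].
      apply Rnot_lt_le. intro Q. apply Nex. exists p. split; [assumption|lra].
    + intros p Hp. apply Rnot_le_lt. intro Q. apply Nex. exists p. auto.
Qed.

(** * Choice of the parameter and conclusion *)

(** The main term has size [t^8], namely [t^5] from the change of variable and [t^3] from
    [arc_integral]; the ninth power makes the error smaller by a factor [t]. *)
Lemma exp_ge_pow9 (x : R) : 0 <= x -> (x / 9) ^ 9 <= exp x.
Proof.
  intro Hx. replace x with (9 * (x / 9)) at 2 by field.
  assert (E : exp (9 * (x / 9)) = exp (x / 9) ^ 9).
  { rewrite <- Rpower_pow by apply exp_pos. unfold Rpower. rewrite ln_exp. f_equal. simpl. ring. }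
  rewrite E. apply pow_incr. split; [lra|]. pose proof (exp_ineq1_le (x / 9)). lra.
Qed.

Lemma tenth_root (r : R) : 0 < r -> exists t, 0 < t /\ t ^ 5 * t ^ 5 = r.
Proof.
  intro Hr. exists (Rpower r (/ 10)). split; [apply Rpower_pos|].
  rewrite <- pow_add. rewrite <- Rpower_pow by apply Rpower_pos. rewrite Rpower_mult.
  replace (/ 10 * INR (5 + 5)) with 1 by (simpl; field). apply Rpower_1, Hr.
Qed.

Lemma tenth_power_le (s t : R) : 0 < s -> 0 < t -> s ^ 5 * s ^ 5 <= t ^ 5 * t ^ 5 -> s <= t.
Proof.
  intros Hs Ht H. apply Rnot_lt_le. intro L.
  assert (P : forall n, t ^ S n < s ^ S n).
  { induction n as [|n IH]; [simpl; lra|]. change (t * t ^ S n < s * s ^ S n).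
    apply Rmult_le_0_lt_compat; try assumption; [lra|left; apply pow_lt; assumption]. }
  specialize (P 4%nat). assert (0 < t ^ 5) by (apply pow_lt; assumption).
  assert (t ^ 5 * t ^ 5 < s ^ 5 * s ^ 5) by (apply Rmult_le_0_lt_compat; lra). lra.
Qed.

Lemma slash_one (k : R) (f : C -> C) : slash k f SL2Z_one = f.
Proof.
  apply functional_extensionality. intro z. unfold slash. rewrite denom_one, moebius_one.
  assert (E : Cpowr 1 (- k) = 1).
  { unfold Cpowr, Clog, Carg. rewrite Cmod_1, ln_1. rewrite Re_RtoC, Im_RtoC.
    replace (1 / 1) with 1 by field. rewrite acos_1.
    rewrite <- Cexp_0. f_equal. destruct (Rle_dec 0 0); apply C_ext; reim; ring. }
  rewrite E. ring.
Qed.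

Lemma common_denominator (xs : list R) :
  (forall x, In x xs -> exists D : nat, (1 <= D)%nat /\ exists n : Z, INR D * x = IZR n) ->
  exists D : nat, (1 <= D)%nat /\ forall x, In x xs -> exists n : Z, INR D * x = IZR n.
Proof.
  induction xs as [|x xs IH]; intro H.
  - exists 1%nat. split; [lia|]. intros x [].
  - destruct IH as [D [HD HDx]]; [intros; apply H; right; assumption|].
    destruct (H x (or_introl eq_refl)) as [D' [HD' [n' Hn']]].
    exists (D * D')%nat. split; [nia|]. intros y [<-|Hy]; rewrite mult_INR.
    + exists (Z.of_nat D * n')%Z. rewrite Rmult_assoc, Hn', mult_IZR, <- INR_IZR_INZ. reflexivity.
    + destruct (HDx y Hy) as [n Hn]. exists (Z.of_nat D' * n)%Z.
      rewrite mult_IZR, <- INR_IZR_INZ, <- Hn. ring.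
Qed.

Lemma ee_multiple (x : R) (n : nat) : ee (RtoC (INR n * x)) = Cpow (ee x) n.
Proof.
  induction n as [|n IH].
  - simpl. rewrite Rmult_0_l. apply ee_0.
  - rewrite S_INR, Rmult_plus_distr_r, Rmult_1_l, RtoC_plus, ee_plus, IH. simpl. ring.
Qed.

(** Along the exponents [l0 + n / N] each term is geometric in [n] with ratio [ee (- x / N)]. The
    ratios are distinct because the [x] lie in an interval of length [N], so the sum is non-zero at
    some [n0]. If [D] is a common denominator of the [x], the ratios are roots of unity of order
    dividing [N * D], and the value at [n0] recurs with that period. *)
Lemma leading_sum_periodic (L : list (R * C)) (N : nat) (l0 : R) : (1 <= N)%nat -> L <> nil ->
  NoDup (map fst L) -> (forall p, In p L -> snd p <> 0) ->
  (forall x, In x (map fst L) -> 0 <= x < INR N) ->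
  (forall x, In x (map fst L) -> exists D : nat, (1 <= D)%nat /\ exists n : Z, INR D * x = IZR n) ->
  exists (n0 D : nat) (s0 : R), (1 <= D)%nat /\ 0 < s0 /\ forall m : nat,
    s0 <= Cmod (lsum (map (fun p => snd p * ee (- RtoC ((l0 + INR (n0 + D * m) / INR N) * fst p)))%C L)).
Proof.
  intros HN Hne Hnd Hb Hx Hrat.
  assert (PN : 1 <= INR N) by (apply (le_INR 1); assumption).
  set (q := fun x : R => ee (RtoC (- (x / INR N)))).
  set (l := map (fun p : R * C => ((snd p * ee (- RtoC (l0 * fst p)))%C, q (fst p))) L).
  assert (ES : forall n : nat, lsum (map (fun p => snd p * ee (- RtoC ((l0 + INR n / INR N) * fst p)))%C L)
     = lsum (map (fun p => fst p * snd p ^ n)%C l)).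
  { intro n. unfold l. rewrite map_map. f_equal. apply map_ext. intro p. cbn [fst snd].
    unfold q. rewrite <- ee_multiple, <- Cmult_assoc, <- ee_plus. do 2 f_equal.
    rewrite <- !RtoC_opp, <- RtoC_plus. f_equal. field. lra. }
  assert (Hq : forall x y, In x (map fst L) -> In y (map fst L) -> q x = q y -> x = y).
  { intros x y Px Py E. apply Hx in Px. apply Hx in Py. unfold q in E.
    destruct (ee_R_inj _ _ E) as [n Hn].
    assert (E1 : y - x = IZR n * INR N).
    { replace (IZR n) with (- (x / INR N) + y / INR N) by lra. field. lra. }
    assert (n = 0)%Z.
    { assert (IZR n < IZR 1) by (simpl; nra). assert (IZR (-1) < IZR n) by (simpl; nra).
      apply lt_IZR in H. apply lt_IZR in H0. lia. }
    subst n. simpl in E1. lra. }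
  assert (Ex : exists n : nat, lsum (map (fun p => fst p * snd p ^ n)%C l) <> 0).
  { apply not_all_not_ex. intro H.
    assert (H' : forall n : nat, lsum (map (fun p => fst p * snd p ^ n)%C l) = 0) by (intro n; apply NNPP, H).
    assert (Hndl : NoDup (map snd l)).
    { unfold l. rewrite map_map. cbn [snd].
      replace (map (fun p : R * C => q (fst p)) L) with (map q (map fst L)) by (rewrite map_map; reflexivity).
      apply NoDup_map_NoDup_ForallPairs; [|assumption]. intros x y Px Py. apply Hq; assumption. }
    destruct L as [|p L']; [apply Hne; reflexivity|].
    pose proof (geometric_independent l Hndl H' _ (or_introl eq_refl)) as Z. cbn [fst] in Z.
    revert Z. apply Cmult_neq_0; [apply Hb; left; reflexivity|apply ee_neq_0]. }
  destruct Ex as [n0 Hn0].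
  destruct (common_denominator _ Hrat) as [D [HD HDx]].
  exists n0, (N * D)%nat, (Cmod (lsum (map (fun p => fst p * snd p ^ n0)%C l))).
  split; [nia|]. split; [apply Cmod_gt_0, Hn0|]. intro m. right. f_equal. rewrite ES. f_equal.
  unfold l. rewrite !map_map. apply map_ext_in. intros p Hp. cbn [fst snd].
  rewrite Cpow_add_r, !Cpow_mult_r.
  destruct (HDx (fst p) (in_map fst L p Hp)) as [n Hn].
  assert (E : ((q (fst p) ^ N) ^ D)%C = 1).
  { rewrite <- Cpow_mult_r. unfold q. rewrite <- ee_multiple, mult_INR.
    replace (INR N * INR D * - (fst p / INR N)) with (IZR (- n)) by (rewrite opp_IZR, <- Hn; field; lra).
    apply ee_IZR. }
  rewrite E, Cpow_1_l. ring.
Qed.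

Theorem theorem3 (k : R) (Gamma : SL2Z -> Prop) (f : C -> C)
    (Gamma_subgroup : is_subgroup Gamma)
    (Gamma_finite_index : finite_index Gamma)
    (f_modular : modular_function k Gamma f)
    (f_nonzero : exists z : C, half_plane 0 z /\ f z <> RtoC 0)
    (f_holomorphic : holomorphic_on (half_plane 0) f)
    (k_nonneg : 0 <= k)
    (f_not_finite : ~ finite_at_cusps k f) :
  strongly_non_lacunary f.
Proof.
  destruct f_modular as [_ [[j Hj] Hcusps]].
  assert (Hord : forall g, finite_order_at_infty (slash k f g)) by (intro g; apply Hcusps).
  assert (S : modular_setup k Gamma f j) by (unfold modular_setup; tauto).
  pose proof (holomorphic_Cdiff f f_holomorphic) as Hdiff.
  destruct (conj_T_in Gamma SL2Z_one Gamma_subgroup Gamma_finite_index) as [N [HN HT]].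
  rewrite SL2Z_mul_1_l in HT.
  replace (SL2Z_inv SL2Z_one) with SL2Z_one in HT by (apply SL2Z_ext; reflexivity).
  rewrite SL2Z_mul_1_r in HT.
  assert (PN : 1 <= INR N) by (apply (le_INR 1); assumption).
  destruct (translation_constant k Gamma f j _ f_holomorphic Hj HT) as [u [Hu Hper]].
  rewrite <- INR_IZR_INZ in Hper.
  assert (Hf1 : finite_order_at_infty f) by (rewrite <- (slash_one k f); apply Hord).
  destruct (change_period f (INR N) u f_holomorphic ltac:(lra) Hu Hper Hf1) as [a [Hexp Hfin]].
  destruct (expansion_struct f (INR N) u a Hexp Hfin) as (l0 & y0 & B & HL & _ & HE).
  destruct (dominant_points k Gamma f j N S f_not_finite HN HT)
    as (M & M' & K & eta & xs & HM & HK & Heta & Hnd & Hne & Hglob & Hmain).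
  destruct (off_arcs k f M M' K eta (INR N) xs k_nonneg HM HK Heta Hglob) as (kap1 & t1 & Hkap1 & Ht1 & Hoff).
  assert (PM : 0 < M) by lra.
  destruct (uniform_approx k f M xs k_nonneg PM) as (L & K2 & kap2 & t2 & EL & HK2 & Hkap2 & Ht2 & Happ);
    [intros x Hx; apply Hmain, Hx|].
  destruct (arc_integral k M k_nonneg PM) as (c & t3 & Hc & Ht3 & Harc).
  destruct (list_gap xs) as [d [Hd Hgap]].
  destruct (leading_sum_periodic L N l0 HN) as (n0 & D & s0 & HD & Hs0 & HS).
  { intro E. rewrite E in EL. simpl in EL. congruence. }
  { rewrite EL. assumption. }
  { intros p Hp. apply Happ, Hp. }
  { intros x Hx. rewrite EL in Hx. apply Hmain in Hx. lra. }
  { intros x Hx. rewrite EL in Hx. destruct (Hmain x Hx) as [_ (g & nu & [Hmc _] & ->)].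
    exists (Z.to_nat (mc g)). split; [lia|]. exists (- md g)%Z.
    rewrite INR_IZR_INZ, Z2Nat.id, opp_IZR by lia. unfold pole_point. field.
    apply Rgt_not_eq, IZR_lt. assumption. }
  set (K0 := Rmax K K2). set (kap := Rmin kap1 kap2).
  assert (HK0 : K <= K0 /\ K2 <= K0) by (split; [apply Rmax_l|apply Rmax_r]).
  assert (Hkap : kap <= kap1 /\ kap <= kap2) by (split; [apply Rmin_l|apply Rmin_r]).
  assert (Pkap : 0 < kap) by (apply Rmin_pos; assumption).
  (* By [exp_ge_pow9] the error is at most [Q * t^9], up to factors shared with the main term; [t4]
     is chosen so that [t <= t4] implies [Q * t < s0 * c]. *)
  set (Q := INR N * K0 * (9 / kap) ^ 9).
  assert (PQ : 0 <= Q).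
  { unfold Q. apply Rmult_le_pos; [apply Rmult_le_pos; lra|]. apply pow_le.
    apply Rlt_le, Rdiv_lt_0_compat; lra. }
  set (t4 := s0 * c / (Q + 1)).
  assert (Ht4 : 0 < t4) by (apply Rdiv_lt_0_compat; nra).
  assert (Et4 : t4 * (Q + 1) = s0 * c) by (unfold t4; field; lra).
  set (t0 := Rmin (Rmin (Rmin t1 t2) (Rmin t3 t4)) (Rmin eta (d / 4))).
  assert (Ht0 : t0 <= t1 /\ t0 <= t2 /\ t0 <= t3 /\ t0 <= t4 /\ t0 <= eta /\ t0 <= d / 4).
  { unfold t0. repeat split.
    - eapply Rle_trans; [apply Rmin_l|]. eapply Rle_trans; [apply Rmin_l|]. apply Rmin_l.
    - eapply Rle_trans; [apply Rmin_l|]. eapply Rle_trans; [apply Rmin_l|]. apply Rmin_r.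
    - eapply Rle_trans; [apply Rmin_l|]. eapply Rle_trans; [apply Rmin_r|]. apply Rmin_l.
    - eapply Rle_trans; [apply Rmin_l|]. eapply Rle_trans; [apply Rmin_r|]. apply Rmin_r.
    - eapply Rle_trans; [apply Rmin_r|]. apply Rmin_l.
    - eapply Rle_trans; [apply Rmin_r|]. apply Rmin_r. }
  assert (Pt0 : 0 < t0) by (unfold t0; repeat apply Rmin_pos; lra).
  (* If the coefficient were zero, the estimate would bound the main term, at least [s0 * c * t^8],
     by the error, at most [Q * t^9]. *)
  assert (Key : forall m : nat, M / (t0 ^ 5 * t0 ^ 5) <= l0 + INR (n0 + D * m) / INR N ->
     a (l0 + INR (n0 + D * m) / INR N) <> 0).
  { intros m Hlam Za. set (n := (n0 + D * m)%nat) in *. set (lam := l0 + INR n / INR N) in *.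
    assert (Pt05 : 0 < t0 ^ 5 * t0 ^ 5) by (apply Rmult_lt_0_compat; apply pow_lt; assumption).
    assert (Plam : 0 < lam) by (eapply Rlt_le_trans; [|exact Hlam]; apply Rdiv_lt_0_compat; assumption).
    (* The saddle condition [lam = M / y^2] with [y = t^5]; large [lam] means small [t]. *)
    destruct (tenth_root (M / lam)) as [t [Pt Et]]; [apply Rdiv_lt_0_compat; assumption|].
    assert (Htt : t <= t0).
    { apply tenth_power_le; try assumption. rewrite Et.
      apply Rmult_le_reg_r with lam; [assumption|]. unfold Rdiv. rewrite Rmult_assoc, Rinv_l, Rmult_1_r by lra.
      apply (Rmult_le_compat_l (t0 ^ 5 * t0 ^ 5)) in Hlam; [|lra].
      replace (t0 ^ 5 * t0 ^ 5 * (M / (t0 ^ 5 * t0 ^ 5))) with M in Hlam by (field; lra). exact Hlam. }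
    assert (Py : 0 < t ^ 5) by (apply pow_lt; assumption).
    assert (Elam : lam = M / (t ^ 5 * t ^ 5)) by (rewrite Et; field; lra).
    destruct (Harc t ltac:(lra)) as [I [HI HIlow]].
    pose proof (fourier_coeff_H f (INR N) l0 y0 B u _ n (t ^ 5) (- eta) Hdiff Hper (HL n) HE Py) as Hv.
    cbv beta in Hv. fold lam in Hv. rewrite Za, Elam in Hv.
    pose proof (coefficient_estimate k f M K0 kap t0 eta (INR N) L d t I (INR N * 0)%C) as Hest.
    cbv zeta in Hest. rewrite EL in Hest. rewrite <- Elam in Hest, Hv.
    pose proof (Rpower_pos (t ^ 5) (- k)) as PR.
    assert (Bound : Cmod (INR N * 0 - lsum (map (fun p => snd p * ee (- RtoC (lam * fst p)))%C L) *
        (RtoC (Rpower (t ^ 5) (- k) * t ^ 5) * I))%C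
      <= INR N * (K0 * Rpower (t ^ 5) (- k) * exp (2 * (2 * PI * M / t ^ 5) - kap / t))).
    { apply Hest; try assumption; try lra.
      - intros x Hx. apply Hmain, Hx.
      - intros p Hp. destruct (Happ p Hp) as [_ Ha].
        eapply approximates_mono; [exact Ha| | | |]; lra.
      - intros x Hx HX. eapply Rle_trans; [apply Hoff; try assumption; lra|].
        apply Rmult_le_compat.
        + apply Rmult_le_pos; lra.
        + left; apply exp_pos.
        + apply Rmult_le_compat_r; lra.
        + apply exp_le. unfold Rdiv. assert (0 < / t) by (apply Rinv_0_lt_compat; lra).
          assert (kap * / t <= kap1 * / t) by (apply Rmult_le_compat_r; lra). lra. }
    specialize (HS m). fold n lam in HS. clear Hest.
    set (Sum := lsum (map (fun p => snd p * ee (- RtoC (lam * fst p)))%C L)) in *.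
    replace (INR N * 0 - Sum * (RtoC (Rpower (t ^ 5) (- k) * t ^ 5) * I))%C
      with (- (Sum * (RtoC (Rpower (t ^ 5) (- k) * t ^ 5) * I)))%C in Bound by ring.
    rewrite Cmod_opp, Cmod_mult, Cmod_RtoC_mult in Bound.
    rewrite Rabs_right in Bound by (apply Rle_ge, Rmult_le_pos; lra).
    set (rp := Rpower (t ^ 5) (- k)) in *. set (E2 := exp (2 * (2 * PI * M / t ^ 5))) in *.
    assert (PE2 : 0 < E2) by apply exp_pos.
    unfold Rminus in Bound. rewrite exp_plus in Bound. fold E2 in Bound.
    assert (Pt3 : 0 < t ^ 3) by (apply pow_lt; assumption).
    assert (Low : s0 * (rp * t ^ 5 * (c * t ^ 3 * E2)) <= INR N * (K0 * rp * (E2 * exp (- (kap / t))))).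
    { eapply Rle_trans; [|exact Bound]. apply Rmult_le_compat.
      - lra.
      - repeat apply Rmult_le_pos; lra.
      - exact HS.
      - apply Rmult_le_compat_l; [apply Rmult_le_pos; lra|exact HIlow]. }
    (* The power [y^(-k)] and the factor [exp (2 (2 pi M / y))] occur on both sides and cancel. *)
    assert (Low2 : s0 * c * t ^ 8 <= INR N * K0 * exp (- (kap / t))).
    { apply Rmult_le_reg_r with (rp * E2); [apply Rmult_lt_0_compat; assumption|].
      replace (s0 * c * t ^ 8 * (rp * E2)) with (s0 * (rp * t ^ 5 * (c * t ^ 3 * E2))) by ring.
      replace (INR N * K0 * exp (- (kap / t)) * (rp * E2)) with (INR N * (K0 * rp * (E2 * exp (- (kap / t))))) by ring.
      exact Low. }
    assert (Hexp9 : exp (- (kap / t)) <= (9 / kap) ^ 9 * t ^ 9).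
    { pose proof (exp_ge_pow9 (kap / t)) as H9.
      assert (P9 : 0 < kap / t) by (apply Rdiv_lt_0_compat; assumption). specialize (H9 ltac:(lra)).
      rewrite exp_Ropp. replace ((9 / kap) ^ 9 * t ^ 9) with (/ (kap / t / 9) ^ 9) by (field; lra).
      apply Rinv_le_contravar; [|exact H9]. apply pow_lt. apply Rdiv_lt_0_compat; lra. }
    assert (Low3 : s0 * c * t ^ 8 <= Q * t * t ^ 8).
    { eapply Rle_trans; [exact Low2|]. unfold Q.
      replace (INR N * K0 * (9 / kap) ^ 9 * t * t ^ 8) with (INR N * K0 * ((9 / kap) ^ 9 * t ^ 9)) by ring.
      apply Rmult_le_compat_l; [apply Rmult_le_pos; lra|exact Hexp9]. }
    assert (Pt8 : 0 < t ^ 8) by (apply pow_lt; assumption).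
    apply Rmult_le_reg_r in Low3; [|assumption].
    assert (Q * t <= Q * t4) by (apply Rmult_le_compat_l; lra). lra. }
  destruct (nat_above ((M / (t0 ^ 5 * t0 ^ 5) - l0) * INR N)) as [m0 Hm0].
  exists (INR N), u, a. split; [assumption|]. split; [assumption|].
  exists (l0 + INR (n0 + D * m0) / INR N), D. split; [assumption|]. intro n.
  replace (l0 + INR (n0 + D * m0) / INR N + INR D * / INR N * INR n)
    with (l0 + INR (n0 + D * (m0 + n)) / INR N)
    by (rewrite !plus_INR, !mult_INR, plus_INR; field; lra).
  split; [apply HL|]. apply Key.
  assert (INR m0 <= INR (n0 + D * (m0 + n))) by (apply le_INR; nia).
  apply Rmult_le_reg_r with (INR N); [lra|].
  replace ((l0 + INR (n0 + D * (m0 + n)) / INR N) * INR N) with (l0 * INR N + INR (n0 + D * (m0 + n))) by (field; lra).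
  lra.
Qed.
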